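(* Let the solution $u$ satisfy the decomposition assumption stated in the context (regular part bounds for $0\le i+j\le2$, layer part bounds for $0\le i+j\le 3$). Let $u^I\in V^N$ be the piecewise linear nodal interpolant of $u$ on $\mathcal{T}_N$ and $u^N\in V^N$ the SDFEM solution. Then there is a constant $C$ independent of $\varepsilon$ and $N$ such that $$\Vert u^I-u^{N} \Vert_{\varepsilon}\le \Vert u^I-u^{N} \Vert_{SD}\le C\,(\varepsilon^{1/2} N^{-1}+N^{-3/2})\ln^{3/2}N.$$
   Context: Problem: $\Omega=(0,1)^2$; $u$ is the solution of $-\varepsilon\Delta u+\boldsymbol{b}\cdot\nabla u+cu=f$ in $\Omega$, $u=0$ on $\partial\Omega$, where $\varepsilon>0$ is a small parameter, and $\boldsymbol b=(b_1,b_2)^T$, $c\ge0$, $f$ are sufficiently smooth functions on $\bar\Omega$ with $b_1\ge\beta_1>0$, $b_2\ge\beta_2>0$, $c-\tfrac12\nabla\cdot\boldsymbol b\ge\mu_0>0$ on $\bar\Omega$ for constants $\beta_1,\beta_2,\mu_0$. The constant $C$ (here and in the assumption below) denotes a generic constant independent of $\varepsilon$ and $N$. Decomposition assumption: $u=S+E_1+E_2+E_{12}$ on $\bar\Omega$, with sufficiently smooth functions satisfying, at all $(x,y)\in\bar\Omega$: for $0\le i+j\le 2$, $|\partial_x^i\partial_y^jS|\le C$; and for $0\le i+j\le 3$, $|\partial_x^i\partial_y^jE_1|\le C\varepsilon^{-i}e^{-\beta_1(1-x)/\varepsilon}$, $|\partial_x^i\partial_y^jE_2|\le C\varepsilon^{-j}e^{-\beta_2(1-y)/\varepsilon}$,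 $|\partial_x^i\partial_y^jE_{12}|\le C\varepsilon^{-(i+j)}e^{-(\beta_1(1-x)+\beta_2(1-y))/\varepsilon}$. Shishkin mesh: $N\ge4$ is an even integer; standing assumptions $\varepsilon\le N^{-1}$ and $\lambda_x=\rho\varepsilon\beta_1^{-1}\ln N\le\frac12$, $\lambda_y=\rho\varepsilon\beta_2^{-1}\ln N\le\frac12$, with $\rho=2.5$. Points $0=x_0<\dots<x_N=1$ divide each of $[0,1-\lambda_x]$, $[1-\lambda_x,1]$ into $N/2$ equal intervals; points $0=y_0<\dots<y_N=1$ divide each of $[0,1-\lambda_y]$, $[1-\lambda_y,1]$ into $N/2$ equal intervals. Each rectangle $[x_i,x_{i+1}]\times[y_j,y_{j+1}]$ is split into the triangle $K^1_{i,j}$ with vertices $(x_i,y_j),(x_{i+1},y_j),(x_i,y_{j+1})$ and the triangle $K^2_{i,j}$ with vertices $(x_i,y_{j+1}),(x_{i+1},y_j),(x_{i+1},y_{j+1})$; $\mathcal T_N$ is the resulting triangulation. $\Omega_s=[0,1-\lambda_x]\times[0,1-\lambda_y]$. $V^N\subset H^1_0(\Omega)$ is the space of continuous functions, linear on each triangle of $\mathcal T_N$, vanishing on $\partial\Omega$. SDFEM: $(\cdot,\cdot)_D$, $\Vert\cdot\Vert_D$ are the $L^2(D)$ inner product and norm ($D=\Omega$ when omitted), $|\cdot|_1$ is the $H^1(\Omega)$ seminorm. Let $\delta_K=C^*N^{-1}$ if $K\subset\Omega_s$ and $\delta_K=0$ otherwise, and $$a_{Gal}(w,v)=\varepsilon(\nabla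 w,\nabla v)+(\boldsymbol b\cdot\nabla w+cw,v),\qquad a_{stab}(w,v)=\sum_{K\in\mathcal T_N}(-\varepsilon\Delta w+\boldsymbol b\cdot\nabla w+cw,\ \delta_K\boldsymbol b\cdot\nabla v)_K,$$ $a_{SD}=a_{Gal}+a_{stab}$. The SDFEM solution $u^N\in V^N$ is defined by $a_{SD}(u^N,v^N)=(f,v^N)+\sum_{K}(f,\delta_K\boldsymbol b\cdot\nabla v^N)_K$ for all $v^N\in V^N$. Norms: $$\Vert v\Vert_\varepsilon^2=\varepsilon|v|_1^2+\mu_0\Vert v\Vert^2,\qquad \Vert v\Vert_{SD}^2=\varepsilon|v|_1^2+\mu_0\Vert v\Vert^2+\sum_{K\in\mathcal T_N}\delta_K\Vert\boldsymbol b\cdot\nabla v\Vert_K^2.$$ $C^*>0$ is a constant (independent of $\varepsilon,N$) chosen such that $a_{SD}(v^N,v^N)\ge\frac12\Vert v^N\Vert_{SD}^2$ for all $v^N\in V^N$. *)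

(* Defs.v *)
From HB Require Import structures.
From mathcomp Require Import all_boot all_order all_algebra.
From mathcomp Require Import all_classical all_reals all_analysis.

Set Implicit Arguments.
Unset Strict Implicit.
Unset Printing Implicit Defensive.

Import Order.TTheory GRing.Theory Num.Theory.
Import numFieldNormedType.Exports.

Local Open Scope classical_set_scope.
Local Open Scope ring_scope.

Section square.
Context {R : realType}.

Definition Omega : set (R * R) := [set p | 0 < p.1 < 1 /\ 0 < p.2 < 1].

Definition Omegabar : set (R * R) := [set p | 0 <= p.1 <= 1 /\ 0 <= p.2 <= 1].

Definition bdOmega : set (R * R) := Omegabar `\` Omega.

Definition dx (g : R * R -> R) (p : R * R) : R :=
  derive1 (fun t : R => g (t, p.2)) p.1.

Definition dy (g : R * R -> R) (p : R * R) : R :=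
  derive1 (fun t : R => g (p.1, t)) p.2.

(* [g] is of class C^k on the closed square, and [D i j], for i + j <= k, is
   the partial derivative d_x^i d_y^j g, which exists in the open square and is
   extended continuously to the closed square. Only the values of [g] and
   [D i j] on the closed square matter. *)
Definition Ck_with_partials (k : nat) (g : R * R -> R)
    (D : nat -> nat -> R * R -> R) : Prop :=
  [/\ forall p, Omegabar p -> D 0%N 0%N p = g p,
      forall i j, (i + j <= k)%N -> {within Omegabar, continuous (D i j)},
      forall i j p, (i + j < k)%N -> Omega p ->
        is_derive p.1 1 (fun t => D i j (t, p.2)) (D i.+1 j p) &
      forall i j p, (i + j < k)%N -> Omega p ->
        is_derive p.2 1 (fun t => D i j (p.1, t)) (D i j.+1 p)].

Definition leb2 : {measure set (measurableTypeR R * measurableTypeR R) -> \bar R} :=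
  (@lebesgue_measure R \x @lebesgue_measure R)%E.

Definition L2ip (D : set (R * R)) (g h : R * R -> R) : R :=
  \int[leb2]_(p in D) (g p * h p).

Definition L2normsq (D : set (R * R)) (g : R * R -> R) : R := L2ip D g g.

End square.

(* The data that do not depend on eps and N; [Cstar] is the constant of the
   stabilization parameters. *)
Record sdfem_data (R : realType) := SdfemData {
  coef_b1 : R * R -> R;
  coef_b2 : R * R -> R;
  coef_c : R * R -> R;
  source : R * R -> R;
  beta1 : R;
  beta2 : R;
  mu0 : R;
  Cstar : R }.

Section problem.
Context {R : realType}.
Variable P : sdfem_data R.

(* The coefficients are only required to be as smooth as the problem needs to
   make sense: b is C^1 and c, f are continuous on the closed square. *)
Definition data_ok : Prop :=
  (exists Db1 Db2 : nat -> nat -> R * R -> R,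
    [/\ Ck_with_partials 1 (coef_b1 P) Db1,
        Ck_with_partials 1 (coef_b2 P) Db2 &
        forall p, Omegabar p ->
          mu0 P <= coef_c P p - 2^-1 * (Db1 1%N 0%N p + Db2 0%N 1%N p)]) /\
  [/\ {within Omegabar, continuous (coef_c P)},
      {within Omegabar, continuous (source P)},
      forall p, Omegabar p -> 0 <= coef_c P p,
      (forall p, Omegabar p -> beta1 P <= coef_b1 P p /\ beta2 P <= coef_b2 P p) &
      [/\ 0 < beta1 P, 0 < beta2 P, 0 < mu0 P & 0 < Cstar P]].

Definition is_solution (eps : R) (u : R * R -> R) : Prop :=
  exists Du : nat -> nat -> R * R -> R,
    [/\ Ck_with_partials 2 u Du,
        forall p, Omega p ->
          - eps * (Du 2%N 0%N p + Du 0%N 2%N p)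
          + (coef_b1 P p * Du 1%N 0%N p + coef_b2 P p * Du 0%N 1%N p)
          + coef_c P p * u p = source P p &
        forall p, bdOmega p -> u p = 0].

Definition decomposition (C eps : R) (u : R * R -> R) : Prop :=
  exists S E1 E2 E12 : R * R -> R,
  exists DS DE1 DE2 DE12 : nat -> nat -> R * R -> R,
  [/\ forall p, Omegabar p -> u p = S p + E1 p + E2 p + E12 p,
      [/\ Ck_with_partials 2 S DS, Ck_with_partials 3 E1 DE1,
          Ck_with_partials 3 E2 DE2 & Ck_with_partials 3 E12 DE12],
      forall i j p, (i + j <= 2)%N -> Omegabar p -> `|DS i j p| <= C &
      forall i j p, (i + j <= 3)%N -> Omegabar p ->
        [/\ `|DE1 i j p| <= C * eps ^- i * expR (- (beta1 P * (1 - p.1) / eps)),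
            `|DE2 i j p| <= C * eps ^- j * expR (- (beta2 P * (1 - p.2) / eps)) &
            `|DE12 i j p| <= C * eps ^- (i + j)
              * expR (- ((beta1 P * (1 - p.1) + beta2 P * (1 - p.2)) / eps))]].

Definition transition (beta eps : R) (N : nat) : R :=
  5 / 2 * eps / beta * ln N%:R.

Definition lambda_x (eps : R) (N : nat) : R := transition (beta1 P) eps N.

Definition lambda_y (eps : R) (N : nat) : R := transition (beta2 P) eps N.

Definition mesh_ok (eps : R) (N : nat) : Prop :=
  [/\ (4 <= N)%N, ~~ odd N, 0 < eps, eps <= N%:R^-1 &
      lambda_x eps N <= 2^-1 /\ lambda_y eps N <= 2^-1].

(* i-th node of the mesh dividing each of [0, 1 - lam] and [1 - lam, 1] into
   N / 2 equal intervals *)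
Definition shishkin (lam : R) (N i : nat) : R :=
  if (i <= N./2)%N then i%:R * ((1 - lam) / (N./2)%:R)
  else (1 - lam) + (i - N./2)%:R * (lam / (N./2)%:R).

Section discretization.
Variables (eps : R) (N : nat).

Definition node_x (i : nat) : R := shishkin (lambda_x eps N) N i.

Definition node_y (j : nat) : R := shishkin (lambda_y eps N) N j.

Definition Omega_s : set (R * R) :=
  [set p | 0 <= p.1 <= 1 - lambda_x eps N /\ 0 <= p.2 <= 1 - lambda_y eps N].

(* ((i, j), true) is the triangle K^1_{i,j}, ((i, j), false) is K^2_{i,j} *)
Definition element : finType := ('I_N * 'I_N * bool)%type.

Definition vertices (K : element) : (R * R) * (R * R) * (R * R) :=
  let i : nat := K.1.1 in let j : nat := K.1.2 in
  if K.2 then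
    ((node_x i, node_y j), (node_x i.+1, node_y j), (node_x i, node_y j.+1))
  else
    ((node_x i, node_y j.+1), (node_x i.+1, node_y j),
     (node_x i.+1, node_y j.+1)).

Definition barycenter (K : element) (s t r : R) : R * R :=
  let: (A, B, D) := vertices K in
  (s * A.1 + t * B.1 + r * D.1, s * A.2 + t * B.2 + r * D.2).

Definition triangle (K : element) : set (R * R) :=
  [set p | exists s t r : R,
    [/\ 0 <= s, 0 <= t, 0 <= r, s + t + r = 1 & p = barycenter K s t r]].

(* Interior of the closed triangle; integrals over K are taken over it, because
   the edges are negligible and the classical derivatives of a piecewise linear
   function exist in the interior only. *)
Definition otriangle (K : element) : set (R * R) :=
  [set p | exists s t r : R,
    [/\ 0 < s, 0 < t, 0 < r, s + t + r = 1 & p = barycenter K s t r]].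

Definition VN : set (R * R -> R) :=
  [set v | [/\ {within Omegabar, continuous v},
    forall K : element, exists a0 a1 a2 : R,
      forall p, triangle K p -> v p = a0 + a1 * p.1 + a2 * p.2 &
    forall p, bdOmega p -> v p = 0]].

Definition is_interpolant (u uI : R * R -> R) : Prop :=
  VN uI /\ forall i j, (i <= N)%N -> (j <= N)%N ->
    uI (node_x i, node_y j) = u (node_x i, node_y j).

Definition delta (K : element) : R :=
  if `[< triangle K `<=` Omega_s >] then Cstar P * N%:R^-1 else 0.

Definition bgrad (v : R * R -> R) (p : R * R) : R :=
  coef_b1 P p * dx v p + coef_b2 P p * dy v p.

Definition laplace (v : R * R -> R) (p : R * R) : R :=
  dx (dx v) p + dy (dy v) p.

(* The functions below are applied to elements of [VN] only: their weak
   gradient on Omega is the elementwise classical one, so that the inner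
   products over Omega involving gradients are sums over the triangles. *)
Definition a_Gal (w v : R * R -> R) : R :=
  eps * (\sum_(K : element)
    (L2ip (otriangle K) (dx w) (dx v) + L2ip (otriangle K) (dy w) (dy v)))
  + \sum_(K : element)
      L2ip (otriangle K) (fun p => bgrad w p + coef_c P p * w p) v.

Definition a_stab (w v : R * R -> R) : R :=
  \sum_(K : element)
    L2ip (otriangle K)
      (fun p => - eps * laplace w p + bgrad w p + coef_c P p * w p)
      (fun p => delta K * bgrad v p).

Definition a_SD (w v : R * R -> R) : R := a_Gal w v + a_stab w v.

Definition is_sdfem_solution (uN : R * R -> R) : Prop :=
  VN uN /\ forall v, VN v ->
    a_SD uN v = L2ip Omega (source P) v
      + \sum_(K : element)
          L2ip (otriangle K) (source P) (fun p => delta K * bgrad v p).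

Definition H1seminormsq (v : R * R -> R) : R :=
  \sum_(K : element)
    (L2normsq (otriangle K) (dx v) + L2normsq (otriangle K) (dy v)).

Definition norm_eps (v : R * R -> R) : R :=
  Num.sqrt (eps * H1seminormsq v + mu0 P * L2normsq Omega v).

Definition norm_SD (v : R * R -> R) : R :=
  Num.sqrt (eps * H1seminormsq v + mu0 P * L2normsq Omega v
    + \sum_(K : element) delta K * L2normsq (otriangle K) (bgrad v)).

Definition coercive : Prop :=
  forall v, VN v -> 2^-1 * norm_SD v ^+ 2 <= a_SD v v.

End discretization.
End problem.

(* Main.v *)
(* With chi = u^I - u^N, coercivity and Galerkin orthogonality bound
   ||chi||_SD^2 / 2 by a_SD(u^I - u, chi), whose convection term is integrated by
   parts onto chi. Every term is then estimated triangle by triangle with Young's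
   inequality, so that 3/16 of ||chi||_SD^2 can be absorbed and the remaining
   constants add up to (eps N^-2 + N^-3) ln^3 N.

   Three terms need more than first order interpolation estimates. In the
   diffusion term of the layer functions inside their layers, two triangles sharing a
   horizontal edge are treated together: chi has the same x-slope on both, and the
   integral of d_x (F^I - F) over their union, which is symmetric about the
   midpoint of the edge, vanishes for quadratic F. Outside the layers a layer
   function is bounded by N^(-5/2), and integrals of its derivatives are turned
   into boundary integrals of the function. In the stabilization term on the
   coarse part of the mesh the same is done with the second derivatives, and the
   gradient of chi that appears is controlled by an inverse inequality. *)

Require Import Defs.
From mathcomp Require Import all_boot all_order all_algebra.
From mathcomp Require Import ring lra zify.
From mathcomp Require Import all_classical all_reals all_analysis.
From mathcomp Require Import measurable_realfun.

Import Order.TTheory GRing.Theory Num.Theory.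
Import numFieldNormedType.Exports.
Local Open Scope classical_set_scope.
Local Open Scope ring_scope.

Set Implicit Arguments.
Unset Strict Implicit.
Unset Printing Implicit Defensive.

(** * Continuous functions on the closed square *)

(** The transition factor 5/2 makes a layer function of size [kap], with [kap ^+ 2 = q ^+ 5], beyond
    its transition point. On a fine cell, whose width may be as small as a multiple of [eps * q],
    its slope error is [kap / (eps * q)], and the square of this times [eps] is exactly
    [q ^+ 3 / eps]. Squared errors are measured by the density [weight]: the value
    [L ^+ 2 * q ^+ 3 / eps] is allowed only on a fine strip, whose width [eps * L] turns it into
    [q ^+ 3 * L ^+ 3]; hence the power 3/2 of the logarithm. Patches lose their symmetry in the one
    row where the mesh size changes; being a single row, it can afford a first order estimate. The
    interpolation error is tested against the gradient of [chi]: on coarse cells the stabilization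
    part of the norm controls it at the price [1 / q], elsewhere the diffusion part at the price
    [1 / eps], where again the strip is thin. Estimates in the y-direction follow from those in the
    x-direction by exchanging the coordinates, which maps the triangulation to one of the same
    kind. *)

Definition cont {R : realType} (f : R * R -> R) : Prop :=
  {within Omegabar, continuous f}.

Section continuity.
Context {R : realType}.
Implicit Types f g : R * R -> R.

Lemma contD f g : cont f -> cont g -> cont (fun p => f p + g p).
Proof. by move=> cf cg p; apply: cvgD; [exact: cf|exact: cg]. Qed.

Lemma contN f : cont f -> cont (fun p => - f p).
Proof. by move=> cf p; apply: cvgN; exact: cf. Qed.

Lemma contB f g : cont f -> cont g -> cont (fun p => f p - g p).
Proof. by move=> cf cg; apply: contD => //; exact: contN. Qed.

Lemma contM f g : cont f -> cont g -> cont (fun p => f p * g p).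
Proof. by move=> cf cg p; apply: cvgM; [exact: cf|exact: cg]. Qed.

Lemma contX f n : cont f -> cont (fun p => f p ^+ n).
Proof.
move=> cf; elim: n => [|n ih]; first by move=> p; exact: cvg_cst.
rewrite (_ : (fun p => _) = (fun p => f p * f p ^+ n)); first exact: contM.
by apply/funext => p; rewrite exprS.
Qed.

Lemma cont_cst (a : R) : cont (fun=> a).
Proof. by move=> p; exact: cvg_cst. Qed.

Lemma cont_fst : cont (fun p : R * R => p.1).
Proof. by apply: continuous_subspaceT => p; exact: cvg_fst. Qed.

Lemma cont_snd : cont (fun p : R * R => p.2).
Proof. by apply: continuous_subspaceT => p; exact: cvg_snd. Qed.

Lemma cont_eq f g : (forall p, Omegabar p -> f p = g p) -> cont f -> cont g.
Proof. by move=> fg; apply: subspace_eq_continuous => p /set_mem; exact: fg. Qed.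

(** Serves restriction to lines, restriction to graphs over the y-axis and the exchange of
    coordinates. *)
Lemma cont_comp (T : topologicalType) (A : set T) f (h : T -> R * R) :
  cont f -> continuous h -> (forall t, A t -> Omegabar (h t)) ->
  {within A, continuous (fun t => f (h t))}.
Proof.
move=> /subspace_continuousP cf ch hA; apply/subspace_continuousP => t At.
apply: (@cvg_comp _ _ _ h f _ (within Omegabar (nbhs (h t)))); last exact/cf/hA.
move=> B /= Bh; have := ch t _ Bh.
apply: (@filterS _ (nbhs t)) => s Bs As; apply: Bs; exact: hA.
Qed.

Lemma Omega_open : open (@Omega R).
Proof.
rewrite (_ : Omega = fst @^-1` `]0, 1[ `&` snd @^-1` `]0, 1[).
  apply: openI; (apply: open_comp; last exact: interval_open) => p _.
    exact: cvg_fst.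
  exact: cvg_snd.
by apply/seteqP; split=> -[x y]; rewrite /Omega/= !in_itv.
Qed.

Lemma Omega_sub : @Omega R `<=` Omegabar.
Proof. by move=> p [/andP[? ?] /andP[? ?]]; split; apply/andP; split; exact: ltW. Qed.

Lemma Omegabar_compact : compact (@Omegabar R).
Proof.
rewrite (_ : Omegabar = (`[0, 1] `*` `[0, 1])%classic).
  by apply: compact_setX; exact: segment_compact.
by apply/seteqP; split=> -[x y]; rewrite /Omegabar/= !in_itv.
Qed.

Lemma cont_bounded f : cont f -> exists2 M, 0 <= M & forall p, Omegabar p -> `|f p| <= M.
Proof.
move=> cf.
have /compact_bounded[M [_ HM]] := continuous_compact cf Omegabar_compact.
exists (`|M| + 1) => [|p Op]; first by rewrite addr_ge0.
by apply: HM; [rewrite ltr_pwDr// ler_norm|exists p].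
Qed.

End continuity.

#[global] Hint Resolve cont_cst cont_fst cont_snd : core.

Ltac contt :=
  lazymatch goal with
  | |- cont (fun _ => ?a) => exact: cont_cst
  | |- cont (fun p => (@?f p + @?g p)%R) => apply (@contD _ f g); contt
  | |- cont (fun p => (- @?f p)%R) => apply (@contN _ f); contt
  | |- cont (fun p => (@?f p * @?g p)%R) => apply (@contM _ f g); contt
  | |- cont (fun p => (@?f p ^+ ?n)%R) => apply (@contX _ f n); contt
  | |- cont (fun p => p.1) => exact: cont_fst
  | |- cont (fun p => p.2) => exact: cont_snd
  | |- cont (fun p => ?f p) => match goal with H : cont f |- _ => exact H end
  | |- cont ?f => match goal with H : cont f |- _ => exact H end
  end.

(** * Measurability and integrability on open parts of the square *)

Section integrals.
Context {R : realType}.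
Implicit Types (f g : R * R -> R) (D : set (R * R)).
Local Notation mu := (@lebesgue_measure R).
Local Notation leb2 := (@leb2 R).

(** The measurable sets of [leb2] are those of a product of two Borel algebras, so an open set has
    to be written as a countable union of boxes, here those with rational corners. *)
Lemma open2_measurable D : open D -> @measurable _ (measurableTypeR R * measurableTypeR R)%type D.
Proof.
move=> oD.
pose box (q : rat * rat * (rat * rat)) : set (R * R) :=
  (`]ratr q.1.1, ratr q.1.2[ `*` `]ratr q.2.1, ratr q.2.2[)%classic.
have boxm q : @measurable _ (measurableTypeR R * measurableTypeR R)%type (box q).
  by apply: measurableX; exact: measurable_itv.
(* Boxes not contained in [D] are replaced by the empty set, so that the union runs over a whole
   countable type. *)
rewrite (_ : D = \bigcup_q (if `[< box q `<=` D >] then box q else set0)); last first.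
  apply/seteqP; split => [p Dp|p [q _]]; last by case: asboolP => [h|//]; exact: h.
  have /nbhs_ballP[e /= e0 pe] : nbhs p D by exact: open_nbhs_nbhs.
  have [a1] := @rat_in_itvoo R (p.1 - e) p.1 (ltac:(lra)).
  have [b1] := @rat_in_itvoo R p.1 (p.1 + e) (ltac:(lra)).
  have [a2] := @rat_in_itvoo R (p.2 - e) p.2 (ltac:(lra)).
  have [b2] := @rat_in_itvoo R p.2 (p.2 + e) (ltac:(lra)).
  rewrite !in_itv/= => /andP[h1 h2] /andP[h3 h4] /andP[h5 h6] /andP[h7 h8].
  have bD : box ((a1, b1), (a2, b2)) `<=` D.
    move=> -[x y] [/=]; rewrite !in_itv/= => /andP[h9 h10] /andP[h11 h12].
    by apply: pe; split; rewrite /ball/= ltr_norml; apply/andP; split; lra.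
  exists ((a1, b1), (a2, b2)) => //; rewrite asboolT//.
  by split => /=; rewrite in_itv/=; apply/andP.
apply: countable_bigcupT_measurable => [|q]; first exact: countableP.
by case: asboolP => // _; exact: measurable0.
Qed.

(** Preimages of open intervals are open relative to [D], hence open in the plane because [D] is
    open. *)
Lemma cont_measurable D f : open D -> D `<=` Omega -> cont f ->
  measurable_fun (D : set (measurableTypeR R * measurableTypeR R)) f.
Proof.
move=> oD DO cf; apply: (measurability _ (RGenOpens.measurableE R)).
move=> _ [_ [a [b ->] <-]]; apply: open2_measurable.
have cD : {within D, continuous f}.
  by apply: continuous_subspaceW cf => p /DO; exact: Omega_sub.
have /continuousP/(_ _ (@interval_open R _ _ _ _)) := cD.
move=> /(_ (BRight a) (BLeft b) isT isT).
by rewrite -(open_setSI _ oD).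
Qed.

Lemma leb2_Omega : leb2 Omega = 1%E.
Proof.
rewrite (_ : Omega = (`]0, 1[ `*` `]0, 1[)%classic); last first.
  by apply/seteqP; split=> -[x y]; rewrite /Omega/= !in_itv.
rewrite /leb2/= product_measure1E//=; try exact: measurable_itv.
by rewrite lebesgue_measure_itv/= lte01 sube0 mule1.
Qed.

Lemma leb2_fin D : open D -> D `<=` Omega -> (leb2 D < +oo)%E.
Proof.
move=> oD DO; apply: (@le_lt_trans _ _ (leb2 Omega)); last by rewrite leb2_Omega ltry.
by apply: le_measure => //; rewrite inE; apply: open2_measurable => //; exact: Omega_open.
Qed.

Lemma cont_integrable D f : open D -> D `<=` Omega -> cont f ->
  leb2.-integrable D (EFin \o f).
Proof.
move=> oD DO cf; have [M M0 fM] := cont_bounded cf.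
apply: (@measurable_bounded_integrable _ _ _ leb2 f D).
- exact: open2_measurable.
- exact: leb2_fin.
- exact: cont_measurable.
- exists M; split; first exact: num_real.
  move=> x Mx p Dp; apply: le_trans (ltW Mx); apply: fM; exact/Omega_sub/DO.
Qed.

End integrals.

(** * Integration over planar regions *)

Definition J {R : realType} (D : set (R * R)) (f : R * R -> R) : R :=
  \int[leb2]_(p in D) f p.

Definition I1 {R : realType} (c d : R) (f : R -> R) : R :=
  \int[lebesgue_measure]_(y in `[c, d]) f y.

Definition swap {T : Type} (p : T * T) : T * T := (p.2, p.1).

(** Bounded by graphs over the y-axis, so that integrating an x-derivative leaves a single integral
    in y; open, so that derivatives are needed in the interior only. *)
Definition region {R : realType} (c d : R) (l r : R -> R) : set (R * R) :=
  [set p | c < p.2 < d /\ l p.2 < p.1 < r p.2].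

Section one_dim.
Context {R : realType}.
Implicit Types f g : R -> R.
Local Notation cont1 c d f := {within `[c, d]%classic, continuous f}.
Local Notation mu := (@lebesgue_measure R).

Lemma cont1_integrable c d f : cont1 c d f -> mu.-integrable `[c, d] (EFin \o f).
Proof. by move=> cf; apply: continuous_compact_integrable => //; exact: segment_compact. Qed.

Lemma I1D c d f g : cont1 c d f -> cont1 c d g ->
  I1 c d (fun y => f y + g y) = I1 c d f + I1 c d g.
Proof. by move=> cf cg; rewrite /I1 RintegralD//; exact: cont1_integrable. Qed.

Lemma I1Z c d a f : cont1 c d f -> I1 c d (fun y => a * f y) = a * I1 c d f.
Proof. by move=> cf; rewrite /I1 RintegralZl//; exact: cont1_integrable. Qed.

Lemma le_I1 c d f g : cont1 c d f -> cont1 c d g ->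
  (forall y, c <= y <= d -> f y <= g y) -> I1 c d f <= I1 c d g.
Proof.
move=> cf cg fg; rewrite /I1 le_Rintegral//; exact: cont1_integrable.
Qed.

Lemma eq_I1 c d f g : (forall y, c <= y <= d -> f y = g y) -> I1 c d f = I1 c d g.
Proof.
by move=> fg; apply: eq_Rintegral => y /set_mem/=; rewrite in_itv/=; exact: fg.
Qed.

(** Kept in extended-real form because it is also applied to the inner integral of an iterated
    one. *)
Lemma ftc c d (f F : R -> R) : c < d -> cont1 c d f -> cont1 c d F ->
  (forall y, c < y < d -> is_derive y 1 F (f y)) ->
  (\int[mu]_(y in `[c, d]) (f y)%:E = (F d - F c)%:E)%E.
Proof.
move=> cd cf cF dF; rewrite (@continuous_FTC2 _ f F)//.
  have /(continuous_within_itvP _ cd)[_ Fc Fd] := cF.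
  by split => // y; rewrite in_itv/= => /dF [].
by move=> y; rewrite in_itv/= => /dF h; rewrite derive1E; exact: derive_val.
Qed.

Lemma I1_ftc c d (f F : R -> R) : c < d -> cont1 c d f -> cont1 c d F ->
  (forall y, c < y < d -> is_derive y 1 F (f y)) -> I1 c d f = F d - F c.
Proof. by move=> cd cf cF dF; rewrite /I1 /Rintegral (ftc cd cf cF dF). Qed.

Lemma I1_cst c d (a : R) : c <= d -> I1 c d (fun=> a) = a * (d - c).
Proof.
move=> cd; rewrite /I1 Rintegral_cst; last exact: measurable_itv.
have := @lebesgue_measure_itv R `[c, d]; rewrite /= lte_fin => ->.
by case: ltgtP cd => //= -> _; rewrite subrr.
Qed.

End one_dim.

Section two_dim.
Context {R : realType}.
Implicit Types (f g : R * R -> R) (D : set (R * R)).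
Local Notation mu := (@lebesgue_measure R).
Local Notation leb2 := (@leb2 R).

Section domain.
Variable D : set (R * R).
Hypotheses (oD : open D) (DO : D `<=` Omega).

Lemma JD f g : cont f -> cont g -> J D (fun p => f p + g p) = J D f + J D g.
Proof.
by move=> cf cg; rewrite /J RintegralD//; solve [exact: open2_measurable|exact: cont_integrable].
Qed.

Lemma JZ a f : cont f -> J D (fun p => a * f p) = a * J D f.
Proof.
by move=> cf; rewrite /J RintegralZl//; solve [exact: open2_measurable|exact: cont_integrable].
Qed.

Lemma JB f g : cont f -> cont g -> J D (fun p => f p - g p) = J D f - J D g.
Proof.
by move=> cf cg; rewrite /J RintegralB//; solve [exact: open2_measurable|exact: cont_integrable].
Qed.

Lemma le_J f g : cont f -> cont g -> (forall p, D p -> f p <= g p) -> J D f <= J D g.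
Proof.
by move=> cf cg fg; rewrite /J le_Rintegral//; solve [exact: open2_measurable|exact: cont_integrable].
Qed.

End domain.

Lemma eq_J D f g : (forall p, D p -> f p = g p) -> J D f = J D g.
Proof. by move=> fg; apply: eq_Rintegral => y /set_mem/=; exact: fg. Qed.

Lemma J_fubini D f : open D -> D `<=` Omega -> cont f ->
  (J D f)%:E = (\int[mu]_y \int[mu]_x ((f \_ D) (x, y))%:E)%E.
Proof.
move=> oD DO cf.
have mD := open2_measurable oD.
have /(integrable_mkcond _ mD) fi := cont_integrable oD DO cf.
rewrite /J /Rintegral fineK; last exact/integrable_fin_num/cont_integrable.
rewrite integral_mkcond -integral21_prod_meas1//.
by rewrite restrict_EFin.
Qed.

Lemma J_fubini' D f : open D -> D `<=` Omega -> cont f ->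
  (J D f)%:E = (\int[mu]_x \int[mu]_y ((f \_ D) (x, y))%:E)%E.
Proof.
move=> oD DO cf.
have mD := open2_measurable oD.
have /(integrable_mkcond _ mD) fi := cont_integrable oD DO cf.
rewrite /J /Rintegral fineK; last exact/integrable_fin_num/cont_integrable.
rewrite integral_mkcond -integral12_prod_meas1//.
by rewrite restrict_EFin.
Qed.

Lemma continuous_pair (T : topologicalType) (f g : T -> R) :
  continuous f -> continuous g -> continuous (fun t => (f t, g t)).
Proof.
by move=> cf cg t; apply: (@cvg_pair _ _ _ (nbhs t) (nbhs (f t)) (nbhs (g t)));
  [exact: cf|exact: cg].
Qed.

Lemma continuous_swap : continuous (@swap R).
Proof. by apply: continuous_pair => p; [exact: cvg_snd|exact: cvg_fst]. Qed.

Lemma Omegabar_swap p : @Omegabar R (swap p) <-> Omegabar p.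
Proof. by rewrite /Omegabar/=; split=> -[]. Qed.

Lemma Omega_swap p : @Omega R (swap p) <-> Omega p.
Proof. by rewrite /Omega/=; split=> -[]. Qed.

Lemma cont_swap f : cont f -> cont (fun p => f (swap p)).
Proof.
by move=> cf; apply: cont_comp => //; [exact: continuous_swap|move=> p /Omegabar_swap].
Qed.

Lemma open_swap D : open D -> open (swap @^-1` D).
Proof. by move=> oD; apply: open_comp => // p _; exact: continuous_swap. Qed.

(** Fubini in one order on the left and in the other order on the right gives the same iterated
    integral up to the names of the variables. Statements about y-derivatives are reduced to
    x-derivatives through this. *)
Lemma J_swap D f : open D -> D `<=` Omega -> cont f ->
  J (swap @^-1` D) (fun p => f (swap p)) = J D f.
Proof.
move=> oD DO cf; apply: EFin_inj; rewrite J_fubini'//; last 3 first.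
- exact: open_swap.
- by move=> p /DO/Omega_swap.
- exact: cont_swap.
by rewrite J_fubini.
Qed.

Lemma region_open (c d : R) (l r : R -> R) :
  continuous l -> continuous r -> open (region c d l r).
Proof.
move=> cl cr.
rewrite (_ : region _ _ _ _ = snd @^-1` `]c, d[ `&`
  ((fun p => p.1 - l p.2) @^-1` [set x | 0 < x] `&`
   (fun p => r p.2 - p.1) @^-1` [set x | 0 < x])); last first.
  apply/seteqP; split=> -[x y]; rewrite /region/= in_itv/= !subr_gt0.
    by case=> ? /andP[].
  by case=> ? [? ?]; split => //; apply/andP.
apply: openI; [|apply: openI]; apply: open_comp => [p _|];
  do ?[exact: interval_open|exact: open_gt].
- exact: cvg_snd.
- apply: cvgB; first exact: cvg_fst.
  by apply: (@cvg_comp _ _ _ snd l); [exact: cvg_snd|exact: cl].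
- apply: cvgB; last exact: cvg_fst.
  by apply: (@cvg_comp _ _ _ snd r); [exact: cvg_snd|exact: cr].
Qed.

Section region.
Variables (c d : R) (l r : R -> R).
Hypotheses (c0 : 0 <= c) (cd : c < d) (d1 : d <= 1).
Hypotheses (cl : continuous l) (cr : continuous r).
Hypotheses (lr : forall y, c < y < d -> l y < r y).
Hypotheses (l01 : forall y, c <= y <= d -> 0 <= l y <= 1).
Hypotheses (r01 : forall y, c <= y <= d -> 0 <= r y <= 1).

Lemma region_sub : region c d l r `<=` Omega.
Proof.
move=> p [/andP[cp pd] /andP[lp pr]].
have cpd : c <= p.2 <= d by rewrite !ltW.
have /andP[? ?] := l01 cpd; have /andP[? ?] := r01 cpd.
by split; apply/andP; split; move: c0 d1; lra.
Qed.

Lemma graph_cont G (s : R -> R) : cont G -> continuous s ->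
  (forall y, c <= y <= d -> 0 <= s y <= 1) ->
  {within `[c, d], continuous (fun y => G (s y, y))}.
Proof.
move=> cG cs s01; apply: cont_comp => //.
  by apply: continuous_pair => // y; exact: cvg_id.
move=> y /=; rewrite in_itv/= => cyd; split; first exact: s01.
by case/andP: cyd => ? ?; apply/andP; split; move: c0 d1; rewrite /=; lra.
Qed.

(** Fubini, then the fundamental theorem on each horizontal segment; continuity of [G] up to the
    boundary supplies the values at the endpoints. *)
Lemma J_derivative G Gx : cont G -> cont Gx ->
  (forall p, region c d l r p -> is_derive p.1 1 (fun t => G (t, p.2)) (Gx p)) ->
  J (region c d l r) Gx = I1 c d (fun y => G (r y, y) - G (l y, y)).
Proof.
move=> cG cGx dG; apply: EFin_inj; rewrite J_fubini//; last 2 first.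
- exact: region_open.
- exact: region_sub.
have cH : {within `[c, d], continuous (fun y => G (r y, y) - G (l y, y))}.
  by move=> y; apply: cvgB; exact: graph_cont.
rewrite /I1 /Rintegral fineK; last first.
  exact/integrable_fin_num/cont1_integrable.
(* The region omits its endpoints in y while [I1] includes them; after dropping them both sides are
   integrals over the line of restricted functions, compared for each y. *)
rewrite integral_itv_bndoo; last first.
  apply/measurable_EFinP.
  apply: open_continuous_measurable_fun; first exact: interval_open.
  rewrite -continuous_open_subspace; last exact: interval_open.
  apply: continuous_subspaceW cH; exact: subset_itv_oo_cc.
rewrite [RHS]integral_mkcond; apply: eq_integral => y _.
rewrite patchE; case: ifPn => [/set_mem|/negP]; rewrite ?inE/= in_itv/= => ycd; last first.
  rewrite integral0_eq// => x _; rewrite patchE ifF//.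
  by apply/negP; rewrite inE => -[].
have ycd' : c <= y <= d by case/andP: ycd => *; rewrite !ltW.
have /andP[? ?] := l01 ycd'; have /andP[? ?] := r01 ycd'.
have /andP[? ?] := ycd.
have line x : cont x -> {within `[l y, r y], continuous (fun t => x (t, y))}.
  move=> cx; apply: cont_comp => //.
    by apply: continuous_pair => t; [exact: cvg_id|exact: cvg_cst].
  by move=> t /=; rewrite in_itv/= => /andP[? ?]; split; apply/andP; split; rewrite /=; move: c0 d1; lra.
transitivity (\int[mu]_(x in `[l y, r y]) (Gx (x, y))%:E)%E; last first.
  apply: (@ftc _ _ _ (fun t => Gx (t, y)) (fun t => G (t, y)));
    [exact: lr|exact: line|exact: line|].
  by move=> x xlr; exact: (dG (x, y)).
rewrite integral_itv_bndoo; last first.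
  apply/measurable_EFinP.
  apply: open_continuous_measurable_fun; first exact: interval_open.
  rewrite -continuous_open_subspace; last exact: interval_open.
  apply: continuous_subspaceW (line _ cGx); exact: subset_itv_oo_cc.
rewrite [RHS]integral_mkcond; apply: eq_integral => x _.
rewrite !patchE; case: ifPn => [/set_mem[_ /= xlr]|].
  by rewrite ifT// inE/= in_itv.
move=> h; rewrite ifF//; apply/negP; rewrite inE/= in_itv/= => xlr.
by move/negP: h; apply; rewrite inE.
Qed.

End region.
End two_dim.

(** * Triangles *)

Lemma derive_continuous {R : realType} (f df : R -> R) :
  (forall y : R, is_derive y 1 f (df y)) -> continuous f.
Proof. by move=> h y; apply/differentiable_continuous/derivable1_diffP; case: (h y). Qed.

Section cubic.
Context {R : realType}.
Implicit Types a c d : R.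

(** Centred at [c], so that its integral from [c] is a polynomial in [d - c]. Degree three is what
    the cubed segment lengths in [inverse_x] need. *)
Definition cubic a0 a1 a2 a3 c (y : R) : R :=
  a0 + a1 * (y - c) + a2 * (y - c) ^+ 2 + a3 * (y - c) ^+ 3.

Lemma cubic_continuous a0 a1 a2 a3 c : continuous (cubic a0 a1 a2 a3 c).
Proof.
apply: (@derive_continuous _ _ (fun y => a1 + 2 * a2 * (y - c) + 3 * a3 * (y - c) ^+ 2)).
by move=> y; rewrite /cubic; apply: is_derive_eq; rewrite /GRing.scale/=; ring.
Qed.

Lemma I1_cubic a0 a1 a2 a3 c d : c < d ->
  I1 c d (cubic a0 a1 a2 a3 c) = a0 * (d - c) + a1 / 2 * (d - c) ^+ 2
    + a2 / 3 * (d - c) ^+ 3 + a3 / 4 * (d - c) ^+ 4.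
Proof.
move=> cd.
pose F y := a0 * (y - c) + a1 / 2 * (y - c) ^+ 2 + a2 / 3 * (y - c) ^+ 3
     + a3 / 4 * (y - c) ^+ 4.
have dF (y : R) : is_derive y 1 F (cubic a0 a1 a2 a3 c y).
  by rewrite /F/cubic; apply: is_derive_eq; rewrite /GRing.scale/=; field.
rewrite (@I1_ftc _ c d _ F)//.
- by rewrite /F subrr; ring.
- exact/continuous_subspaceT/cubic_continuous.
- exact/continuous_subspaceT/(derive_continuous dF).
Qed.

Lemma I1_bound c d (f : R -> R) B : c <= d -> {within `[c, d], continuous f} ->
  (forall y, c <= y <= d -> `|f y| <= B) -> `|I1 c d f| <= B * (d - c).
Proof.
move=> cd cf fB; rewrite ler_norml -mulNr -!I1_cst//.
have cc a : {within `[c, d], continuous (fun=> a : R)}.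
  by apply: continuous_subspaceT => ?; exact: cvg_cst.
by apply/andP; split; apply: le_I1 => // y /fB; rewrite ler_norml => /andP[].
Qed.

End cubic.

Definition cell_ok {R : realType} (x0 x1 y0 y1 : R) : Prop :=
  [/\ 0 <= x0, x0 < x1 & x1 <= 1] /\ [/\ 0 <= y0, y0 < y1 & y1 <= 1].

Definition rect {R : realType} (x0 x1 y0 y1 : R) : set (R * R) :=
  [set p | x0 <= p.1 <= x1 /\ y0 <= p.2 <= y1].

(* The diagonal from (x0, y1) to (x1, y0), as a graph over the y-axis. *)
Definition diag {R : realType} (x0 x1 y0 y1 y : R) : R :=
  x1 - (x1 - x0) / (y1 - y0) * (y - y0).

Definition left {R : realType} (x0 x1 y0 y1 : R) (b : bool) : R -> R :=
  if b then cst x0 else diag x0 x1 y0 y1.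

Definition right {R : realType} (x0 x1 y0 y1 : R) (b : bool) : R -> R :=
  if b then diag x0 x1 y0 y1 else cst x1.

(** The open lower left half of the cell for [b = true], the upper right half otherwise. *)
Definition tri {R : realType} (x0 x1 y0 y1 : R) (b : bool) : set (R * R) :=
  region y0 y1 (left x0 x1 y0 y1 b) (right x0 x1 y0 y1 b).

Section triangle.
Context {R : realType}.
Variables (x0 x1 y0 y1 : R).
Hypothesis ok : cell_ok x0 x1 y0 y1.
Implicit Types (f g G : R * R -> R) (b : bool).
Local Notation T := (tri x0 x1 y0 y1).
Local Notation l := (left x0 x1 y0 y1).
Local Notation r := (right x0 x1 y0 y1).
Local Notation h := (x1 - x0).
Local Notation k := (y1 - y0).

Let x01 : x0 < x1. Proof. by case: ok => -[]. Qed.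
Let y01 : y0 < y1. Proof. by case: ok => _ []. Qed.

Lemma diag_continuous : continuous (diag x0 x1 y0 y1).
Proof.
apply: (@derive_continuous _ _ (fun=> - (h / k))) => y; rewrite /diag.
by apply: is_derive_eq; rewrite /GRing.scale/=; ring.
Qed.

Lemma left_continuous b : continuous (l b).
Proof. by case: b; [move=> y; exact: cvg_cst|exact: diag_continuous]. Qed.

Lemma right_continuous b : continuous (r b).
Proof. by case: b; [exact: diag_continuous|move=> y; exact: cvg_cst]. Qed.

Lemma diag_range y : y0 <= y <= y1 -> x0 <= diag x0 x1 y0 y1 y <= x1.
Proof.
move=> /andP[a b]; rewrite /diag mulrAC -mulrA.
have k0 : 0 < k by rewrite subr_gt0.
have t0 : 0 <= (y - y0) / k by rewrite divr_ge0 ?subr_ge0// ltW.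
have t1 : (y - y0) / k <= 1 by rewrite ler_pdivrMr// mul1r; lra.
have h0 : 0 < h by rewrite subr_gt0.
by apply/andP; split; nra.
Qed.

Lemma diag_lt y : y0 < y < y1 -> x0 < diag x0 x1 y0 y1 y < x1.
Proof.
move=> /andP[a b]; rewrite /diag mulrAC -mulrA.
have k0 : 0 < k by rewrite subr_gt0.
have t0 : 0 < (y - y0) / k by rewrite divr_gt0 ?subr_gt0.
have t1 : (y - y0) / k < 1 by rewrite ltr_pdivrMr// mul1r; lra.
have h0 : 0 < h by rewrite subr_gt0.
by apply/andP; split; nra.
Qed.

Lemma left_range b y : y0 <= y <= y1 -> x0 <= l b y <= x1.
Proof. by case: b => [_|/diag_range//]; rewrite /left lexx ltW. Qed.

Lemma right_range b y : y0 <= y <= y1 -> x0 <= r b y <= x1.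
Proof. by case: b => [/diag_range//|_]; rewrite /right lexx ltW. Qed.

Lemma left_lt_right b y : y0 < y < y1 -> l b y < r b y.
Proof. by move=> /diag_lt/andP[? ?]; case: b. Qed.

Lemma rect_sub : rect x0 x1 y0 y1 `<=` Omegabar.
Proof.
case: ok => -[? _ ?] [? _ ?] p [/andP[? ?] /andP[? ?]].
by split; apply/andP; split; lra.
Qed.

Lemma tri_rect b : T b `<=` rect x0 x1 y0 y1.
Proof.
move=> p [/andP[yp py] /andP[lp pr]].
have yy : y0 <= p.2 <= y1 by rewrite !ltW.
have /andP[? ?] := left_range b yy; have /andP[? ?] := right_range b yy.
by split => //; apply/andP; split; lra.
Qed.

Let l01 b y : y0 <= y <= y1 -> 0 <= l b y <= 1.
Proof.
by move=> /(left_range b)/andP[? ?]; case: ok => -[? ? ?] _; apply/andP; split; lra.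
Qed.

Let r01 b y : y0 <= y <= y1 -> 0 <= r b y <= 1.
Proof.
by move=> /(right_range b)/andP[? ?]; case: ok => -[? ? ?] _; apply/andP; split; lra.
Qed.

Lemma tri_open b : open (T b).
Proof. apply: region_open; [exact: left_continuous|exact: right_continuous]. Qed.

Lemma tri_sub b : T b `<=` Omega.
Proof.
case: ok => _ [? _ ?].
by apply: region_sub => // y; [exact: l01|exact: r01].
Qed.

Lemma J_tri_dx b G Gx : cont G -> cont Gx ->
  (forall p, T b p -> is_derive p.1 1 (fun t => G (t, p.2)) (Gx p)) ->
  J (T b) Gx = I1 y0 y1 (fun y => G (r b y, y) - G (l b y, y)).
Proof.
case: ok => _ [? _ ?] cG cGx dG; apply: J_derivative => //.
- exact: left_continuous.
- exact: right_continuous.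
- exact: left_lt_right.
- exact: l01.
- exact: r01.
Qed.

Lemma diff_cont b G : cont G ->
  {within `[y0, y1], continuous (fun y => G (r b y, y) - G (l b y, y))}.
Proof.
case: ok => _ [? _ ?] cG y; apply: cvgB; apply: graph_cont => //.
- exact: right_continuous.
- exact: r01.
- exact: left_continuous.
- exact: l01.
Qed.

(** Only the size of [G] enters, not that of [Gx]. This is what makes layer functions harmless
    outside their layers, where a derivative is still worth a factor [1 / eps]. *)
Lemma J_tri_dx_bound b G Gx B : cont G -> cont Gx ->
  (forall p, T b p -> is_derive p.1 1 (fun t => G (t, p.2)) (Gx p)) ->
  (forall p, rect x0 x1 y0 y1 p -> `|G p| <= B) ->
  `|J (T b) Gx| <= 2 * B * k.
Proof.
move=> cG cGx dG GB; rewrite (J_tri_dx cG cGx dG).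
apply: I1_bound; [exact: ltW|exact: diff_cont|move=> y yy].
apply: le_trans (ler_normB _ _) _; rewrite mulr2n mulrDl mul1r.
by apply: lerD; apply: GB; split => //; [exact: right_range|exact: left_range].
Qed.

(** The contributions of the diagonal cancel. Two separate derivatives are allowed because gradients
    of piecewise linear functions jump there. *)
Lemma J_cell_dx G Gx1 Gx2 : cont G -> cont Gx1 -> cont Gx2 ->
  (forall p, T true p -> is_derive p.1 1 (fun t => G (t, p.2)) (Gx1 p)) ->
  (forall p, T false p -> is_derive p.1 1 (fun t => G (t, p.2)) (Gx2 p)) ->
  J (T true) Gx1 + J (T false) Gx2 = I1 y0 y1 (fun y => G (x1, y) - G (x0, y)).
Proof.
move=> cG c1 c2 d1 d2; rewrite (J_tri_dx cG c1 d1) (J_tri_dx cG c2 d2).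
rewrite -I1D; [|exact: (@diff_cont true)|exact: (@diff_cont false)].
by apply: eq_I1 => y _; rewrite /left/right/=; ring.
Qed.

Let h0 : 0 < h. Proof. by rewrite subr_gt0. Qed.
Let k0 : 0 < k. Proof. by rewrite subr_gt0. Qed.

(** Unlike the definition by graphs, this form is symmetric in the two coordinates; it yields
    [tri_swap] and the comparison with [otriangle]. *)
Lemma tri_trueP p : T true p <->
  [/\ x0 < p.1, y0 < p.2 & (p.1 - x0) * k + (p.2 - y0) * h < h * k].
Proof.
have e : p.1 < diag x0 x1 y0 y1 p.2 <-> (p.1 - x0) * k + (p.2 - y0) * h < h * k.
  rewrite /diag mulrAC -(ltr_pM2r k0) mulrBl divfK ?gt_eqF//.
  by split; lra.
split; first by move=> [/andP[? ?] /= /andP[? /e]].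
case=> a c /[dup] d /e ?; split; apply/andP; split => //.
have : 0 < (p.1 - x0) * k by rewrite mulr_gt0// subr_gt0.
have : (p.2 - y0 < k) = ((p.2 - y0) * h < k * h) by rewrite ltr_pM2r.
by rewrite ltrD2r => -> ?; lra.
Qed.

Lemma tri_falseP p : T false p <->
  [/\ p.1 < x1, p.2 < y1 & (x1 - p.1) * k + (y1 - p.2) * h < h * k].
Proof.
have e : diag x0 x1 y0 y1 p.2 < p.1 <-> (x1 - p.1) * k + (y1 - p.2) * h < h * k.
  rewrite /diag mulrAC -(ltr_pM2r k0) mulrBl divfK ?gt_eqF//.
  by split; lra.
split; first by move=> [/andP[? ?] /= /andP[/e]].
case=> a c /[dup] d /e ?; split; apply/andP; split => //.
have : 0 < (x1 - p.1) * k by rewrite mulr_gt0// subr_gt0.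
have : (y1 - p.2 < k) = ((y1 - p.2) * h < k * h) by rewrite ltr_pM2r.
by rewrite ltrD2l ltrN2 => -> ?; lra.
Qed.

End triangle.

Section triangle_integrals.
Context {R : realType}.
Variables (x0 x1 y0 y1 : R).
Hypothesis ok : cell_ok x0 x1 y0 y1.
Implicit Types (f g G : R * R -> R) (b : bool).
Local Notation T := (tri x0 x1 y0 y1).
Local Notation h := (x1 - x0).
Local Notation k := (y1 - y0).

Let h0 : 0 < h. Proof. by case: ok => -[? ? ?] _; rewrite subr_gt0. Qed.
Let k0 : 0 < k. Proof. by case: ok => _ [? ? ?]; rewrite subr_gt0. Qed.
Let y01 : y0 < y1. Proof. by case: ok => _ []. Qed.

Lemma cell_ok_swap : cell_ok y0 y1 x0 x1.
Proof. by case: ok. Qed.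

Lemma tri_swap b : swap @^-1` T b = tri y0 y1 x0 x1 b.
Proof.
by apply/seteqP; case: b; split => p /=;
  (rewrite (tri_trueP ok) (tri_trueP cell_ok_swap) || rewrite (tri_falseP ok) (tri_falseP cell_ok_swap));
  case=> ? ? /= ?; split => //=; lra.
Qed.

Lemma J_tri_swap b f : cont f ->
  J (tri y0 y1 x0 x1 b) (fun p => f (swap p)) = J (T b) f.
Proof.
move=> cf; rewrite -tri_swap J_swap//; first exact: tri_open.
exact: tri_sub.
Qed.

Lemma area b : J (T b) (fun=> 1) = h * k / 2.
Proof.
rewrite (@J_tri_dx _ _ _ _ _ ok b (fun p => p.1))//.
rewrite (@eq_I1 _ _ _ _ (if b then cubic h (- (h / k)) 0 0 y0 else cubic 0 (h / k) 0 0 y0)).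
  by case: b; rewrite I1_cubic//; field; rewrite gt_eqF.
move=> y yy.
by case: b; rewrite /right/left/cubic/diag/=; ring.
Qed.

(** The area times the abscissa of the centroid. The two centroids of a patch are symmetric about
    the midpoint of the common edge, which [patch_error] exploits. *)
Lemma moment_fst b : J (T b) (fun p => p.1) =
  h * k / 2 * (if b then x0 + h / 3 else x1 - h / 3).
Proof.
apply: etrans.
  apply: (@J_tri_dx _ _ _ _ _ ok b (fun p => 2^-1 * p.1 ^+ 2)) => //.
    by apply: contM => //; exact: contX.
  by move=> p _; apply: is_derive_eq; rewrite /GRing.scale/=; field.
rewrite /= (@eq_I1 _ _ _ _ (if b
  then cubic ((x1 ^+ 2 - x0 ^+ 2) / 2) (- (x1 * h / k)) ((h / k) ^+ 2 / 2) 0 y0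
  else cubic 0 (x1 * h / k) (- ((h / k) ^+ 2 / 2)) 0 y0)).
  by case: b; rewrite I1_cubic//; field; rewrite gt_eqF.
move=> y yy.
by case: b; rewrite /right/left/cubic/diag/=; field; rewrite gt_eqF.
Qed.

Lemma J_cst b a : J (T b) (fun=> a) = a * (h * k / 2).
Proof.
rewrite -(area b) -JZ//; [|exact: tri_open|exact: tri_sub].
by apply: eq_J => p _; rewrite mulr1.
Qed.

Lemma J_bound b f B : cont f -> (forall p, T b p -> `|f p| <= B) ->
  `|J (T b) f| <= B * (h * k / 2).
Proof.
move=> cf fB; rewrite ler_norml -mulNr -!(J_cst b).
by apply/andP; split; apply: le_J => //; try exact: tri_open; try exact: tri_sub;
  move=> p /fB; rewrite ler_norml => /andP[].
Qed.

(** On a horizontal segment of length s the square of an affine function of slope [c] integrates to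
    at least [c ^+ 2 / 12] times the cube of s. Integrating the cubed lengths over y gives
    [h ^+ 3 * k / 4], and 12 times 4 is 48. *)
Lemma inverse_x b a c d :
  c ^+ 2 * h ^+ 3 * k / 48 <= J (T b) (fun p => (a + c * p.1 + d * p.2) ^+ 2).
Proof.
pose G (p : R * R) := (a + d * p.2) ^+ 2 * p.1 + c * (a + d * p.2) * p.1 ^+ 2
  + c ^+ 2 / 3 * p.1 ^+ 3.
have cG : cont G by rewrite /G; contt.
have -> : J (T b) (fun p => (a + c * p.1 + d * p.2) ^+ 2) =
    I1 y0 y1 (fun y => G (right x0 x1 y0 y1 b y, y) - G (left x0 x1 y0 y1 b y, y)).
  apply: J_tri_dx => //.
    contt.
  by move=> p _; rewrite /G/=; apply: is_derive_eq; rewrite /GRing.scale/=; field.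
pose z := c ^+ 2 / 12.
(* The cubed segment length times [z], expanded about [y0]: the length is [h - h / k * (y - y0)] for
   the lower triangle and [h / k * (y - y0)] for the upper one. *)
pose q := if b then cubic (z * h ^+ 3) (- (3 * z * h ^+ 3 / k)) (3 * z * h ^+ 3 / k ^+ 2)
    (- (z * (h / k) ^+ 3)) y0
  else cubic 0 0 0 (z * (h / k) ^+ 3) y0.
have -> : c ^+ 2 * h ^+ 3 * k / 48 = I1 y0 y1 q.
  by rewrite /q /z; case: (b); rewrite I1_cubic//; field; rewrite gt_eqF.
apply: le_I1.
- by rewrite /q; case: (b); apply: continuous_subspaceT; exact: cubic_continuous.
- exact: diff_cont.
move=> y yy.
pose l := left x0 x1 y0 y1 b y; pose r := right x0 x1 y0 y1 b y.
have -> : q y = z * (r - l) ^+ 3.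
  by rewrite /q /l /r; case: (b); rewrite /left/right/diag/cubic/=; field; rewrite gt_eqF.
(* The exact integral of a squared affine function: the length times the squared midpoint value,
   plus the variance term that is kept. *)
have -> : G (r, y) - G (l, y) =
    (r - l) * (a + d * y + c * ((r + l) / 2)) ^+ 2 + z * (r - l) ^+ 3.
  by rewrite /G/z/=; field.
rewrite lerDr mulr_ge0 ?sqr_ge0// subr_ge0.
rewrite /l /r; case: (b); rewrite /left/right/=; have /andP[] := diag_range ok yy; lra.
Qed.

End triangle_integrals.

(** * Sums over a triangulation *)

Definition mesh_sum {R : realType} (N : nat) (F : nat -> nat -> bool -> R) : R :=
  \sum_(i < N) \sum_(j < N) (F i j true + F i j false).

Section mesh_sum.
Context {R : realType}.
Variable N : nat.
Implicit Types F G : nat -> nat -> bool -> R.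

Lemma mesh_sumE F : \sum_(K : element N) F K.1.1 K.1.2 K.2 = mesh_sum N F.
Proof.
rewrite /mesh_sum (eq_bigr (fun K : 'I_N * 'I_N * bool => F K.1.1 K.1.2 K.2))//.
rewrite -(pair_big xpredT xpredT (fun (p : 'I_N * 'I_N) b => F p.1 p.2 b))/=.
rewrite -(pair_big xpredT xpredT
  (fun i j : 'I_N => \sum_(b : bool) F i j b))/=.
by apply: eq_bigr => i _; apply: eq_bigr => j _; rewrite big_bool.
Qed.

Lemma eq_mesh_sum F G :
  (forall i j b, (i < N)%N -> (j < N)%N -> F i j b = G i j b) -> mesh_sum N F = mesh_sum N G.
Proof. by move=> FG; apply: eq_bigr => i _; apply: eq_bigr => j _; rewrite !FG. Qed.

Lemma le_mesh_sum F G :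
  (forall i j b, (i < N)%N -> (j < N)%N -> F i j b <= G i j b) -> mesh_sum N F <= mesh_sum N G.
Proof.
by move=> FG; apply: ler_sum => i _; apply: ler_sum => j _; apply: lerD; exact: FG.
Qed.

Lemma mesh_sumD F G : mesh_sum N (fun i j b => F i j b + G i j b) = mesh_sum N F + mesh_sum N G.
Proof.
rewrite /mesh_sum -big_split/=; apply: eq_bigr => i _; rewrite -big_split/=.
by apply: eq_bigr => j _; rewrite addrACA.
Qed.

Lemma mesh_sumZ a F : mesh_sum N (fun i j b => a * F i j b) = a * mesh_sum N F.
Proof.
rewrite /mesh_sum big_distrr/=; apply: eq_bigr => i _; rewrite big_distrr/=.
by apply: eq_bigr => j _; rewrite mulrDr.
Qed.

Lemma mesh_sum_ge0 F :
  (forall i j b, (i < N)%N -> (j < N)%N -> 0 <= F i j b) -> 0 <= mesh_sum N F.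
Proof.
by move=> F0; apply: sumr_ge0 => i _; apply: sumr_ge0 => j _; apply: addr_ge0; exact: F0.
Qed.

Lemma mesh_sum_swap F : mesh_sum N F = mesh_sum N (fun i j => F j i).
Proof. by rewrite /mesh_sum exchange_big. Qed.

End mesh_sum.

(* The i-th cell in the x-direction is (X i, X i.+1); b = true is the lower left
   triangle of the cell. *)
Definition mesh_tri {R : realType} (X Y : nat -> R) (i j : nat) (b : bool) : set (R * R) :=
  tri (X i) (X i.+1) (Y j) (Y j.+1) b.

Definition partition01 {R : realType} (N : nat) (X : nat -> R) : Prop :=
  [/\ X 0%N = 0, X N = 1 & forall i, (i < N)%N -> X i < X i.+1].

Section mesh.
Context {R : realType}.
Variables (N : nat) (X Y : nat -> R).
Hypotheses (pX : partition01 N X) (pY : partition01 N Y).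
Implicit Types (f G : R * R -> R).

Lemma partition_le (Z : nat -> R) i j :
  partition01 N Z -> (i <= j)%N -> (j <= N)%N -> Z i <= Z j.
Proof.
case=> _ _ Z_lt; elim: j => [|j ih]; first by rewrite leqn0 => /eqP ->.
rewrite leq_eqVlt => /predU1P[->//|]; rewrite ltnS => ij jN.
by apply: le_trans (ih ij (ltnW jN)) _; exact/ltW/Z_lt.
Qed.

Lemma partition_range (Z : nat -> R) i :
  partition01 N Z -> (i <= N)%N -> 0 <= Z i <= 1.
Proof.
move=> pZ iN; case: (pZ) => Z0 Z1 _; rewrite -{1}Z0 -Z1.
by rewrite !(partition_le pZ).
Qed.

Lemma mesh_cell i j : (i < N)%N -> (j < N)%N -> cell_ok (X i) (X i.+1) (Y j) (Y j.+1).
Proof.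
move=> iN jN; case: (pX) (pY) => _ _ X_lt [_ _ Y_lt]; split; split; do ?[exact: X_lt|exact: Y_lt].
- by have /andP[] := partition_range pX (ltnW iN).
- by have /andP[] := partition_range pX iN.
- by have /andP[] := partition_range pY (ltnW jN).
- by have /andP[] := partition_range pY jN.
Qed.

Lemma sum_steps (Z : nat -> R) n m : (n <= m)%N ->
  \sum_(n <= i < m) (Z i.+1 - Z i) = Z m - Z n.
Proof. exact: telescope_sumr. Qed.

Lemma total_area : mesh_sum N (fun i j _ => (X i.+1 - X i) * (Y j.+1 - Y j) / 2) = 1.
Proof.
rewrite /mesh_sum; under eq_bigr => i _ do under eq_bigr => j _ do
  rewrite -splitr.
under eq_bigr => i _ do rewrite -mulr_sumr.
rewrite -mulr_suml.
have sZ (Z : nat -> R) : partition01 N Z -> \sum_(i < N) (Z i.+1 - Z i) = 1.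
  move=> [Z0 Z1 _]; rewrite -(big_mkord xpredT (fun i => Z i.+1 - Z i)).
  by rewrite sum_steps// Z0 Z1 subr0.
by rewrite !sZ// mulr1.
Qed.

Lemma mesh_tri_inj i j b i' j' b' p : (i < N)%N -> (j < N)%N -> (i' < N)%N -> (j' < N)%N ->
  mesh_tri X Y i j b p -> mesh_tri X Y i' j' b' p -> [/\ i = i', j = j' & b = b'].
Proof.
move=> iN jN i'N j'N.
have open_rect n m c : (n < N)%N -> (m < N)%N -> mesh_tri X Y n m c p ->
    X n < p.1 < X n.+1 /\ Y m < p.2 < Y m.+1.
  move=> nN mN [yp /andP[lp pr]]; split => //.
  have [[_ x01 _] _] := mesh_cell nN mN.
  have /andP[a1 a2] := diag_lt (mesh_cell nN mN) yp.
  by case: c lp pr; rewrite /left/right/= => *; apply/andP; split; lra.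
have sep (Z : nat -> R) n m t : partition01 N Z -> (n < N)%N -> (m < N)%N ->
    Z n < t < Z n.+1 -> Z m < t < Z m.+1 -> n = m.
  move=> pZ nN mN /andP[a1 a2] /andP[b1 b2].
  case: (ltngtP n m) => // nm.
    by have H := partition_le pZ nm (ltnW mN); exfalso; clear -a1 a2 b1 b2 H; lra.
  by have H := partition_le pZ nm (ltnW nN); exfalso; clear -a1 a2 b1 b2 H; lra.
move=> /[dup] /(open_rect _ _ _ iN jN)[px py] Tp /[dup] /(open_rect _ _ _ i'N j'N)[px' py'] Tp'.
have ii := sep _ _ _ _ pX iN i'N px px'.
have jj := sep _ _ _ _ pY jN j'N py py'.
split => //; subst i' j'.
have ok := mesh_cell iN jN.
case: b b' Tp Tp' => -[]// Tp Tp'.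
  have /(tri_trueP ok)[? ? ?] := Tp; have /(tri_falseP ok)[? ? ?] := Tp'; lra.
have /(tri_trueP ok)[? ? ?] := Tp'; have /(tri_falseP ok)[? ? ?] := Tp; lra.
Qed.

(** Nothing has to be proved about the edges: the disjoint open triangles have total area 1, the
    measure of [Omega], so what they miss is a null set. *)
Lemma J_mesh f : cont f -> J Omega f = mesh_sum N (fun i j b => J (mesh_tri X Y i j b) f).
Proof.
pose T (K : element N) := mesh_tri X Y K.1.1 K.1.2 K.2.
have okK (K : element N) := mesh_cell (ltn_ord K.1.1) (ltn_ord K.1.2).
have oT K : open (T K) by exact: tri_open.
have TO K : T K `<=` Omega by apply: tri_sub; exact: okK.
pose U := \big[setU/set0]_(K <- index_enum (element N)) T K.
have oU : open U.
  by apply: big_ind => [||K _]; [exact: open0|exact: openU|exact: oT].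
have UO : U `<=` Omega.
  apply: (big_ind (fun A : set (R * R) => A `<=` Omega)) => [//|A B AO BO p [/AO|/BO]//|K _]; exact: TO.
have J_U g : cont g -> J U g = mesh_sum N (fun i j b => J (mesh_tri X Y i j b) g).
  move=> cg; rewrite -mesh_sumE/= /J /Rintegral.
  rewrite integral_bigsetU_EFin/=; first last.
  - by apply/measurable_EFinP; exact: cont_measurable.
  - move=> [[i j] b] [[i' j'] b'] _ _ [p [Tp Tp']].
    have [] := mesh_tri_inj (ltn_ord i) (ltn_ord j) (ltn_ord i') (ltn_ord j') Tp Tp'.
    by move=> /= /val_inj -> /val_inj -> ->.
  - exact: index_enum_uniq.
  - by move=> K; exact: open2_measurable.
  rewrite -sum_fine// => K _; apply: integrable_fin_num.
    exact: open2_measurable.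
  exact: (cont_integrable (oT K) (TO K) cg).
move=> cf; rewrite -J_U//.
have mU := open2_measurable oU; have mO := open2_measurable (@Omega_open R).
(* Additivity over the triangles, applied to the constant function 1, measures their union. *)
have U1 : leb2 U = 1%E.
  have := J_U _ (@cont_cst R 1).
  rewrite (eq_mesh_sum (G := fun i j _ => (X i.+1 - X i) * (Y j.+1 - Y j) / 2)); last first.
    by move=> i j b iN jN; rewrite area//; exact: mesh_cell.
  rewrite total_area /J Rintegral_cst// mul1r.
  have : (leb2 U < +oo)%E by exact: leb2_fin.
  by rewrite -ge0_fin_numE// => /fineK e h; rewrite -e h.
have mD : @measurable _ (measurableTypeR R * measurableTypeR R)%type (Omega `\` U).
  exact: measurableD.
have D0 : leb2 (Omega `\` U) = 0%E.
  rewrite measureD//; last by apply: leb2_fin => //; exact: Omega_open.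
  rewrite (setIidr UO); transitivity (1 - 1 : \bar R)%E; last by rewrite subee.
  by congr (_ - _)%E; [exact: leb2_Omega|exact: U1].
rewrite /J /Rintegral (negligible_integral _ _ _ D0)//.
  by rewrite setDD (setIidr UO).
by apply: cont_integrable => //; exact: Omega_open.
Qed.

(** Elementwise integration without jump terms: [G] is continuous across edges, so the vertical
    sides telescope along each row and the two outer ones vanish. [Gx] itself may jump. *)
Lemma sum_J_dx G (Gx : nat -> nat -> bool -> R * R -> R) : cont G ->
  (forall i j b, (i < N)%N -> (j < N)%N -> cont (Gx i j b)) ->
  (forall i j b p, (i < N)%N -> (j < N)%N -> mesh_tri X Y i j b p ->
    is_derive p.1 1 (fun t => G (t, p.2)) (Gx i j b p)) ->
  (forall p, bdOmega p -> G p = 0) ->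
  mesh_sum N (fun i j b => J (mesh_tri X Y i j b) (Gx i j b)) = 0.
Proof.
move=> cG cGx dG G0.
pose H j i := I1 (Y j) (Y j.+1) (fun y => G (X i, y)).
have line i j : (i <= N)%N -> (j < N)%N ->
    {within `[Y j, Y j.+1], continuous (fun y => G (X i, y))}.
  move=> iN jN; apply: cont_comp => //.
    by apply: continuous_pair => t; [exact: cvg_cst|exact: cvg_id].
  move=> t /=; rewrite in_itv/= => /andP[? ?]; split; first exact: partition_range.
  have /andP[? ?] := partition_range pY (ltnW jN).
  have /andP[? ?] := partition_range pY jN.
  by apply/andP; split; rewrite /=; lra.
rewrite /mesh_sum (eq_bigr (fun i : 'I_N => \sum_(j < N) (H j i.+1 - H j i))); last first.
  move=> i _; apply: eq_bigr => j _.
  apply: etrans.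
    apply: (J_cell_dx (mesh_cell (ltn_ord i) (ltn_ord j)) cG).
    - exact: cGx.
    - exact: cGx.
    - by move=> p; exact: dG.
    - by move=> p; exact: dG.
  rewrite /H -[X in _ - X]mul1r -mulNr -I1Z; last exact: line (ltnW (ltn_ord i)) _.
  rewrite -I1D; [|exact: line|]; last first.
    by move=> y; apply: cvgM; [exact: cvg_cst|exact: (line _ _ (ltnW (ltn_ord i)))].
  by apply: eq_I1 => y _; rewrite mulN1r.
rewrite exchange_big/= big1// => j _.
rewrite -(big_mkord xpredT (fun i => H j i.+1 - H j i)) telescope_sumr//.
have [X0 X1 _] := pX.
rewrite /H X0 X1.
have /andP[? ?] := partition_range pY (ltnW (ltn_ord j)).
have /andP[? ?] := partition_range pY (ltn_ord j).
rewrite (@eq_I1 _ _ _ _ (fun=> 0)) ?(@eq_I1 _ _ _ (fun y => G (0, y)) (fun=> 0)) ?subrr//.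
  move=> y /andP[? ?]; apply: G0; split.
    by split; apply/andP; split; rewrite /=; lra.
  by case=> /andP[] /=; rewrite ltxx.
move=> y /andP[? ?]; apply: G0; split.
  by split; apply/andP; split; rewrite /=; lra.
by case=> /andP[] /=; rewrite ltxx.
Qed.

End mesh.

Section mesh_y.
Context {R : realType}.
Variables (N : nat) (X Y : nat -> R).
Hypotheses (pX : partition01 N X) (pY : partition01 N Y).

Lemma J_mesh_swap i j b f : (i < N)%N -> (j < N)%N -> cont f ->
  J (mesh_tri Y X j i b) (fun p => f (swap p)) = J (mesh_tri X Y i j b) f.
Proof. by move=> iN jN; exact: J_tri_swap (mesh_cell pX pY iN jN) _ _. Qed.

Lemma sum_J_dy G (Gy : nat -> nat -> bool -> R * R -> R) : cont G ->
  (forall i j b, (i < N)%N -> (j < N)%N -> cont (Gy i j b)) ->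
  (forall i j b p, (i < N)%N -> (j < N)%N -> mesh_tri X Y i j b p ->
    is_derive p.2 1 (fun t => G (p.1, t)) (Gy i j b p)) ->
  (forall p, bdOmega p -> G p = 0) ->
  mesh_sum N (fun i j b => J (mesh_tri X Y i j b) (Gy i j b)) = 0.
Proof.
move=> cG cGy dG G0; rewrite mesh_sum_swap.
apply: etrans; last apply: (@sum_J_dx _ _ _ _ pY pX (fun p => G (swap p))
  (fun i j b p => Gy j i b (swap p))).
- by apply: eq_mesh_sum => i j b iN jN; rewrite J_mesh_swap//; exact: cGy.
- exact: cont_swap.
- by move=> *; apply: cont_swap; exact: cGy.
- move=> i j b [x y] iN jN Tp; apply: (dG j i b (y, x)) => //.
  by rewrite /mesh_tri -(tri_swap (mesh_cell pY pX iN jN)).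
- by move=> p [Op nOp]; apply: G0; split; [exact/Omegabar_swap|move=> /Omega_swap].
Qed.

End mesh_y.

(** * Interpolation errors on a cell *)

(* Partial derivatives up to total order n, with D 0 0 the function itself. *)
Definition smooth {R : realType} (n : nat) (D : nat -> nat -> R * R -> R) : Prop :=
  [/\ forall i j, (i + j <= n)%N -> cont (D i j),
      forall i j p, (i + j < n)%N -> Omega p ->
        is_derive p.1 1 (fun t => D i j (t, p.2)) (D i.+1 j p) &
      forall i j p, (i + j < n)%N -> Omega p ->
        is_derive p.2 1 (fun t => D i j (p.1, t)) (D i j.+1 p)].

Definition swapD {R : realType} (D : nat -> nat -> R * R -> R) i j (p : R * R) : R :=
  D j i (swap p).

Section mean_value.
Context {R : realType}.
Implicit Types g gx gy : R * R -> R.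

(** Derivatives exist in the open square only, while a cell may touch its boundary. Estimates
    obtained on interior lines pass to boundary lines by this lemma. *)
Lemma le_closure c d (phi : R -> R) K : c < d -> {within `[c, d], continuous phi} ->
  (forall y, c < y < d -> phi y <= K) -> forall y, c <= y <= d -> phi y <= K.
Proof.
move=> cd cphi le_in y /andP[]; have /(continuous_within_itvP _ cd)[_ pc pd] := cphi.
rewrite le_eqVlt => /predU1P[<- _|cy]; last first.
  rewrite le_eqVlt => /predU1P[->|yd]; last by apply: le_in; rewrite cy.
  apply: (cvgr_to_le pd); near=> t; apply: le_in.
  by apply/andP; split; near: t; [exact: nbhs_left_gt|exact: nbhs_left_lt].
apply: (cvgr_to_le pc); near=> t; apply: le_in.
by apply/andP; split; near: t; [exact: nbhs_right_gt|exact: nbhs_right_lt].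
Unshelve. all: by end_near. Qed.

Section cell.
Variables (x0 x1 y0 y1 : R).
Hypothesis ok : cell_ok x0 x1 y0 y1.
Local Notation box := (rect x0 x1 y0 y1).
Local Notation h := (x1 - x0).
Local Notation k := (y1 - y0).

Let hor_cont g y : cont g -> y0 <= y <= y1 -> {within `[x0, x1], continuous (fun x => g (x, y))}.
Proof.
move=> cg yy; apply: cont_comp => //.
  by apply: continuous_pair => t; [exact: cvg_id|exact: cvg_cst].
by move=> t /=; rewrite in_itv/= => xx; apply: (rect_sub ok).
Qed.

Let ver_cont g x : cont g -> x0 <= x <= x1 -> {within `[y0, y1], continuous (fun y => g (x, y))}.
Proof.
move=> cg xx; apply: cont_comp => //.
  by apply: continuous_pair => t; [exact: cvg_cst|exact: cvg_id].
by move=> t /=; rewrite in_itv/= => yy; apply: (rect_sub ok).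
Qed.

Lemma mvt_le g gx (M : R) a b y : cont g ->
  (forall p, Omega p -> is_derive p.1 1 (fun t => g (t, p.2)) (gx p)) ->
  (forall p, box p -> gx p <= M) ->
  x0 <= a -> a <= b -> b <= x1 -> y0 <= y <= y1 -> g (b, y) - g (a, y) <= M * (b - a).
Proof.
move=> cg dg gM xa ab bx yy.
have [[X0 _ X1] [Y0 y01 Y1]] := ok.
have xb : x0 <= b <= x1 by apply/andP; split => //; exact: le_trans ab.
have xa' : x0 <= a <= x1 by apply/andP; split => //; exact: le_trans bx.
move: y yy; apply: le_closure => //.
  by move=> z; apply: cvgB; exact: ver_cont.
move=> y /andP[yy0 yy1].
have yy : y0 <= y <= y1 by rewrite !ltW.
move: ab; rewrite le_eqVlt => /predU1P[->|ab]; first by rewrite !subrr mulr0.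
have [||c] := @MVT _ (fun t => g (t, y)) (fun t => gx (t, y)) a b ab.
- move=> x; rewrite in_itv/= => /andP[ax xb'].
  by apply: (dg (x, y)); split; apply/andP; split; rewrite /=; lra.
- apply: continuous_subspaceW (hor_cont cg yy); apply: subset_itvScc; rewrite bnd_simp//.
rewrite in_itv/= => /andP[ac cb] ->.
apply: ler_wpM2r; first by rewrite subr_ge0 ltW.
by apply: gM; split => //; apply/andP; split; rewrite /=; lra.
Qed.

(** One form for two purposes: [A = 0] gives Lipschitz bounds, and [A] equal to a slope or a
    derivative at a point gives interpolation and Taylor remainders. *)
Lemma mvt_x g gx (A B : R) a b y : cont g ->
  (forall p, Omega p -> is_derive p.1 1 (fun t => g (t, p.2)) (gx p)) ->
  (forall p, box p -> `|gx p - A| <= B) ->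
  x0 <= a <= x1 -> x0 <= b <= x1 -> y0 <= y <= y1 ->
  `|g (b, y) - g (a, y) - A * (b - a)| <= B * `|b - a|.
Proof.
move=> cg dg gAB; wlog ab : a b / a <= b => [hw|] xa xb yy.
  have [ab|ba] := leP a b; first by apply: hw.
  have := hw b a (ltW ba) xb xa yy; rewrite (distrC a b) -[X in X <= _]normrN; apply: le_trans.
  by rewrite le_eqVlt; apply/orP; left; apply/eqP; congr `|_|; ring.
have /andP[? ?] := xa; have /andP[? ?] := xb.
rewrite [X in _ <= _ * X]ger0_norm ?subr_ge0// ler_norml; apply/andP; split.
  suff : - g (b, y) - - g (a, y) <= (B - A) * (b - a) by lra.
  apply: (@mvt_le (fun p => - g p) (fun p => - gx p)) => //.
  - exact: contN.
  - by move=> p /dg dp; apply: is_derive_eq.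
  - by move=> p /gAB; rewrite ler_norml => /andP[? ?]; lra.
suff : g (b, y) - g (a, y) <= (A + B) * (b - a) by lra.
apply: (@mvt_le g gx) => //.
by move=> p /gAB; rewrite ler_norml => /andP[? ?]; lra.
Qed.

End cell.
End mean_value.

Lemma smooth_swap {R : realType} n (D : nat -> nat -> R * R -> R) :
  smooth n D -> smooth n (swapD D).
Proof.
case=> cD dD1 dD2; split.
- by move=> i j ij; apply: cont_swap; apply: cD; rewrite addnC.
- by move=> i j p ij Op; apply: (dD2 j i (swap p)); [rewrite addnC|exact/Omega_swap].
- by move=> i j p ij Op; apply: (dD1 j i (swap p)); [rewrite addnC|exact/Omega_swap].
Qed.

Lemma rect_swap {R : realType} (x0 x1 y0 y1 : R) p :
  rect y0 y1 x0 x1 (swap p) <-> rect x0 x1 y0 y1 p.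
Proof. by rewrite /rect/=; split=> -[]. Qed.

(* The horizontal edge of the triangle [tri x0 x1 y0 y1 b] lies on the line
   y = y0 if b = true, y = y1 otherwise; hence the x-slope on the triangle of
   the linear interpolant of g at the vertices. *)
Definition slope {R : realType} (x0 x1 y0 y1 : R) (b : bool) (g : R * R -> R) : R :=
  let y := if b then y0 else y1 in (g (x1, y) - g (x0, y)) / (x1 - x0).

Section interpolation.
Context {R : realType}.
Implicit Types (A B M : R) (g gx gy : R * R -> R) (D : nat -> nat -> R * R -> R).

Section cell.
Variables (x0 x1 y0 y1 : R).
Hypothesis ok : cell_ok x0 x1 y0 y1.
Local Notation box := (rect x0 x1 y0 y1).
Local Notation h := (x1 - x0).
Local Notation k := (y1 - y0).

Let h0 : 0 < h. Proof. by case: ok => -[? ? ?] _; rewrite subr_gt0. Qed.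
Let k0 : 0 < k. Proof. by case: ok => _ [? ? ?]; rewrite subr_gt0. Qed.

Lemma mvt_y g gy (A B : R) a b x : cont g ->
  (forall p, Omega p -> is_derive p.2 1 (fun t => g (p.1, t)) (gy p)) ->
  (forall p, box p -> `|gy p - A| <= B) ->
  x0 <= x <= x1 -> y0 <= a <= y1 -> y0 <= b <= y1 ->
  `|g (x, b) - g (x, a) - A * (b - a)| <= B * `|b - a|.
Proof.
move=> cg dg gAB xx ya yb.
apply: (@mvt_x _ _ _ _ _ (cell_ok_swap ok) (fun p => g (swap p)) (fun p => gy (swap p))) => //.
- exact: cont_swap.
- by move=> p /Omega_swap; exact: dg.
- by move=> p /rect_swap; exact: gAB.
Qed.

Lemma dist_le (a b c d : R) : a <= b <= c -> a <= d <= c -> `|b - d| <= c - a.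
Proof. by move=> /andP[? ?] /andP[? ?]; rewrite ler_norml; apply/andP; split; lra. Qed.

Lemma bound_ge0 g B : (forall p, box p -> `|g p| <= B) -> 0 <= B.
Proof.
move=> gB; apply: le_trans (gB (x0, y0) _); first exact: normr_ge0.
by split; rewrite /= lexx ltW// -subr_gt0.
Qed.

Lemma lipschitz_rect g gx gy B1 B2 : cont g ->
  (forall p, Omega p -> is_derive p.1 1 (fun t => g (t, p.2)) (gx p)) ->
  (forall p, Omega p -> is_derive p.2 1 (fun t => g (p.1, t)) (gy p)) ->
  (forall p, box p -> `|gx p| <= B1) -> (forall p, box p -> `|gy p| <= B2) ->
  forall p q, box p -> box q -> `|g p - g q| <= B1 * h + B2 * k.
Proof.
move=> cg dx dy gx1 gy2 [x y] [x' y'] [/= xx yy] [/= xx' yy'].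
have -> : g (x, y) - g (x', y') =
    (g (x, y) - g (x', y) - 0 * (x - x')) + (g (x', y) - g (x', y') - 0 * (y - y')) by ring.
apply: le_trans (ler_normD _ _) _; apply: lerD.
  apply: le_trans (_ : B1 * `|x - x'| <= _).
    by apply: (mvt_x ok cg dx) => // p /gx1; rewrite subr0.
  by rewrite ler_wpM2l ?(bound_ge0 gx1)// dist_le.
apply: le_trans (_ : B2 * `|y - y'| <= _).
  by apply: (mvt_y cg dy) => // p /gy2; rewrite subr0.
by rewrite ler_wpM2l ?(bound_ge0 gy2)// dist_le.
Qed.

Section error.
Variables (b : bool) (D : nat -> nat -> R * R -> R).
Local Notation v1 := (slope x0 x1 y0 y1 b (D 0 0)).

(** [v1] is the mean of [D 1 0] over the horizontal edge, so the error is at most the oscillation of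
    [D 1 0] on the cell. *)
Lemma slope_error n M20 M11 : smooth n D -> (2 <= n)%N ->
  (forall p, box p -> `|D 2 0 p| <= M20) -> (forall p, box p -> `|D 1 1 p| <= M11) ->
  forall p, box p -> `|D 1 0 p - v1| <= M20 * h + M11 * k.
Proof.
move=> [cD dD1 dD2] n2 m20 m11 p rp; set B := (X in _ <= X).
have n1 : (1 < n)%N by [].
have n0 : (0 < n)%N by exact: ltnW.
have lip q : box q -> `|D 1 0 q - D 1 0 p| <= B.
  move=> rq; apply: (@lipschitz_rect (D 1 0) (D 2 0) (D 1 1)) => //.
  - exact: cD.
  - by move=> ? ?; exact: dD1.
  - by move=> ? ?; exact: dD2.
pose y := if b then y0 else y1.
have yy : y0 <= y <= y1 by rewrite /y; case: b; rewrite lexx ltW// -subr_gt0.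
have := @mvt_x _ _ _ _ _ ok (D 0 0) (D 1 0) (D 1 0 p) B x0 x1 y.
move=> /(_ (cD 0 0 (leq0n _)) (fun q => dD1 0 0 q n0) lip).
have x01 : x0 <= x1 by rewrite ltW// -subr_gt0.
rewrite !lexx x01 => /(_ isT isT yy).
have -> : v1 = (D 0 0 (x1, y) - D 0 0 (x0, y)) / h by [].
rewrite (gtr0_norm h0) -ler_pdivrMr// -(gtr0_norm h0) -normf_div (gtr0_norm h0).
apply: le_trans; rewrite -normrN le_eqVlt; apply/orP; left; apply/eqP.
by congr `|_|; field; rewrite gt_eqF.
Qed.

Lemma slope_le B : (forall p, box p -> `|D 0 0 p| <= B) -> `|v1| * h <= 2 * B.
Proof.
move=> FB; rewrite /slope normrM normfV (gtr0_norm h0) divfK ?gt_eqF//.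
apply: le_trans (ler_normB _ _) _; rewrite mulr2n mulrDl mul1r.
by apply: lerD; apply: FB; split => /=; case: (b); rewrite lexx ltW// -subr_gt0.
Qed.

(** Uses the size of the function alone: 2 from the boundary integral of [D 0 0], 1 from the slope,
    whose product with [h] is at most [2 * B]. *)
Lemma J_slope_error_le n B : smooth n D -> (1 <= n)%N ->
  (forall p, box p -> `|D 0 0 p| <= B) ->
  `|J (tri x0 x1 y0 y1 b) (fun p => v1 - D 1 0 p)| <= 3 * B * k.
Proof.
move=> [cD dD1 dD2] n1 FB; rewrite JB//; try exact: tri_open; try exact: tri_sub; last exact: cD.
rewrite J_cst//; apply: le_trans (ler_normB _ _) _.
have J1 : `|J (tri x0 x1 y0 y1 b) (D 1 0)| <= 2 * B * k.
  apply: (J_tri_dx_bound ok (cD 0 0 _) (cD 1 0 _)) => // p /(tri_sub ok) Op.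
  exact: dD1.
have J2 : `|v1 * (h * k / 2)| <= B * k.
  have hk : 0 < h * k / 2 by rewrite divr_gt0// mulr_gt0.
  rewrite normrM (gtr0_norm hk) (_ : _ * _ = `|v1| * h * (k / 2)); last by field.
  rewrite (_ : B * k = 2 * B * (k / 2)); last by field.
  by apply: ler_wpM2r; [exact/ltW/divr_gt0|exact: slope_le FB].
lra.
Qed.

Lemma J_slope_error_smooth n M20 M11 : smooth n D -> (2 <= n)%N ->
  (forall p, box p -> `|D 2 0 p| <= M20) -> (forall p, box p -> `|D 1 1 p| <= M11) ->
  `|J (tri x0 x1 y0 y1 b) (fun p => v1 - D 1 0 p)| <= (M20 * h + M11 * k) * (h * k / 2).
Proof.
move=> sD n2 m20 m11; apply: J_bound => //.
  by case: sD => cD _ _; apply: contB => //; apply: cD; exact: ltnW.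
by move=> p /(tri_rect ok) rp; rewrite distrC; exact: (slope_error sD).
Qed.

End error.
End cell.
End interpolation.

(* Linear interpolant of g at the three vertices of [tri x0 x1 y0 y1 b]. *)
Definition interp {R : realType} (x0 x1 y0 y1 : R) (b : bool) (g : R * R -> R) (p : R * R) : R :=
  let x := if b then x0 else x1 in let y := if b then y0 else y1 in
  g (x, y) + slope x0 x1 y0 y1 b g * (p.1 - x)
  + slope y0 y1 x0 x1 b (fun q => g (swap q)) * (p.2 - y).

Section interpolant.
Context {R : realType}.
Implicit Types (A B M : R) (g gx gy : R * R -> R) (D : nat -> nat -> R * R -> R).

Section cell.
Variables (x0 x1 y0 y1 : R).
Hypothesis ok : cell_ok x0 x1 y0 y1.
Local Notation box := (rect x0 x1 y0 y1).
Local Notation h := (x1 - x0).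
Local Notation k := (y1 - y0).

Let h0 : 0 < h. Proof. by case: ok => -[? ? ?] _; rewrite subr_gt0. Qed.
Let k0 : 0 < k. Proof. by case: ok => _ [? ? ?]; rewrite subr_gt0. Qed.

Let base b : box (if b then x0 else x1, if b then y0 else y1).
Proof. by split; case: b => /=; rewrite lexx ltW// -subr_gt0. Qed.

Lemma interp_le b g B : (forall p, box p -> `|g p| <= B) ->
  forall p, box p -> `|interp x0 x1 y0 y1 b g p| <= 5 * B.
Proof.
move=> gB p [px py]; rewrite /interp; have [xx yy] := base b.
set x := if b then x0 else x1 in xx *; set y := if b then y0 else y1 in yy *.
have s1 : `|slope x0 x1 y0 y1 b g * (p.1 - x)| <= 2 * B.
  apply: le_trans (slope_le ok b (D := fun _ _ => g) gB).
  by rewrite normrM ler_wpM2l// (dist_le px xx).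
have s2 : `|slope y0 y1 x0 x1 b (fun q => g (swap q)) * (p.2 - y)| <= 2 * B.
  have gB' q : rect y0 y1 x0 x1 q -> `|g (swap q)| <= B by move=> /rect_swap/gB.
  apply: le_trans (slope_le (cell_ok_swap ok) b (D := fun _ _ q => g (swap q)) gB').
  by rewrite normrM ler_wpM2l// (dist_le py yy).
have s0 : `|g (x, y)| <= B by exact: gB.
apply: le_trans (ler_normD _ _) _; apply: le_trans (lerD (ler_normD _ _) (lexx _)) _.
lra.
Qed.

(** The vertex with the right angle is joined to [p] by a vertical and a horizontal segment; on
    each, the derivative differs from the interpolated slope by [slope_error]. The path may leave
    the triangle but not the cell, which is why all bounds are taken on the cell. *)
Lemma interp_error b D n (M20 M11 M02 : R) : smooth n D -> (2 <= n)%N ->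
  (forall p, box p -> `|D 2 0 p| <= M20) ->
  (forall p, box p -> `|D 1 1 p| <= M11) ->
  (forall p, box p -> `|D 0 2 p| <= M02) ->
  forall p, box p -> `|interp x0 x1 y0 y1 b (D 0 0) p - D 0 0 p|
    <= (M20 * h + M11 * k) * h + (M02 * k + M11 * h) * k.
Proof.
move=> sD n2 m20 m11 m02 p [px py]; rewrite /interp; have [xx yy] := base b.
set x := if b then x0 else x1 in xx *; set y := if b then y0 else y1 in yy *.
set v1 := slope x0 x1 y0 y1 b _; set v2 := slope y0 y1 x0 x1 b _.
have [cD dD1 dD2] := sD.
have n1 : (0 < n)%N by exact: ltnW.
have e1 q : box q -> `|D 1 0 q - v1| <= M20 * h + M11 * k.
  exact: (slope_error ok b sD n2 m20 m11).
have e2 q : box q -> `|D 0 1 q - v2| <= M02 * k + M11 * h.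
  case: q => [q1 q2] rq.
  have m02' r : rect y0 y1 x0 x1 r -> `|swapD D 2 0 r| <= M02.
    by move=> /rect_swap; exact: m02.
  have m11' r : rect y0 y1 x0 x1 r -> `|swapD D 1 1 r| <= M11.
    by move=> /rect_swap; exact: m11.
  have := slope_error (cell_ok_swap ok) b (smooth_swap sD) n2 m02' m11'.
  have /rect_swap rq' := rq.
  by move=> /(_ _ rq'); rewrite {1}/swapD/=.
have a1 : `|D 0 0 (p.1, p.2) - D 0 0 (x, p.2) - v1 * (p.1 - x)| <= (M20 * h + M11 * k) * h.
  apply: le_trans (_ : (M20 * h + M11 * k) * `|p.1 - x| <= _).
    by apply: (mvt_x ok (cD 0 0 _) _ e1) => // q Oq; exact: dD1.
  by rewrite ler_wpM2l ?(dist_le px xx)//; apply: le_trans (e1 _ (base b)).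
have a2 : `|D 0 0 (x, p.2) - D 0 0 (x, y) - v2 * (p.2 - y)| <= (M02 * k + M11 * h) * k.
  apply: le_trans (_ : (M02 * k + M11 * h) * `|p.2 - y| <= _).
    by apply: (mvt_y ok (cD 0 0 _) _ e2) => // q Oq; exact: dD2.
  by rewrite ler_wpM2l ?(dist_le py yy)//; apply: le_trans (e2 _ (base b)).
rewrite distrC.
rewrite (_ : D 0 0 p - _ = (D 0 0 (p.1, p.2) - D 0 0 (x, p.2) - v1 * (p.1 - x))
  + (D 0 0 (x, p.2) - D 0 0 (x, y) - v2 * (p.2 - y))); last first.
  by rewrite -surjective_pairing; ring.
by apply: le_trans (ler_normD _ _) _; exact: lerD.
Qed.

Lemma moment_snd b : J (tri x0 x1 y0 y1 b) (fun p => p.2) =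
  h * k / 2 * (if b then y0 + k / 3 else y1 - k / 3).
Proof.
rewrite -(J_tri_swap ok b cont_snd).
by rewrite (moment_fst (cell_ok_swap ok)) (mulrC k).
Qed.

(** Integration by parts on one triangle: the derivative of [g] is traded for the length of the
    boundary and a derivative of [phi]. *)
Lemma J_parts_bound b g gx phi phix B (F F' : R) : cont g -> cont gx -> cont phi -> cont phix ->
  (forall p, Omega p -> is_derive p.1 1 (fun t => g (t, p.2)) (gx p)) ->
  (forall p, Omega p -> is_derive p.1 1 (fun t => phi (t, p.2)) (phix p)) ->
  (forall p, box p -> `|g p| <= B) -> (forall p, box p -> `|phi p| <= F) ->
  (forall p, box p -> `|phix p| <= F') ->
  `|J (tri x0 x1 y0 y1 b) (fun p => gx p * phi p)| <= 2 * (B * F) * k + B * F' * (h * k / 2).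
Proof.
move=> cg cgx cp cpx dg dp gB pF pF'.
have bM (f1 f2 : R * R -> R) (b1 b2 : R) p : `|f1 p| <= b1 -> `|f2 p| <= b2 ->
    `|f1 p * f2 p| <= b1 * b2.
  by move=> h1 h2; rewrite normrM; apply: ler_pM.
have -> : J (tri x0 x1 y0 y1 b) (fun p => gx p * phi p) =
   J (tri x0 x1 y0 y1 b) (fun p => gx p * phi p + g p * phix p)
   - J (tri x0 x1 y0 y1 b) (fun p => g p * phix p).
  rewrite -JB; [|exact: tri_open|exact: tri_sub|apply: contD; exact: contM|exact: contM].
  by apply: eq_J => p _; rewrite addrK.
apply: le_trans (ler_normB _ _) _; apply: lerD.
  apply: (J_tri_dx_bound ok (G := fun p => g p * phi p)).
  - exact: contM.
  - by apply: contD; exact: contM.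
  - move=> p /(tri_sub ok) Op; have ? := dg p Op; have ? := dp p Op.
    by apply: is_derive_eq; rewrite /GRing.scale/= -surjective_pairing; ring.
  - by move=> p rp; apply: bM; [exact: gB|exact: pF].
apply: J_bound => //; first exact: contM.
by move=> p /(tri_rect ok) rp; apply: bM; [exact: gB|exact: pF'].
Qed.

End cell.

Section patch.
Variables (x0 x1 y0 y1 y2 : R).
Hypotheses (ok1 : cell_ok x0 x1 y0 y1) (ok2 : cell_ok x0 x1 y1 y2).
Hypothesis symm : y2 - y1 = y1 - y0.
Local Notation box := (rect x0 x1 y0 y2).
Local Notation h := (x1 - x0).
Local Notation k := (y1 - y0).

Let ok : cell_ok x0 x1 y0 y2.
Proof.
by case: ok1 ok2 symm => ? [? ? ?] [_ [? ? ?]] ?; split => //; split => //; lra.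
Qed.

(* The patch formed by the two triangles sharing the horizontal edge at y = y1 is
   symmetric about the midpoint of that edge, so that v - d_x F integrates to zero
   over it when F is quadratic. *)
Lemma patch_error D (M30 M21 M12 : R) : smooth 3 D ->
  (forall p, box p -> `|D 3 0 p| <= M30) ->
  (forall p, box p -> `|D 2 1 p| <= M21) ->
  (forall p, box p -> `|D 1 2 p| <= M12) ->
  forall v, v = slope x0 x1 y1 y2 true (D 0 0) ->
  `|J (tri x0 x1 y1 y2 true) (fun p => v - D 1 0 p) + J (tri x0 x1 y0 y1 false) (fun p => v - D 1 0 p)|
    <= 2 * (M30 * h ^+ 2 + 3 * M21 * h * k + 2 * M12 * k ^+ 2) * (h * k).
Proof.
move=> [cD dD1 dD2] m30 m21 m12 v vE.
have [[? x01 ?] [? ? ?]] := ok; have [_ [? ? ?]] := ok1; have sy := symm.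
(* The midpoint of the shared edge: [D 1 0] is expanded there to first order, with linear part [lin]
   and remainder at most [B]. *)
pose xm := (x0 + x1) / 2; pose m : R * R := (xm, y1).
have rm : box m by split; apply/andP; split; rewrite /=/xm; lra.
set B := M30 * h ^+ 2 + 3 * M21 * h * k + 2 * M12 * k ^+ 2.
have k2 : y2 - y0 = 2 * k by lra.
have l20 q : box q -> `|D 2 0 q - D 2 0 m| <= M30 * h + M21 * (2 * k).
  move=> rq; rewrite -k2; apply: (@lipschitz_rect _ _ _ _ _ ok (D 2 0) (D 3 0) (D 2 1)) => //.
  - exact: cD.
  - by move=> *; exact: dD1.
  - by move=> *; exact: dD2.
have l11 q : box q -> `|D 1 1 q - D 1 1 m| <= M21 * h + M12 * (2 * k).
  move=> rq; rewrite -k2; apply: (@lipschitz_rect _ _ _ _ _ ok (D 1 1) (D 2 1) (D 1 2)) => //.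
  - exact: cD.
  - by move=> *; exact: dD1.
  - by move=> *; exact: dD2.
pose lin (p : R * R) := D 2 0 m * (p.1 - xm) + D 1 1 m * (p.2 - y1).
have taylor p : box p -> `|D 1 0 p - lin p - D 1 0 m| <= B.
  move=> [px py].
  have a1 : `|D 1 0 (p.1, p.2) - D 1 0 (xm, p.2) - D 2 0 m * (p.1 - xm)|
      <= (M30 * h + M21 * (2 * k)) * h.
    apply: le_trans (_ : (M30 * h + M21 * (2 * k)) * `|p.1 - xm| <= _).
      apply: (@mvt_x _ _ _ _ _ ok (D 1 0) (D 2 0)) => //; first exact: cD.
        by move=> *; exact: dD1.
      by case: rm.
    rewrite ler_wpM2l ?(dist_le px)//; last by case: rm.
    by apply: le_trans (l20 _ rm).
  have a2 : `|D 1 0 (xm, p.2) - D 1 0 (xm, y1) - D 1 1 m * (p.2 - y1)|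
      <= (M21 * h + M12 * (2 * k)) * k.
    apply: le_trans (_ : (M21 * h + M12 * (2 * k)) * `|p.2 - y1| <= _).
      apply: (@mvt_y _ _ _ _ _ ok (D 1 0) (D 1 1)) => //; first exact: cD.
      - by move=> *; exact: dD2.
      - by case: rm.
      - by apply/andP; split; lra.
    rewrite ler_wpM2l//; first by apply: le_trans (l11 _ rm).
    by move: py => /andP[? ?]; rewrite ler_norml; apply/andP; split; lra.
  rewrite (_ : _ - _ - _ = (D 1 0 (p.1, p.2) - D 1 0 (xm, p.2) - D 2 0 m * (p.1 - xm))
    + (D 1 0 (xm, p.2) - D 1 0 (xm, y1) - D 1 1 m * (p.2 - y1))); last first.
    by rewrite /lin -surjective_pairing; ring.
  apply: le_trans (ler_normD _ _) _; rewrite (_ : B = (M30 * h + M21 * (2 * k)) * h +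
    (M21 * h + M12 * (2 * k)) * k); [exact: lerD|by rewrite /B; ring].
have h0 : 0 < h by rewrite subr_gt0.
have vm : `|v - D 1 0 m| <= B.
  (* An x-antiderivative of [lin] is subtracted. It takes equal values at both ends of the edge, so
     [G] has the same increment as [D 0 0] while its derivative is within [B] of the constant
     [D 1 0 m]. *)
  pose G (p : R * R) := D 0 0 p - (D 2 0 m / 2 * (p.1 - xm) ^+ 2 + D 1 1 m * (p.2 - y1) * p.1).
  have : `|G (x1, y1) - G (x0, y1) - D 1 0 m * (x1 - x0)| <= B * `|x1 - x0|.
    apply: (@mvt_x _ _ _ _ _ ok G (fun p => D 1 0 p - lin p)) => //;
      do ?[by apply/andP; split; lra].
      rewrite /G; apply: contB; first exact: cD.
      contt.
    move=> p Op; have ? := dD1 0 0 p isT Op; rewrite /G/=.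
    by apply: is_derive_eq; rewrite /lin /GRing.scale/=; field.
  rewrite (gtr0_norm h0) -ler_pdivrMr// -(gtr0_norm h0) -normf_div (gtr0_norm h0).
  apply: le_trans; rewrite le_eqVlt; apply/orP; left; apply/eqP.
  by congr `|_|; rewrite vE/slope/G/=/xm; field; rewrite gt_eqF.
have sub1 := tri_sub ok2 (b := true); have sub2 := tri_sub ok1 (b := false).
have clin : cont lin by rewrite /lin; contt.
have split_J (T : set (R * R)) : open T -> T `<=` Omega ->
    J T (fun p => v - D 1 0 p) = (v - D 1 0 m) * J T (fun=> 1) - J T lin
      - J T (fun p => D 1 0 p - lin p - D 1 0 m).
  move=> oT TO; rewrite -JZ// -!JB//; do ?[by repeat first [exact: cD|apply: contB|apply: contM]].
  by apply: eq_J => p _; ring.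
have lin_split (T : set (R * R)) : open T -> T `<=` Omega ->
    J T lin = D 2 0 m * (J T (fun p => p.1) - xm * J T (fun=> 1))
      + D 1 1 m * (J T (fun p => p.2) - y1 * J T (fun=> 1)).
  move=> oT TO; rewrite -!JZ// -!JB//; try exact: contM.
  rewrite -!JZ// -?JD//; do ?[by apply: contM => //; apply: contB => //; exact: contM].
  - by apply: eq_J => p _; rewrite /lin; ring.
  - by apply: contB => //; exact: contM.
  - by apply: contB => //; exact: contM.
rewrite !split_J ?lin_split//; do ?[exact: tri_open].
rewrite !(area ok1) !(area ok2) !(moment_fst ok1) !(moment_fst ok2) !(moment_snd ok1) !(moment_snd ok2) symm.
have r1 : `|J (tri x0 x1 y1 y2 true) (fun p => D 1 0 p - lin p - D 1 0 m)| <= B * (h * k / 2).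
  rewrite -symm; apply: (J_bound ok2); first by repeat first [exact: cD|apply: contB].
  move=> p /(tri_rect ok2) [px /andP[? ?]]; apply: taylor; split => //.
  by apply/andP; split; lra.
have r2 : `|J (tri x0 x1 y0 y1 false) (fun p => D 1 0 p - lin p - D 1 0 m)| <= B * (h * k / 2).
  apply: (J_bound ok1); first by repeat first [exact: cD|apply: contB].
  move=> p /(tri_rect ok1) [px /andP[? ?]]; apply: taylor; split => //.
  by apply/andP; split; lra.
set j1 := J _ _ in r1 *; set j2 := J _ _ in r2 *.
(* The centroids of the two triangles average to [m] and the areas agree, so the integrals of [lin]
   cancel; only remainders are left. *)
rewrite [X in `|X|](_ : _ = (v - D 1 0 m) * (h * k) - j1 - j2); last first.
  by rewrite /xm; field.
have hk : 0 <= h * k by rewrite mulr_ge0 ?ltW// subr_gt0.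
have vhk : `|(v - D 1 0 m) * (h * k)| <= B * (h * k).
  by rewrite normrM (ger0_norm hk) ler_wpM2r.
apply: le_trans (ler_normB _ _) _.
apply: le_trans (lerD (ler_normB _ _) (lexx _)) _.
lra.
Qed.

End patch.
End interpolant.

(** * The Shishkin mesh and the finite element space *)

Section shishkin_mesh.
Context {R : realType}.
Variables (lam : R) (N : nat).
Hypotheses (lam0 : 0 < lam) (lam1 : lam <= 2^-1) (N4 : (4 <= N)%N) (evenN : ~~ odd N).
Local Notation X := (shishkin lam N).

Let N2 : N = (N./2 + N./2)%N.
Proof. by rewrite addnn -[LHS]odd_double_half (negbTE evenN). Qed.

Let n0 : 0 < (N./2)%:R :> R.
Proof. by rewrite ltr0n; case: N N4 => [|[]]. Qed.

Let Nn : N%:R = 2 * (N./2)%:R :> R.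
Proof. by rewrite {1}N2 natrD; ring. Qed.

Definition step (i : nat) : R := if (i < N./2)%N then (1 - lam) / (N./2)%:R else lam / (N./2)%:R.

Lemma shishkin_step i : X i.+1 - X i = step i.
Proof.
rewrite /shishkin /step; case: (ltnP i N./2) => [ni|ni].
  by rewrite (ltnW ni) -natr1; ring.
move: ni; rewrite leq_eqVlt => /predU1P[<-|ni].
  by rewrite leqnn subSn// subnn; field; rewrite gt_eqF.
have -> : (i <= N./2)%N = false by rewrite leqNgt ni.
by rewrite (subSn (ltnW ni)) -natr1; ring.
Qed.

Lemma step_gt0 i : 0 < step i.
Proof. by rewrite /step; case: ifP => _; rewrite divr_gt0//; move: lam0 lam1; lra. Qed.

Lemma shishkin_mid : X N./2 = 1 - lam.
Proof. by rewrite /shishkin leqnn; field; rewrite gt_eqF. Qed.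

Lemma shishkin_partition : partition01 N X.
Proof.
split.
- by rewrite /shishkin leq0n mul0r.
- have -> : X N = (1 - lam) + (N - N./2)%:R * (lam / (N./2)%:R).
    by rewrite /shishkin ifF//; move: N2 N4; lia.
  have -> : (N - N./2 = N./2)%N by move: N2; lia.
  by field; rewrite gt_eqF.
- by move=> i _; rewrite -subr_gt0 shishkin_step step_gt0.
Qed.

Lemma shishkin_le_mid i : (i < N./2)%N -> X i.+1 <= 1 - lam.
Proof.
move=> iN; rewrite -shishkin_mid; apply: (partition_le shishkin_partition) => //.
by move: N2; lia.
Qed.

Lemma shishkin_ge_mid i : (N./2 <= i)%N -> (i <= N)%N -> 1 - lam <= X i.
Proof. by move=> ? ?; rewrite -shishkin_mid; apply: (partition_le shishkin_partition). Qed.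

Lemma shishkin_gt_mid i : (N./2 <= i)%N -> (i < N)%N -> 1 - lam < X i.+1.
Proof.
move=> ni iN; apply: le_lt_trans (shishkin_ge_mid ni (ltnW iN)) _.
by have [_ _] := shishkin_partition; apply.
Qed.

Lemma step_coarse i : (i < N./2)%N -> N%:R^-1 <= step i <= 2 * N%:R^-1.
Proof.
move=> ni; rewrite /step ni Nn invfM.
have i0 : 0 < (N./2)%:R^-1 :> R by rewrite invr_gt0.
by move: lam0 lam1 => ? ?; apply/andP; split; nra.
Qed.

Lemma step_fine i : (N./2 <= i)%N -> step i = 2 * lam * N%:R^-1.
Proof.
by move=> ni; rewrite /step ltnNge ni/= Nn; field; rewrite gt_eqF.
Qed.

Lemma step_le i : step i <= 2 * N%:R^-1.
Proof.
case: (ltnP i N./2) => [/step_coarse/andP[]//|/step_fine ->].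
have : 0 < N%:R^-1 :> R by rewrite invr_gt0 Nn mulr_gt0.
move: lam0 lam1 => ? ? ?; nra.
Qed.

Lemma sum_step_fine : \sum_(i < N | (N./2 <= i)%N) step i = lam.
Proof.
rewrite (eq_bigr (fun i : 'I_N => X i.+1 - X i)); last by move=> i _; rewrite shishkin_step.
rewrite -(big_mkord (fun i => N./2 <= i)%N (fun i => X i.+1 - X i)).
rewrite -(big_nat_widenl N./2 0 N xpredT (fun i => X i.+1 - X i))//.
rewrite telescope_sumr; last by move: N2; lia.
by have [_ -> _] := shishkin_partition; rewrite shishkin_mid; ring.
Qed.

End shishkin_mesh.

Section local_derivatives.
Context {R : realType}.
Implicit Types (f g : R * R -> R) (p : R * R) (T : set (R * R)).

Lemma is_derive_dx g p (d : R) : is_derive p.1 1 (fun t => g (t, p.2)) d -> dx g p = d.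
Proof. by move=> dg; rewrite /dx derive1E; exact: derive_val. Qed.

Lemma is_derive_dy g p (d : R) : is_derive p.2 1 (fun t => g (p.1, t)) d -> dy g p = d.
Proof. by move=> dg; rewrite /dy derive1E; exact: derive_val. Qed.

Lemma is_derive_x_eq T f g p (d : R) : open T -> T p -> (forall q, T q -> f q = g q) ->
  is_derive p.1 1 (fun t => f (t, p.2)) d -> is_derive p.1 1 (fun t => g (t, p.2)) d.
Proof.
move=> oT Tp fg; apply: near_eq_is_derive.
have : \forall t \near p.1, T (t, p.2).
  have cl : continuous (fun t : R => (t, p.2)).
    by apply: continuous_pair => t; [exact: cvg_id|exact: cvg_cst].
  by apply: (cl p.1); rewrite -surjective_pairing; exact: open_nbhs_nbhs.
by apply: filterS => t; exact: fg.
Qed.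

Lemma is_derive_y_eq T f g p (d : R) : open T -> T p -> (forall q, T q -> f q = g q) ->
  is_derive p.2 1 (fun t => f (p.1, t)) d -> is_derive p.2 1 (fun t => g (p.1, t)) d.
Proof.
move=> oT Tp fg; apply: near_eq_is_derive.
have : \forall t \near p.2, T (p.1, t).
  have cl : continuous (fun t : R => (p.1, t)).
    by apply: continuous_pair => t; [exact: cvg_cst|exact: cvg_id].
  by apply: (cl p.2); rewrite -surjective_pairing; exact: open_nbhs_nbhs.
by apply: filterS => t; exact: fg.
Qed.

End local_derivatives.

Section discretization.
Context {R : realType}.
Variables (P : sdfem_data R) (eps : R) (N : nat).
Hypotheses (b10 : 0 < beta1 P) (b20 : 0 < beta2 P) (mok : mesh_ok P eps N).
Local Notation X := (node_x P eps N).
Local Notation Y := (node_y P eps N).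

Lemma ln_ge1 : 1 <= ln N%:R :> R.
Proof.
have [N4 _ _ _ _] := mok.
have N0 : 0 < N%:R :> R by rewrite ltr0n; case: N N4.
rewrite -[leLHS](@expRK R) ler_ln ?posrE ?expR_gt0//.
apply: le_trans (_ : 4 <= _); last by rewrite ler_nat.
(* From [1 + x <= expR x] at x = -1/2; squaring gives e at most 4, hence at most [N]. *)
have e2 : expR (2^-1) <= 2 :> R.
  have := expR_ge1Dx (- 2^-1 : R); rewrite expRN.
  have -> : 1 + - 2^-1 = 2^-1 :> R by field.
  by rewrite lef_pV2// posrE ?expR_gt0.
have -> : expR 1 = expR 2^-1 * expR 2^-1 :> R by rewrite -expRD; congr expR; field.
have -> : 4 = 2 * 2 :> R by ring.
by apply: ler_pM => //; exact: expR_ge0.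
Qed.

Lemma lambda_x_gt0 : 0 < lambda_x P eps N.
Proof.
have [_ _ e0 _ _] := mok; have := ln_ge1.
by move=> l1; rewrite /lambda_x/transition mulr_gt0 ?divr_gt0 ?mulr_gt0//; lra.
Qed.

Lemma lambda_y_gt0 : 0 < lambda_y P eps N.
Proof.
have [_ _ e0 _ _] := mok; have := ln_ge1.
by move=> l1; rewrite /lambda_y/transition mulr_gt0 ?divr_gt0 ?mulr_gt0//; lra.
Qed.

Lemma partition_x : partition01 N X.
Proof. by have [N4 evN _ _ [lx _]] := mok; apply: shishkin_partition => //; exact: lambda_x_gt0. Qed.

Lemma partition_y : partition01 N Y.
Proof. by have [N4 evN _ _ [_ ly]] := mok; apply: shishkin_partition => //; exact: lambda_y_gt0. Qed.

Definition slope_x (v : R * R -> R) i j b : R := slope (X i) (X i.+1) (Y j) (Y j.+1) b v.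

Definition slope_y (v : R * R -> R) i j b : R :=
  slope (Y j) (Y j.+1) (X i) (X i.+1) b (fun q => v (swap q)).

Local Notation T := (mesh_tri X Y).

Lemma cell_node i j : (i < N)%N -> (j < N)%N -> cell_ok (X i) (X i.+1) (Y j) (Y j.+1).
Proof. exact: (mesh_cell partition_x partition_y). Qed.

Lemma otriangleE (K : element N) : otriangle P eps K = T K.1.1 K.1.2 K.2.
Proof.
case: K => -[i j] b /=; have ok := cell_node (ltn_ord i) (ltn_ord j).
have [[_ xx _] [_ yy _]] := ok.
have h0 : 0 < X i.+1 - X i by rewrite subr_gt0.
have k0 : 0 < Y j.+1 - Y j by rewrite subr_gt0.
apply/seteqP; split => p; rewrite /mesh_tri; case: b => /=.
- move=> [s [t [r [s0 t0 r0 str]]]]; rewrite /barycenter/= => ->.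
  have th := mulr_gt0 t0 h0; have rk := mulr_gt0 r0 k0.
  have shk := mulr_gt0 s0 (mulr_gt0 h0 k0).
  have se : s = 1 - t - r by lra.
  by rewrite se in shk *; apply/(tri_trueP ok); split => /=; lra.
- move=> [s [t [r [s0 t0 r0 str]]]]; rewrite /barycenter/= => ->.
  have sh := mulr_gt0 s0 h0; have tk := mulr_gt0 t0 k0.
  have rhk := mulr_gt0 r0 (mulr_gt0 h0 k0).
  have re : r = 1 - s - t by lra.
  by rewrite re in rhk *; apply/(tri_falseP ok); split => /=; lra.
- move=> /(tri_trueP ok)[px py ps].
  pose t := (p.1 - X i) / (X i.+1 - X i); pose r := (p.2 - Y j) / (Y j.+1 - Y j).
  exists (1 - t - r), t, r; split.
  + have : t + r < 1; last by lra.
    rewrite /t /r addf_div ?gt_eqF// ltr_pdivrMr ?mulr_gt0// mul1r.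
    exact: ps.
  + by rewrite divr_gt0// subr_gt0.
  + by rewrite divr_gt0// subr_gt0.
  + by ring.
  + rewrite /barycenter/= [LHS]surjective_pairing; congr pair; rewrite /t /r; field;
    by rewrite ?gt_eqF.
- move=> /(tri_falseP ok)[px py ps].
  pose s := (X i.+1 - p.1) / (X i.+1 - X i); pose t := (Y j.+1 - p.2) / (Y j.+1 - Y j).
  exists s, t, (1 - s - t); split.
  + by rewrite divr_gt0// subr_gt0.
  + by rewrite divr_gt0// subr_gt0.
  + have : s + t < 1; last by lra.
    rewrite /s /t addf_div ?gt_eqF// ltr_pdivrMr ?mulr_gt0// mul1r.
    exact: ps.
  + by ring.
  + rewrite /barycenter/= [LHS]surjective_pairing; congr pair; rewrite /s /t; field;
    by rewrite ?gt_eqF.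
Qed.

End discretization.

(** * Finite element functions: slopes, boundary values, stabilization parameter *)

Section VN.
Context {R : realType}.
Variables (P : sdfem_data R) (eps : R) (N : nat).
Hypotheses (b10 : 0 < beta1 P) (b20 : 0 < beta2 P) (mok : mesh_ok P eps N).
Local Notation X := (node_x P eps N).
Local Notation Y := (node_y P eps N).
Local Notation T := (mesh_tri X Y).
Local Notation sx := (slope_x P eps N).
Local Notation sy := (slope_y P eps N).
Local Notation V := (VN P eps N).

Let pX := partition_x b10 mok.
Let pY := partition_y b20 mok.
Let cell := cell_node b10 b20 mok.

(** The affine coefficients are recovered from the three vertices, which belong to the closed
    [triangle]. The gradient thereby becomes a pair of edge difference quotients. *)
Lemma VN_interp v i j b p : V v -> (i < N)%N -> (j < N)%N -> T i j b p ->
  v p = interp (X i) (X i.+1) (Y j) (Y j.+1) b v p.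
Proof.
move=> [_ vaff _] iN jN Tp.
pose K : element N := (Ordinal iN, Ordinal jN, b).
have [a0 [a1 [a2 va]]] := vaff K.
have [[_ xx _] [_ yy _]] := cell iN jN.
have h0 : X i.+1 - X i != 0 by rewrite gt_eqF// subr_gt0.
have k0 : Y j.+1 - Y j != 0 by rewrite gt_eqF// subr_gt0.
have vert s t r : 0 <= s -> 0 <= t -> 0 <= r -> s + t + r = 1 ->
    triangle P eps K (barycenter P eps K s t r).
  by move=> *; exists s, t, r.
have v1 := va _ (vert 1 0 0 ler01 (lexx _) (lexx _) (ltac:(ring))).
have v2 := va _ (vert 0 1 0 (lexx _) ler01 (lexx _) (ltac:(ring))).
have v3 := va _ (vert 0 0 1 (lexx _) (lexx _) ler01 (ltac:(ring))).
have vp : v p = a0 + a1 * p.1 + a2 * p.2.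
  have : otriangle P eps K p by rewrite (otriangleE b10 b20 mok).
  by move=> [s [t [r [? ? ? ? ->]]]]; apply: va; apply: vert => //; exact: ltW.
move: v1 v2 v3; rewrite vp {vp va vert Tp} /barycenter/K/interp/slope/vertices/=.
by case: b {K} => /=; rewrite !(mul0r, mul1r, add0r, addr0) => e1 e2 e3;
  rewrite /swap/= e1 e2 e3; field; rewrite h0 k0.
Qed.

Lemma VN_sub v w : V v -> V w -> V (fun p => v p - w p).
Proof.
move=> [cv av v0] [cw aw w0]; split; first exact: contB.
- move=> K; have [a0 [a1 [a2 va]]] := av K; have [c0 [c1 [c2 wa]]] := aw K.
  by exists (a0 - c0), (a1 - c1), (a2 - c2) => p Tp; rewrite va// wa//; ring.
- by move=> p Bp; rewrite v0// w0// subrr.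
Qed.

Lemma slope_xB v w i j b : sx (fun p => v p - w p) i j b = sx v i j b - sx w i j b.
Proof. by rewrite /slope_x/slope -mulrBl; congr (_ * _); ring. Qed.

Lemma slope_yB v w i j b : sy (fun p => v p - w p) i j b = sy v i j b - sy w i j b.
Proof. by rewrite /slope_y/slope -mulrBl; congr (_ * _); ring. Qed.

Lemma VN_dx v i j b p : V v -> (i < N)%N -> (j < N)%N -> T i j b p ->
  is_derive p.1 1 (fun t => v (t, p.2)) (sx v i j b).
Proof.
move=> Vv iN jN Tp.
apply: (@is_derive_x_eq _ (T i j b) (interp (X i) (X i.+1) (Y j) (Y j.+1) b v)).
- exact: tri_open.
- exact: Tp.
- by move=> q Tq; rewrite (VN_interp Vv iN jN Tq).
- by rewrite /interp/=; apply: is_derive_eq; rewrite /GRing.scale/=/slope_x; ring.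
Qed.

Lemma VN_dy v i j b p : V v -> (i < N)%N -> (j < N)%N -> T i j b p ->
  is_derive p.2 1 (fun t => v (p.1, t)) (sy v i j b).
Proof.
move=> Vv iN jN Tp.
apply: (@is_derive_y_eq _ (T i j b) (interp (X i) (X i.+1) (Y j) (Y j.+1) b v)).
- exact: tri_open.
- exact: Tp.
- by move=> q Tq; rewrite (VN_interp Vv iN jN Tq).
- by rewrite /interp/=; apply: is_derive_eq; rewrite /GRing.scale/=/slope_y; ring.
Qed.

Lemma VN_laplace v i j b p : V v -> (i < N)%N -> (j < N)%N -> T i j b p -> laplace v p = 0.
Proof.
move=> Vv iN jN Tp; rewrite /laplace.
have -> : dx (dx v) p = 0.
  apply: is_derive_dx; apply: (@is_derive_x_eq _ (T i j b) (fun=> sx v i j b)) => //.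
    exact: tri_open.
    by move=> q Tq; apply/esym/is_derive_dx; exact: VN_dx.
  exact: is_derive_cst.
have -> : dy (dy v) p = 0.
  apply: is_derive_dy; apply: (@is_derive_y_eq _ (T i j b) (fun=> sy v i j b)) => //.
    exact: tri_open.
    by move=> q Tq; apply/esym/is_derive_dy; exact: VN_dy.
  exact: is_derive_cst.
by rewrite addr0.
Qed.

Lemma VN_bgrad v i j b p : V v -> (i < N)%N -> (j < N)%N -> T i j b p ->
  bgrad P v p = coef_b1 P p * sx v i j b + coef_b2 P p * sy v i j b.
Proof.
move=> Vv iN jN Tp; rewrite /bgrad.
by rewrite (is_derive_dx (VN_dx Vv iN jN Tp)) (is_derive_dy (VN_dy Vv iN jN Tp)).
Qed.

(** True by computation: both slopes are read off the common horizontal edge. This lets two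
    triangles be treated as one patch. *)
Lemma slope_x_shared v i j : sx v i j.+1 true = sx v i j false.
Proof. by []. Qed.

Lemma slope_y_shared v i j : sy v i.+1 j true = sy v i j false.
Proof. by []. Qed.

Let bd_bottom x : 0 <= x <= 1 -> bdOmega (x, 0 : R).
Proof.
by move=> x01; split; [split; rewrite //= lexx ler01|case=> _ /=; rewrite ltxx].
Qed.

Let bd_top x : 0 <= x <= 1 -> bdOmega (x, 1 : R).
Proof.
by move=> x01; split; [split; rewrite //= lexx ler01|case=> _ /=; rewrite ltxx andbF].
Qed.

Let bd_left y : 0 <= y <= 1 -> bdOmega (0 : R, y).
Proof.
by move=> x01; split; [split; rewrite //= lexx ler01|case=> /=; rewrite ltxx].
Qed.

Let bd_right y : 0 <= y <= 1 -> bdOmega (1 : R, y).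
Proof.
by move=> x01; split; [split; rewrite //= lexx ler01|case=> /=; rewrite ltxx andbF].
Qed.

(** Tangential slopes vanish on the boundary, so the triangles that have no partner across a
    horizontal edge drop out of the pairing in [sum_rows]. *)
Lemma slope_x_bottom v i : V v -> (i < N)%N -> sx v i 0 true = 0.
Proof.
move=> [_ _ v0] iN; rewrite /slope_x/slope; have [-> _ _] := pY.
by rewrite !v0 ?subrr ?mul0r//; apply: bd_bottom; apply: (partition_range pX) => //; exact: ltnW.
Qed.

Lemma slope_x_top v i : V v -> (i < N)%N -> sx v i N.-1 false = 0.
Proof.
move=> [_ _ v0] iN; rewrite /slope_x/slope (ltn_predK iN); have [_ -> _] := pY.
by rewrite !v0 ?subrr ?mul0r//; apply: bd_top; apply: (partition_range pX) => //; exact: ltnW.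
Qed.

Lemma slope_y_left v j : V v -> (j < N)%N -> sy v 0 j true = 0.
Proof.
move=> [_ _ v0] jN; rewrite /slope_y/slope/swap/=; have [-> _ _] := pX.
by rewrite !v0 ?subrr ?mul0r//; apply: bd_left; apply: (partition_range pY) => //; exact: ltnW.
Qed.

Lemma slope_y_right v j : V v -> (j < N)%N -> sy v N.-1 j false = 0.
Proof.
move=> [_ _ v0] jN; rewrite /slope_y/slope/swap/= (ltn_predK jN); have [_ -> _] := pX.
by rewrite !v0 ?subrr ?mul0r//; apply: bd_right; apply: (partition_range pY) => //; exact: ltnW.
Qed.

Definition stab_param (i j : nat) : R :=
  if (i < N./2)%N && (j < N./2)%N then Cstar P * N%:R^-1 else 0.

Lemma deltaE (K : element N) : delta P eps K = stab_param K.1.1 K.1.2.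
Proof.
have [N4 evN _ _ [lx ly]] := mok.
have lx0 := lambda_x_gt0 b10 mok; have ly0 := lambda_y_gt0 b20 mok.
case: K => -[i j] b; rewrite /delta /stab_param /=.
have [iN jN] := (ltn_ord i, ltn_ord j).
have vert s t r : 0 <= s -> 0 <= t -> 0 <= r -> s + t + r = 1 ->
    triangle P eps (i, j, b) (barycenter P eps (i, j, b) s t r).
  by move=> *; exists s, t, r.
(* In both kinds of triangle the second vertex has the largest abscissa and the third the largest
   ordinate; these two decide inclusion in [Omega_s]. *)
have vx : exists2 p, triangle P eps (i, j, b) p & p.1 = X i.+1.
  exists (barycenter P eps (i, j, b) 0 1 0); first by apply: vert => //; lra.
  by rewrite /barycenter/=; case: b {vert}; rewrite /= !(mul0r, mul1r, add0r, addr0).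
have vy : exists2 p, triangle P eps (i, j, b) p & p.2 = Y j.+1.
  exists (barycenter P eps (i, j, b) 0 0 1); first by apply: vert => //; lra.
  by rewrite /barycenter/=; case: b {vert vx}; rewrite /= !(mul0r, mul1r, add0r, addr0).
case: asboolP => [sub|nsub].
  have xi : (i < N./2)%N.
    rewrite ltnNge; apply/negP => ni; have [p /sub[/andP[_ p1] _] pE] := vx.
    by have := shishkin_gt_mid lx0 lx N4 evN ni iN; rewrite ltNge -/(X _) -pE p1.
  have yj : (j < N./2)%N.
    rewrite ltnNge; apply/negP => nj; have [p /sub[_ /andP[_ p2]] pE] := vy.
    by have := shishkin_gt_mid ly0 ly N4 evN nj jN; rewrite ltNge -/(Y _) -pE p2.
  by rewrite xi yj.
case: ifP => // /andP[xi yj]; exfalso; apply: nsub.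
have x1 : X i.+1 <= 1 - lambda_x P eps N := shishkin_le_mid lx0 lx N4 evN xi.
have y1 : Y j.+1 <= 1 - lambda_y P eps N := shishkin_le_mid ly0 ly N4 evN yj.
have [[X0 xx _] [Y0 yy _]] := cell iN jN.
move=> p [s [t [r [s0 t0 r0 str ->]]]].
have [[xs xt] xr] := (mulr_ge0 s0 X0, mulr_ge0 t0 X0, mulr_ge0 r0 X0).
have [[ys yt] yr] := (mulr_ge0 s0 Y0, mulr_ge0 t0 Y0, mulr_ge0 r0 Y0).
have h0 : 0 <= X i.+1 - X i by rewrite subr_ge0 ltW.
have k0 : 0 <= Y j.+1 - Y j by rewrite subr_ge0 ltW.
have [[hs ht] hr] := (mulr_ge0 s0 h0, mulr_ge0 t0 h0, mulr_ge0 r0 h0).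
have [[ks kt] kr] := (mulr_ge0 s0 k0, mulr_ge0 t0 k0, mulr_ge0 r0 k0).
have ex : s * X i.+1 + t * X i.+1 + r * X i.+1 = X i.+1 by rewrite -!mulrDl str mul1r.
have ey : s * Y j.+1 + t * Y j.+1 + r * Y j.+1 = Y j.+1 by rewrite -!mulrDl str mul1r.
clear vert vx vy; rewrite /Omega_s /barycenter /vertices /=.
by case: b => /=; split; apply/andP; split; lra.
Qed.

End VN.

(** * The error identity *)

(** [D 0 0] agrees with [g] on the closed square only; replacing it by [g] makes them equal as
    functions, so that one can be rewritten into the other. *)
Lemma Ck_smooth {R : realType} n (g : R * R -> R) D : Ck_with_partials n g D ->
  exists D', [/\ smooth n D', D' 0 0 = g &
    forall i j p, Omegabar p -> D' i j p = D i j p].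
Proof.
move=> [D0 cD dD1 dD2].
pose D' i j := if (i == 0%N) && (j == 0%N) then g else D i j.
have D'E i j p : Omegabar p -> D' i j p = D i j p.
  by move=> Op; rewrite /D'; case: eqP => [->|//]; case: eqP => [->|//]/=; rewrite D0.
exists D'; split => //; split.
- move=> i j /cD cDij; apply: cont_eq cDij => p Op; exact/esym/D'E.
- move=> i j p ij Op; rewrite D'E; last exact: Omega_sub.
  apply: (@is_derive_x_eq _ Omega (D i j)); [exact: Omega_open|exact: Op| |exact: dD1].
  by move=> q /Omega_sub Oq; rewrite D'E.
- move=> i j p ij Op; rewrite D'E; last exact: Omega_sub.
  apply: (@is_derive_y_eq _ Omega (D i j)); [exact: Omega_open|exact: Op| |exact: dD2].
  by move=> q /Omega_sub Oq; rewrite D'E.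
Qed.

(** Identifies the derivatives in the differential equation with those summed from the
    decomposition. Induction on the x-order comes first, then on the y-order. *)
Lemma smooth_unique {R : realType} n (D D' : nat -> nat -> R * R -> R) :
  smooth n D -> smooth n D' -> (forall p, Omega p -> D 0 0 p = D' 0 0 p) ->
  forall i j p, (i + j <= n)%N -> Omega p -> D i j p = D' i j p.
Proof.
move=> [_ dx dy] [_ dx' dy'] D0.
have Dx i p : (i <= n)%N -> Omega p -> D i 0 p = D' i 0 p.
  elim: i p => [p _|i ih p ilt Op]; first exact: D0.
  have d1 : is_derive p.1 1 (fun t => D' i 0 (t, p.2)) (D i.+1 0 p).
    apply: (@is_derive_x_eq _ Omega (D i 0)); [exact: Omega_open|exact: Op| |].
      by move=> q Oq; apply: ih => //; exact: ltnW.
    by apply: dx => //; rewrite addn0.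
  have d2 : is_derive p.1 1 (fun t => D' i 0 (t, p.2)) (D' i.+1 0 p).
    by apply: dx' => //; rewrite addn0.
  by rewrite -(@derive_val _ _ _ _ _ _ _ d1) (@derive_val _ _ _ _ _ _ _ d2).
move=> i j; elim: j => [|j ih] p; first by rewrite addn0; exact: Dx.
rewrite addnS => ij Op.
have d1 : is_derive p.2 1 (fun t => D' i j (p.1, t)) (D i j.+1 p).
  apply: (@is_derive_y_eq _ Omega (D i j)); [exact: Omega_open|exact: Op| |].
    by move=> q Oq; apply: ih => //; exact: ltnW.
  exact: dy.
have d2 := dy' i j p ij Op.
by rewrite -(@derive_val _ _ _ _ _ _ _ d1) (@derive_val _ _ _ _ _ _ _ d2).
Qed.

Section forms.
Context {R : realType}.
Variables (P : sdfem_data R) (eps : R) (N : nat).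
Hypotheses (b10 : 0 < beta1 P) (b20 : 0 < beta2 P) (mok : mesh_ok P eps N).
Hypotheses (cb1 : cont (coef_b1 P)) (cb2 : cont (coef_b2 P)) (cc : cont (coef_c P))
  (cf : cont (source P)).
Local Notation X := (node_x P eps N).
Local Notation Y := (node_y P eps N).
Local Notation T := (mesh_tri X Y).
Local Notation sx := (slope_x P eps N).
Local Notation sy := (slope_y P eps N).
Local Notation V := (VN P eps N).
Local Notation dlt := (stab_param P N).
Local Notation b1 := (coef_b1 P).
Local Notation b2 := (coef_b2 P).
Local Notation c := (coef_c P).
Local Notation f := (source P).

Let pX := partition_x b10 mok.
Let pY := partition_y b20 mok.
Let cell := cell_node b10 b20 mok.

(** The derivative of [v] along b on one triangle, extended to the whole square with the slopes
    frozen; this makes it continuous there. *)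
Definition bg (v : R * R -> R) i j b (p : R * R) : R := b1 p * sx v i j b + b2 p * sy v i j b.

Lemma VN_cont v : V v -> cont v. Proof. by case. Qed.

Lemma bg_cont v i j b : cont (bg v i j b).
Proof. rewrite /bg; contt. Qed.

Let oT i j b : (i < N)%N -> (j < N)%N -> open (T i j b).
Proof. by move=> *; exact: tri_open. Qed.

Let sT i j b : (i < N)%N -> (j < N)%N -> T i j b `<=` Omega.
Proof. by move=> iN jN; apply: tri_sub; exact: cell. Qed.

Lemma a_SD_E w v : V w -> V v -> a_SD P eps N w v =
  mesh_sum N (fun i j b => J (T i j b) (fun p =>
    eps * (sx w i j b * sx v i j b + sy w i j b * sy v i j b)
    + (bg w i j b p + c p * w p) * v p
    + dlt i j * ((bg w i j b p + c p * w p) * bg v i j b p))).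
Proof.
move=> Vw Vv; have cw := VN_cont Vw; have cv := VN_cont Vv.
rewrite -mesh_sumE /a_SD /a_Gal /a_stab big_distrr/= -!big_split/=.
apply: eq_bigr => -[[i j] b] _ /=; rewrite !(otriangleE b10 b20 mok) (deltaE b10 b20 mok)/=.
have [iN jN] := (ltn_ord i, ltn_ord j).
have cbw := @bg_cont w i j b; have cbv := @bg_cont v i j b.
rewrite !JD//; do ?[exact: oT|exact: sT|contt].
rewrite !JZ//; do ?[exact: oT|exact: sT|contt].
rewrite JD//; do ?[exact: oT|exact: sT|contt].
congr (_ * (_ + _) + _ + _).
- apply: eq_J => p Tp.
  by rewrite (is_derive_dx (VN_dx b10 b20 mok Vw iN jN Tp)) (is_derive_dx (VN_dx b10 b20 mok Vv iN jN Tp)).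
- apply: eq_J => p Tp.
  by rewrite (is_derive_dy (VN_dy b10 b20 mok Vw iN jN Tp)) (is_derive_dy (VN_dy b10 b20 mok Vv iN jN Tp)).
- by apply: eq_J => p Tp; rewrite (VN_bgrad b10 b20 mok Vw iN jN Tp).
- rewrite -JZ//; do ?[exact: oT|exact: sT|contt].
  apply: eq_J => p Tp.
  rewrite (VN_bgrad b10 b20 mok Vw iN jN Tp) (VN_bgrad b10 b20 mok Vv iN jN Tp).
  by rewrite (VN_laplace b10 b20 mok Vw iN jN Tp) mulr0 add0r mulrCA.
Qed.

Lemma norm_SD_sq v : V v -> 0 <= eps -> 0 <= mu0 P -> 0 <= Cstar P ->
  norm_SD P eps N v ^+ 2 =
  mesh_sum N (fun i j b => J (T i j b) (fun p =>
    eps * (sx v i j b ^+ 2 + sy v i j b ^+ 2) + mu0 P * v p ^+ 2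
    + dlt i j * bg v i j b p ^+ 2)).
Proof.
move=> Vv e0 m0 C0; have cv := VN_cont Vv.
have L2 D (g : R * R -> R) : 0 <= L2normsq D g.
  by apply: Rintegral_ge0 => p _; rewrite -expr2 sqr_ge0.
have d0 i j : 0 <= dlt i j by rewrite /stab_param; case: ifP => // _; rewrite mulr_ge0 ?invr_ge0.
rewrite /norm_SD sqr_sqrtr; last first.
  apply: addr_ge0; last first.
    by apply: sumr_ge0 => K _; rewrite (deltaE b10 b20 mok) mulr_ge0.
  by apply: addr_ge0; apply: mulr_ge0 => //; apply: sumr_ge0 => K _; rewrite addr_ge0.
have -> : L2normsq Omega v = \sum_(K : element N) J (T K.1.1 K.1.2 K.2) (fun p => v p ^+ 2).
  rewrite (mesh_sumE N (fun i j b => J (T i j b) (fun p => v p ^+ 2))) -(J_mesh pX pY)//; contt.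
rewrite -mesh_sumE /H1seminormsq !big_distrr/= -!big_split/=.
apply: eq_bigr => -[[i j] b] _ /=; rewrite !(otriangleE b10 b20 mok) (deltaE b10 b20 mok)/=.
have [iN jN] := (ltn_ord i, ltn_ord j).
have cbv := @bg_cont v i j b.
rewrite !JD//; do ?[exact: oT|exact: sT|contt].
rewrite !JZ//; do ?[exact: oT|exact: sT|contt].
rewrite JD//; do ?[exact: oT|exact: sT|contt].
congr (_ * (_ + _) + _ + _ * _); apply: eq_J => p Tp.
- by rewrite (is_derive_dx (VN_dx b10 b20 mok Vv iN jN Tp)).
- by rewrite (is_derive_dy (VN_dy b10 b20 mok Vv iN jN Tp)).
- by rewrite (VN_bgrad b10 b20 mok Vv iN jN Tp).
Qed.

Lemma load_E v : V v ->
  L2ip Omega f v + \sum_(K : element N)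
    L2ip (otriangle P eps K) f (fun p => delta P eps K * bgrad P v p) =
  mesh_sum N (fun i j b => J (T i j b) (fun p => f p * v p + dlt i j * (f p * bg v i j b p))).
Proof.
move=> Vv; have cv := VN_cont Vv.
rewrite [L2ip _ _ _](_ : _ = J Omega (fun p => f p * v p))// (J_mesh pX pY); last contt.
rewrite -!mesh_sumE -big_split/=.
apply: eq_bigr => -[[i j] b] _ /=; rewrite !(otriangleE b10 b20 mok) (deltaE b10 b20 mok)/=.
have [iN jN] := (ltn_ord i, ltn_ord j).
have cbv := @bg_cont v i j b.
rewrite JD//; do ?[exact: oT|exact: sT|contt].
congr (_ + _); apply: eq_J => p Tp.
by rewrite (VN_bgrad b10 b20 mok Vv iN jN Tp) (mulrCA (f p)).
Qed.

(* Galerkin orthogonality; the gradient of the interpolation error w in the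
   convection term is moved onto chi by parts, so that only w itself is left there. *)
Lemma error_identity (D : nat -> nat -> R * R -> R) (b1x b2y uI uN : R * R -> R) :
  smooth 2 D -> cont b1x -> cont b2y ->
  (forall p, Omega p -> is_derive p.1 1 (fun t => b1 (t, p.2)) (b1x p)) ->
  (forall p, Omega p -> is_derive p.2 1 (fun t => b2 (p.1, t)) (b2y p)) ->
  (forall p, Omega p ->
    - eps * (D 2 0 p + D 0 2 p) + (b1 p * D 1 0 p + b2 p * D 0 1 p) + c p * D 0 0 p = f p) ->
  V uI -> is_sdfem_solution P eps N uN ->
  let chi p := uI p - uN p in
  let w p := uI p - D 0 0 p in
  a_SD P eps N chi chi = mesh_sum N (fun i j b => J (T i j b) (fun p =>
    eps * (sx chi i j b * (sx uI i j b - D 1 0 p) + sy chi i j b * (sy uI i j b - D 0 1 p))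
    + ((c p - (b1x p + b2y p)) * w p) * chi p - w p * bg chi i j b p
    + stab_param P N i j * ((eps * (D 2 0 p + D 0 2 p) + b1 p * (sx uI i j b - D 1 0 p)
        + b2 p * (sy uI i j b - D 0 1 p) + c p * w p) * bg chi i j b p))).
Proof.
move=> [cD dDx dDy] cb1x cb2y db1 db2 pde VuI [VuN galerkin] chi w.
have Vchi : V chi by exact: VN_sub.
have cuI := VN_cont VuI; have cuN := VN_cont VuN; have cchi : cont chi := VN_cont Vchi.
have c00 : cont (D 0 0) by exact: cD.
have c10 : cont (D 1 0) by exact: cD.
have c01 : cont (D 0 1) by exact: cD.
have c20 : cont (D 2 0) by exact: cD.
have c02 : cont (D 0 2) by exact: cD.
have cw : cont w by exact: contB.
have cbg v i j b := @bg_cont v i j b.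
have := galerkin _ Vchi; rewrite (a_SD_E VuN Vchi) (load_E Vchi) (a_SD_E Vchi Vchi) => gal.
(* Four sums vanish because [chi] is zero on the boundary. The first two turn the Laplacian of u
   tested with [chi] into a product of gradients; [ibp3] and [ibp4] move the gradient of [w] in the
   convection term. *)
have ibp1 : mesh_sum N (fun i j b => J (T i j b) (fun p => D 2 0 p * chi p + D 1 0 p * sx chi i j b)) = 0.
  apply: (sum_J_dx pX pY (G := fun p => D 1 0 p * chi p)).
  - contt.
  - move=> i j b iN jN; contt.
  - move=> i j b p iN jN Tp.
    have := dDx 1 0 p isT (sT iN jN Tp); have := VN_dx b10 b20 mok Vchi iN jN Tp.
    move=> ? ?; apply: is_derive_eq; rewrite /GRing.scale/= -surjective_pairing; ring.
  - by move=> p Bp; case: Vchi => _ _ ->//; rewrite mulr0.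
have ibp2 : mesh_sum N (fun i j b => J (T i j b) (fun p => D 0 2 p * chi p + D 0 1 p * sy chi i j b)) = 0.
  apply: (sum_J_dy pX pY (G := fun p => D 0 1 p * chi p)).
  - contt.
  - move=> i j b iN jN; contt.
  - move=> i j b p iN jN Tp.
    have := dDy 0 1 p isT (sT iN jN Tp); have := VN_dy b10 b20 mok Vchi iN jN Tp.
    move=> ? ?; apply: is_derive_eq; rewrite /GRing.scale/= -surjective_pairing; ring.
  - by move=> p Bp; case: Vchi => _ _ ->//; rewrite mulr0.
have ibp3 : mesh_sum N (fun i j b => J (T i j b) (fun p => b1x p * w p * chi p
    + b1 p * (sx uI i j b - D 1 0 p) * chi p + b1 p * w p * sx chi i j b)) = 0.
  apply: (sum_J_dx pX pY (G := fun p => b1 p * w p * chi p)).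
  - contt.
  - move=> i j b iN jN; contt.
  - move=> i j b p iN jN Tp; have Op := sT iN jN Tp.
    have := dDx 0 0 p isT Op; have := VN_dx b10 b20 mok Vchi iN jN Tp.
    have := VN_dx b10 b20 mok VuI iN jN Tp; have := db1 p Op.
    move=> ? ? ? ?; rewrite /w; apply: is_derive_eq; rewrite /GRing.scale/= -surjective_pairing; ring.
  - by move=> p Bp; case: Vchi => _ _ ->//; rewrite mulr0.
have ibp4 : mesh_sum N (fun i j b => J (T i j b) (fun p => b2y p * w p * chi p
    + b2 p * (sy uI i j b - D 0 1 p) * chi p + b2 p * w p * sy chi i j b)) = 0.
  apply: (sum_J_dy pX pY (G := fun p => b2 p * w p * chi p)).
  - contt.
  - move=> i j b iN jN; contt.
  - move=> i j b p iN jN Tp; have Op := sT iN jN Tp.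
    have := dDy 0 0 p isT Op; have := VN_dy b10 b20 mok Vchi iN jN Tp.
    have := VN_dy b10 b20 mok VuI iN jN Tp; have := db2 p Op.
    move=> ? ? ? ?; rewrite /w; apply: is_derive_eq; rewrite /GRing.scale/= -surjective_pairing; ring.
  - by move=> p Bp; case: Vchi => _ _ ->//; rewrite mulr0.
set lhs := LHS; set target := RHS.
set A := LHS in gal; set B := RHS in gal.
set I1 := LHS in ibp1; set I2 := LHS in ibp2; set I3 := LHS in ibp3; set I4 := LHS in ibp4.
(* With the Galerkin identity and the four zero sums added, the claim is an equality of integrals
   whose integrands agree pointwise once the source is replaced by the differential equation. *)
suff : lhs + A = target + (eps * I1 + eps * I2 + I3 + I4) + B.
  by rewrite gal ibp1 ibp2 ibp3 ibp4 !mulr0 !addr0 => /addIr.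
rewrite /lhs /A /target /B /I1 /I2 /I3 /I4.
rewrite -!mesh_sumZ -!mesh_sumD; apply: eq_mesh_sum => i j b iN jN.
have oTK := oT (b := b) iN jN; have sTK := sT (b := b) iN jN.
have cchib := cbg chi i j b; have cuNb := cbg uN i j b.
rewrite -!JZ//; try contt.
rewrite -!JD//; try contt.
apply: eq_J => p /sTK /pde <-.
by rewrite /bg !(slope_xB, slope_yB) /w /chi; ring.
Qed.

End forms.

(** * The diffusion term *)

Ltac nonneg :=
  lazymatch goal with
  | H : is_true (0 <= ?a)%R |- is_true (0 <= ?a)%R => exact H
  | H : is_true (0 < ?a)%R |- is_true (0 <= ?a)%R => exact (ltW H)
  | |- is_true (0 <= _ ^+ 2)%R => exact: sqr_ge0
  | |- is_true (0 <= _ ^+ _)%R => apply: exprn_ge0; nonneg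
  | |- is_true (0 <= _ * _)%R => apply: mulr_ge0; nonneg
  | |- is_true (0 <= _^-1)%R => rewrite invr_ge0; nonneg
  | |- is_true (0 <= `|_|)%R => exact: normr_ge0
  | |- is_true (0 <= 1)%R => exact: ler01
  | |- is_true (0 <= _%:R)%R => exact: ler0n
  | |- is_true (0 <= _ + _)%R => apply: addr_ge0; nonneg
  end.

(* Parameters here and below: q = 1 / N, n = N / 2, L = ln N; the steps of index
   i < n are coarse and lead up to the transition point [m]. *)
Record layer_mesh (R : realType) (N n : nat) (eps q L rho m : R) (X : nat -> R) : Prop :=
  LayerMesh {
    lm_partition : partition01 N X;
    lm_coarse : forall i, (i < n)%N -> q <= X i.+1 - X i;
    lm_le : forall i, (i < N)%N -> X i.+1 - X i <= 2 * q;
    lm_fine_ge : forall i, (n <= i < N)%N -> eps * q <= rho * (X i.+1 - X i);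
    lm_fine_le : forall i, (n <= i < N)%N -> X i.+1 - X i <= rho * eps * L * q;
    lm_sum_fine : \sum_(i < N | (n <= i)%N) (X i.+1 - X i) <= rho * eps * L;
    lm_uniform : forall i, (i.+1 < n)%N || (n <= i)%N -> (i.+1 < N)%N ->
      X i.+2 - X i.+1 = X i.+1 - X i;
    lm_mid : forall i, (i < n)%N -> X i.+1 <= m }.

(** The bound on [q * L ^+ 2] lets one power of [q] absorb two logarithms; [kap] is [N] to the power
    -5/2, specified by its square to avoid real exponents. *)
Definition scales (R : realType) (N n : nat) (eps q L rho kap : R) : Prop :=
  [/\ (0 < n)%N, (n < N)%N & q = N%:R^-1] /\
  [/\ 0 < eps, eps <= q & q <= 1] /\
  [/\ 1 <= L, q * L ^+ 2 <= 4, 1 <= rho, 0 <= kap & kap ^+ 2 = q ^+ 5].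

Section arithmetic.
Context {R : realType}.
Implicit Types e g x r a C i h k z q : R.

(** The square of [|g| - 16 * r] is nonnegative. The share 1/32 is chosen so that the four parts of
    the decomposition together use 1/8. *)
Lemma young_area e g x r a : 0 <= e -> 0 <= a -> `|x| <= r * a ->
  e * (g * x) <= e * (g ^+ 2 / 32 * a) + e * (8 * r ^+ 2 * a).
Proof.
move=> e0 a0 xr; rewrite -mulrDr; apply: ler_wpM2l => //.
apply: le_trans (_ : `|g| * (r * a) <= _).
  by apply: le_trans (ler_norm _) _; rewrite normrM ler_wpM2l.
rewrite mulrA -mulrDl; apply: ler_wpM2r => //.
by rewrite -[g ^+ 2]real_normK ?num_real//; have := sqr_ge0 (`|g| - 16 * r); nra.
Qed.

(** [i] stands for [1 / eps]. Here y-derivatives cost nothing extra but [k] is coarse; the bracket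
    is at most 1 + 6 + 8 = 15 times the square of [z * q]. *)
Lemma patch_arith C i h k z q : 0 <= C -> 0 <= i -> 0 <= h -> 0 <= k -> 0 <= q -> 1 <= z ->
  i * h <= z * q -> k <= 2 * q ->
  2 * (C * i ^+ 3 * h ^+ 2 + 3 * (C * i ^+ 2) * h * k + 2 * (C * i) * k ^+ 2)
    <= 30 * C * i * z ^+ 2 * q ^+ 2.
Proof.
move=> C0 i0 h0 k0 q0 z1 ih kq.
rewrite (_ : 2 * _ = C * i * (2 * ((i * h) ^+ 2 + 3 * (i * h) * k + 2 * k ^+ 2))); last by ring.
rewrite (_ : _ * q ^+ 2 = C * i * (2 * (15 * (z * q) ^+ 2))); last by ring.
apply: ler_wpM2l; first exact: mulr_ge0.
apply: ler_wpM2l => //.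
have x0 : 0 <= i * h by exact: mulr_ge0.
have qz : q <= z * q by rewrite ler_peMl.
have kz : k <= 2 * (z * q) by lra.
set x := i * h in ih x0 *; set y := z * q in ih qz kz *.
have a1 : x ^+ 2 <= y ^+ 2 by rewrite !expr2; apply: ler_pM.
have a2 : x * k <= y * (2 * y) by apply: ler_pM.
have a3 : k ^+ 2 <= (2 * y) ^+ 2 by rewrite !expr2; apply: ler_pM.
lra.
Qed.

Lemma patch_arith_fine C i h k z q : 0 <= C -> 0 <= i -> 0 <= h -> 0 <= k -> 0 <= q ->
  i * h <= z * q -> i * k <= z * q ->
  2 * (C * i ^+ 3 * h ^+ 2 + 3 * (C * i ^+ 3) * h * k + 2 * (C * i ^+ 3) * k ^+ 2)
    <= 30 * C * i * z ^+ 2 * q ^+ 2.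
Proof.
move=> C0 i0 h0 k0 q0 ih ik.
rewrite (_ : 2 * _ = C * i * (2 * ((i * h) ^+ 2 + 3 * (i * h) * (i * k) + 2 * (i * k) ^+ 2))); last by ring.
rewrite (_ : _ * q ^+ 2 = C * i * (2 * (15 * (z * q) ^+ 2))); last by ring.
apply: ler_wpM2l; first exact: mulr_ge0.
apply: ler_wpM2l => //.
have x0 : 0 <= i * h by exact: mulr_ge0.
have x1 : 0 <= i * k by exact: mulr_ge0.
set x := i * h in ih x0 *; set x' := i * k in ik x1 *; set y := z * q in ih ik *.
have a1 : x ^+ 2 <= y ^+ 2 by rewrite !expr2; apply: ler_pM.
have a2 : x * x' <= y * y by apply: ler_pM.
have a3 : x' ^+ 2 <= y ^+ 2 by rewrite !expr2; apply: ler_pM.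
have := sqr_ge0 y; rewrite expr2 in a1 a3 *; lra.
Qed.

End arithmetic.

(** Regroups a column into pairs sharing a horizontal edge instead of pairs sharing a diagonal. *)
Lemma sum_rows (R : realType) (N : nat) (F : nat -> bool -> R) : (0 < N)%N ->
  F 0%N true = 0 -> F N.-1 false = 0 ->
  \sum_(j < N) (F j true + F j false) = \sum_(j < N.-1) (F j.+1 true + F j false).
Proof.
case: N => // N _ F0 FN; rewrite big_split/= big_ord_recl/= F0 add0r.
by rewrite big_ord_recr/= FN addr0 -big_split.
Qed.

(** * Diffusion in the x-direction, for each part of the decomposition *)

Section slope_terms.
Context {R : realType}.
Variables (N n : nat) (eps q L rho kap mx my C : R) (X Y : nat -> R).
Hypothesis sc : scales N n eps q L rho kap.
Hypotheses (lmX : layer_mesh N n eps q L rho mx X) (lmY : layer_mesh N n eps q L rho my Y).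
Hypothesis C0 : 0 <= C.
Variable g : nat -> nat -> bool -> R.
Implicit Types (D : nat -> nat -> R * R -> R) (i j : nat) (b : bool).
Local Notation T := (mesh_tri X Y).
Local Notation hX i := (X i.+1 - X i).
Local Notation hY j := (Y j.+1 - Y j).

Definition tri_area i j : R := hX i * hY j / 2.

(** The x-part of the diffusion term on one triangle: [g] is the x-slope of [chi], constant there
    and therefore outside the integral. *)
Definition slope_term D i j b : R :=
  eps * (g i j b * J (T i j b) (fun p =>
    slope (X i) (X i.+1) (Y j) (Y j.+1) b (D 0 0) - D 1 0 p)).

(* Share of the squared error bound carried by column (or row) i, per unit area. *)
Definition weight i : R :=
  eps * q ^+ 2 * L ^+ 2 + q ^+ 3 + (if (n <= i)%N then L ^+ 2 * q ^+ 3 / eps else 0).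

Local Notation energy := (mesh_sum N (fun i j b => eps * (g i j b ^+ 2 * tri_area i j))).

Let pX := lm_partition lmX.
Let pY := lm_partition lmY.
Let e0 : 0 < eps. Proof. by case: sc => _ [[]]. Qed.
Let eq_ : eps <= q. Proof. by case: sc => _ [[]]. Qed.
Let q0 : 0 < q. Proof. exact: lt_le_trans eq_. Qed.
Let q1 : q <= 1. Proof. by case: sc => _ [[]]. Qed.
Let L1 : 1 <= L. Proof. by case: sc => _ [_ []]. Qed.
Let qL : q * L ^+ 2 <= 4. Proof. by case: sc => _ [_ []]. Qed.
Let rho1 : 1 <= rho. Proof. by case: sc => _ [_ []]. Qed.
Let kap0 : 0 <= kap. Proof. by case: sc => _ [_ []]. Qed.
Let kapE : kap ^+ 2 = q ^+ 5. Proof. by case: sc => _ [_ []]. Qed.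
Let hX0 i : (i < N)%N -> 0 < hX i.
Proof. by case: pX => _ _ h iN; rewrite subr_gt0 h. Qed.
Let hY0 j : (j < N)%N -> 0 < hY j.
Proof. by case: pY => _ _ h iN; rewrite subr_gt0 h. Qed.

Let cell i j (iN : (i < N)%N) (jN : (j < N)%N) := mesh_cell pX pY iN jN.

Let area_ge0 i j : (i < N)%N -> (j < N)%N -> 0 <= tri_area i j.
Proof. by move=> iN jN; rewrite divr_ge0 ?mulr_ge0// ltW// (hX0, hY0). Qed.

Lemma kap_le : kap <= q ^+ 2.
Proof.
rewrite -ler_sqr ?nnegrE ?exprn_ge0// ?(ltW q0)// kapE -exprM.
by rewrite ler_wiXn2l// ltW.
Qed.

Lemma weight_ge0 i : 0 <= weight i.
Proof.
have ? := ltW e0; have ? := ltW q0; have L0 : 0 <= L by move: L1; lra.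
by rewrite /weight; case: ifP => _; rewrite !addr_ge0// ?divr_ge0// ?mulr_ge0// ?exprn_ge0//.
Qed.

(** The fine columns have total width [rho * eps * L], which cancels the [1 / eps] of their density
    and adds the third logarithm. *)
Lemma sum_weight : \sum_(i < N) weight i * hX i <= 3 * rho * ((eps * q ^+ 2 + q ^+ 3) * L ^+ 3).
Proof.
have L0 : 0 <= L by move: L1; lra.
have sX : \sum_(i < N) hX i = 1.
  have [X0 X1 _] := pX.
  by rewrite -(big_mkord xpredT (fun i => hX i)) telescope_sumr// X0 X1 subr0.
rewrite (eq_bigr (fun i : 'I_N => (eps * q ^+ 2 * L ^+ 2 + q ^+ 3) * hX i
  + (if (n <= i)%N then L ^+ 2 * q ^+ 3 / eps * hX i else 0))); last first.
  by move=> i _; rewrite /weight mulrDl; congr (_ + _); case: ifP => // _; rewrite mul0r.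
rewrite big_split/= -mulr_sumr sX mulr1 -big_mkcond -mulr_sumr.
have L3 : L ^+ 2 <= L ^+ 3 by rewrite [L ^+ 3]exprS ler_peMl// sqr_ge0.
have L31 : 1 <= L ^+ 3 by rewrite exprn_ege1.
have e2 : 0 <= eps * q ^+ 2 by rewrite mulr_ge0 ?exprn_ge0// ltW.
have q3 : 0 <= q ^+ 3 by rewrite exprn_ge0// ltW.
have a1 : eps * q ^+ 2 * L ^+ 2 <= eps * q ^+ 2 * L ^+ 3 by rewrite ler_wpM2l.
have a2 : q ^+ 3 <= q ^+ 3 * L ^+ 3 by rewrite ler_peMr.
have a3 : L ^+ 2 * q ^+ 3 / eps * (\sum_(i < N | (n <= i)%N) hX i) <= rho * (q ^+ 3 * L ^+ 3).
  apply: le_trans (_ : L ^+ 2 * q ^+ 3 / eps * (rho * eps * L) <= _).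
    apply: ler_wpM2l; last exact: lm_sum_fine lmX.
    by rewrite divr_ge0 ?mulr_ge0 ?sqr_ge0// ltW.
  by rewrite le_eqVlt; apply/orP; left; apply/eqP; field; rewrite gt_eqF.
have b1 : 0 <= eps * q ^+ 2 * L ^+ 3 by apply: mulr_ge0 => //; lra.
have b2 : 0 <= q ^+ 3 * L ^+ 3 by apply: mulr_ge0 => //; lra.
have b3 : eps * q ^+ 2 * L ^+ 3 <= rho * (eps * q ^+ 2 * L ^+ 3) by rewrite ler_peMl.
have b4 : q ^+ 3 * L ^+ 3 <= rho * (q ^+ 3 * L ^+ 3) by rewrite ler_peMl.
rewrite (_ : 3 * rho * _ = 3 * (rho * (eps * q ^+ 2 * L ^+ 3)) + 3 * (rho * (q ^+ 3 * L ^+ 3))); last by ring.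
lra.
Qed.

(** The hypothesis concerns whole columns because, where triangles are paired across rows, no
    sufficient bound is available for a single one. *)
Lemma sum_columns (F : nat -> nat -> bool -> R) (K : R) : 0 <= K ->
  (forall i, (i < N)%N -> \sum_(j < N) (F i j true + F i j false) <=
     \sum_(j < N) (eps * (g i j true ^+ 2 / 32 * tri_area i j)
       + eps * (g i j false ^+ 2 / 32 * tri_area i j)) + K * (weight i * hX i)) ->
  mesh_sum N F <= energy / 32 + 3 * K * rho * ((eps * q ^+ 2 + q ^+ 3) * L ^+ 3).
Proof.
move=> K0 col.
have -> : energy / 32 = mesh_sum N (fun i j b => eps * (g i j b ^+ 2 / 32 * tri_area i j)).
  by rewrite mulrC -mesh_sumZ; apply: eq_mesh_sum => i j b _ _; field.
apply: le_trans (_ : \sum_(i < N) (\sum_(j < N) (eps * (g i j true ^+ 2 / 32 * tri_area i j)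
       + eps * (g i j false ^+ 2 / 32 * tri_area i j)) + K * (weight i * hX i)) <= _).
  by apply: ler_sum => i _; exact: col.
rewrite big_split/= -mulr_sumr; apply: lerD; first by [].
rewrite (_ : 3 * K * rho * _ = K * (3 * rho * ((eps * q ^+ 2 + q ^+ 3) * L ^+ 3))); last by ring.
by rewrite ler_wpM2l// sum_weight.
Qed.

Lemma column_of_triangles (F : nat -> nat -> bool -> R) (K : R) i : (i < N)%N ->
  (forall j b, (j < N)%N ->
     F i j b <= eps * (g i j b ^+ 2 / 32 * tri_area i j) + K * (weight i * tri_area i j)) ->
  \sum_(j < N) (F i j true + F i j false) <=
     \sum_(j < N) (eps * (g i j true ^+ 2 / 32 * tri_area i j)
       + eps * (g i j false ^+ 2 / 32 * tri_area i j)) + K * (weight i * hX i).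
Proof.
move=> iN tri_le.
have -> : K * (weight i * hX i) = \sum_(j < N) (K * (weight i * tri_area i j) + K * (weight i * tri_area i j)).
  have sY : \sum_(j < N) hY j = 1.
    have [Y0 Y1 _] := pY.
    by rewrite -(big_mkord xpredT (fun i => hY i)) telescope_sumr// Y0 Y1 subr0.
  rewrite -[LHS]mulr1 -sY mulr_sumr; apply: eq_bigr => j _.
  by rewrite /tri_area; field.
rewrite -big_split/=; apply: ler_sum => j _.
by rewrite addrACA; exact: lerD (tri_le j true (ltn_ord j)) (tri_le j false (ltn_ord j)).
Qed.

Lemma sum_triangles (F : nat -> nat -> bool -> R) (K : R) : 0 <= K ->
  (forall i j b, (i < N)%N -> (j < N)%N ->
     F i j b <= eps * (g i j b ^+ 2 / 32 * tri_area i j) + K * (weight i * tri_area i j)) ->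
  mesh_sum N F <= energy / 32 + 3 * K * rho * ((eps * q ^+ 2 + q ^+ 3) * L ^+ 3).
Proof.
move=> K0 tri_le; apply: sum_columns => // i iN.
by apply: column_of_triangles => // j b jN; exact: tri_le.
Qed.

Lemma slope_term_bound D i j b r : (i < N)%N -> (j < N)%N ->
  `|J (T i j b) (fun p => slope (X i) (X i.+1) (Y j) (Y j.+1) b (D 0 0) - D 1 0 p)| <= r * tri_area i j ->
  slope_term D i j b <= eps * (g i j b ^+ 2 / 32 * tri_area i j) + eps * (8 * r ^+ 2 * tri_area i j).
Proof. by move=> iN jN Jr; apply: young_area => //; [exact: ltW|exact: area_ge0]. Qed.

Let small_coarse D i j b m : smooth m D -> (1 <= m)%N -> (i < n)%N -> (i < N)%N -> (j < N)%N ->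
  (forall p, rect (X i) (X i.+1) (Y j) (Y j.+1) p -> `|D 0 0 p| <= C * kap) ->
  `|J (T i j b) (fun p => slope (X i) (X i.+1) (Y j) (Y j.+1) b (D 0 0) - D 1 0 p)|
    <= 6 * C * kap / q * tri_area i j.
Proof.
move=> sD m1 ni iN jN small; apply: le_trans (J_slope_error_le (cell iN jN) b sD m1 small) _.
have hq := lm_coarse lmX ni; have k0 := ltW (hY0 jN).
rewrite (_ : _ * tri_area i j = 3 * (C * kap) * hY j * (hX i / q)); last first.
  by rewrite /tri_area; field; rewrite gt_eqF.
by rewrite ler_peMr ?mulr_ge0// ler_pdivlMr// mul1r.
Qed.

Let small_fine D i j b m : smooth m D -> (1 <= m)%N -> (n <= i)%N -> (i < N)%N -> (j < N)%N ->
  (forall p, rect (X i) (X i.+1) (Y j) (Y j.+1) p -> `|D 0 0 p| <= C * kap) ->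
  `|J (T i j b) (fun p => slope (X i) (X i.+1) (Y j) (Y j.+1) b (D 0 0) - D 1 0 p)|
    <= 6 * C * kap * rho / (eps * q) * tri_area i j.
Proof.
move=> sD m1 ni iN jN small; apply: le_trans (J_slope_error_le (cell iN jN) b sD m1 small) _.
have hq := lm_fine_ge lmX (i := i); rewrite ni iN in hq; have {}hq := hq isT.
have k0 := ltW (hY0 jN).
have eq0 : 0 < eps * q by rewrite mulr_gt0.
rewrite (_ : _ * tri_area i j = 3 * (C * kap) * hY j * (rho * hX i / (eps * q))); last first.
  by rewrite /tri_area; field; rewrite !gt_eqF.
by rewrite ler_peMr ?mulr_ge0// ler_pdivlMr// mul1r.
Qed.

(** First order suffices: the error [q] squared, times the factor [eps] of diffusion, is already
    within the rate, and two derivatives of [S] are all that is assumed. *)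
Lemma regular_slope_terms D : smooth 2 D ->
  (forall i j p, (i + j <= 2)%N -> Omegabar p -> `|D i j p| <= C) ->
  mesh_sum N (slope_term D) <=
    energy / 32 + 3 * (128 * C ^+ 2) * rho * ((eps * q ^+ 2 + q ^+ 3) * L ^+ 3).
Proof.
move=> sD DC; apply: sum_triangles; first by rewrite mulr_ge0 ?sqr_ge0.
move=> i j b iN jN; have ok := cell iN jN.
apply: le_trans (slope_term_bound (r := 4 * C * q) iN jN _) _.
  apply: le_trans (J_slope_error_smooth (M20 := C) (M11 := C) ok b sD isT _ _) _.
  - by move=> p /(rect_sub ok); exact: DC.
  - by move=> p /(rect_sub ok); exact: DC.
  apply: ler_wpM2r; first exact: area_ge0.
  have h1 := ler_wpM2l C0 (lm_le lmX iN); have h2 := ler_wpM2l C0 (lm_le lmY jN); lra.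
rewrite lerD2l (_ : eps * _ = 128 * C ^+ 2 * (eps * q ^+ 2 * tri_area i j)); last by ring.
apply: ler_wpM2l; first by rewrite mulr_ge0 ?sqr_ge0.
apply: ler_wpM2r; first exact: area_ge0.
have z1 : eps * q ^+ 2 <= eps * q ^+ 2 * L ^+ 2.
  rewrite ler_peMr ?exprn_ege1// mulr_ge0 ?sqr_ge0// ltW//.
have z2 : 0 <= q ^+ 3 by rewrite exprn_ge0// ltW.
have z3 : 0 <= L ^+ 2 * q ^+ 3 / eps by apply: divr_ge0; [apply: mulr_ge0; [exact: sqr_ge0|exact: z2]|exact: ltW].
by rewrite /weight; case: ifP => _; lra.
Qed.

Let q3_ge0 : 0 <= q ^+ 3. Proof. by rewrite exprn_ge0// ltW. Qed.

Let fine_ge0 : 0 <= L ^+ 2 * q ^+ 3 / eps.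
Proof. by apply: divr_ge0; [apply: mulr_ge0; [exact: sqr_ge0|exact: q3_ge0]|exact: ltW]. Qed.

Let eq2_ge0 : 0 <= eps * q ^+ 2 * L ^+ 2.
Proof. by nonneg. Qed.

Lemma weight_ge_regular i : eps * q ^+ 2 * L ^+ 2 <= weight i.
Proof.
by have := q3_ge0; have := fine_ge0; rewrite /weight; case: ifP => _; lra.
Qed.

Lemma weight_ge_coarse i : q ^+ 3 <= weight i.
Proof.
by have := eq2_ge0; have := fine_ge0; rewrite /weight; case: ifP => _; lra.
Qed.

Lemma weight_ge_fine i : (n <= i)%N -> L ^+ 2 * q ^+ 3 / eps <= weight i.
Proof. by move=> ni; have := eq2_ge0; have := q3_ge0; rewrite /weight ni; lra. Qed.

Let rho0 : 0 <= rho. Proof. exact: le_trans rho1. Qed.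

Let L0 : 0 <= L. Proof. exact: le_trans L1. Qed.

Let rho2 : 1 <= rho ^+ 2. Proof. exact: exprn_ege1. Qed.

Let L2 : 1 <= L ^+ 2. Proof. exact: exprn_ege1. Qed.

(** The place that dictates [kap ^+ 2 = q ^+ 5]: a fine step loses [eps * q], and what remains is
    [q ^+ 3 / eps]. The constant 288 is 8 times the square of 6. *)
Let small_remainder_fine :
  eps * (8 * (6 * C * kap * rho / (eps * q)) ^+ 2) <= 288 * C ^+ 2 * rho ^+ 2 * (L ^+ 2 * q ^+ 3 / eps).
Proof.
rewrite (_ : eps * _ = 288 * C ^+ 2 * rho ^+ 2 * (kap ^+ 2 / q ^+ 2 / eps)); last first.
  by field; rewrite !gt_eqF.
rewrite kapE (_ : q ^+ 5 / q ^+ 2 / eps = q ^+ 3 / eps); last by field; rewrite !gt_eqF.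
apply: ler_wpM2l; first by nonneg.
rewrite -mulrA ler_peMl//; nonneg.
Qed.

Lemma small_slope_term D i j b m : smooth m D -> (1 <= m)%N -> (i < N)%N -> (j < N)%N ->
  (forall p, rect (X i) (X i.+1) (Y j) (Y j.+1) p -> `|D 0 0 p| <= C * kap) ->
  slope_term D i j b <= eps * (g i j b ^+ 2 / 32 * tri_area i j)
    + 288 * C ^+ 2 * rho ^+ 2 * (weight i * tri_area i j).
Proof.
move=> sD m1 iN jN small; have a0 := area_ge0 iN jN.
case: (ltnP i n) => ni.
  apply: le_trans (slope_term_bound iN jN (small_coarse b sD m1 ni iN jN small)) _.
  rewrite lerD2l mulrA [X in _ <= X]mulrA; apply: ler_wpM2r => //.
  rewrite (_ : eps * _ = 288 * C ^+ 2 * 1 * (eps * (kap ^+ 2 / q ^+ 2))); last first.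
    by field; rewrite !gt_eqF.
  rewrite kapE (_ : q ^+ 5 / q ^+ 2 = q ^+ 3); last by field; rewrite !gt_eqF.
  apply: ler_pM.
  - by nonneg.
  - by nonneg.
  - by apply: ler_wpM2l; [nonneg|exact: rho2].
  - apply: le_trans (weight_ge_coarse i); rewrite ler_piMl//.
    by apply: le_trans eq_ _.
apply: le_trans (slope_term_bound iN jN (small_fine b sD m1 ni iN jN small)) _.
rewrite lerD2l mulrA [X in _ <= X]mulrA; apply: ler_wpM2r => //.
apply: le_trans small_remainder_fine _.
apply: ler_wpM2l; first by nonneg.
exact: weight_ge_fine.
Qed.

(** For x-slopes the y-layer costs [1 / eps] only in the mixed derivative, which is multiplied by a
    fine y-step, so first order estimates suffice in fine rows; in coarse rows the function has size
    [kap]. *)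
Lemma ylayer_slope_terms D : smooth 3 D ->
  (forall p, Omegabar p -> `|D 2 0 p| <= C) ->
  (forall p, Omegabar p -> `|D 1 1 p| <= C / eps) ->
  (forall p, Omegabar p -> p.2 <= my -> `|D 0 0 p| <= C * kap) ->
  mesh_sum N (slope_term D) <=
    energy / 32 + 3 * (288 * C ^+ 2 * rho ^+ 2) * rho * ((eps * q ^+ 2 + q ^+ 3) * L ^+ 3).
Proof.
move=> sD D20 D11 D00; apply: sum_triangles; first by nonneg.
move=> i j b iN jN; have ok := cell iN jN; have a0 := area_ge0 iN jN.
case: (ltnP j n) => nj.
  apply: (small_slope_term b sD) => // p rp; apply: D00; first exact: (rect_sub ok).
  by case: rp => _ /andP[_ /le_trans]; apply; exact: lm_mid lmY _ nj.
apply: le_trans (slope_term_bound (r := 3 * C * rho * L * q) iN jN _) _.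
  apply: le_trans (J_slope_error_smooth (M20 := C) (M11 := C / eps) ok b sD isT _ _) _.
  - by move=> p /(rect_sub ok); exact: D20.
  - by move=> p /(rect_sub ok); exact: D11.
  apply: ler_wpM2r => //.
  have h1 := ler_wpM2l C0 (lm_le lmX iN).
  have h2 : C / eps * hY j <= C * (rho * L * q).
    have njN : (n <= j < N)%N by rewrite nj jN.
    rewrite -mulrA (mulrC eps^-1); apply: ler_wpM2l => //; rewrite ler_pdivrMr//.
    by apply: le_trans (lm_fine_le lmY njN) _; rewrite (_ : _ * q = rho * L * q * eps)//; ring.
  have h3 : C * q <= C * (rho * L * q).
    apply: ler_wpM2l => //; apply: ler_peMl; first exact: ltW.
    by rewrite -[1]mulr1; apply: ler_pM.
  lra.
rewrite lerD2l mulrA [X in _ <= X]mulrA; apply: ler_wpM2r => //.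
apply: le_trans (_ : 288 * C ^+ 2 * rho ^+ 2 * (eps * q ^+ 2 * L ^+ 2) <= _).
  rewrite (_ : eps * _ = 72 * C ^+ 2 * rho ^+ 2 * (eps * q ^+ 2 * L ^+ 2)); last by ring.
  by apply: ler_wpM2r => //; have := mulr_ge0 (sqr_ge0 C) (sqr_ge0 rho); lra.
apply: ler_wpM2l; first by nonneg.
exact: weight_ge_regular.
Qed.

Section xlayer.
Variable D : nat -> nat -> R * R -> R.
Hypothesis sD : smooth 3 D.
Hypothesis D2 : forall i j p, (i + j = 2)%N -> Omegabar p -> `|D i j p| <= C * eps^-1 ^+ 2.
Hypothesis D3 : forall i j p, (i + j = 3)%N -> Omegabar p -> `|D i j p| <= C * eps^-1 ^+ 3.
Hypothesis small_x : forall p, Omegabar p -> p.1 <= mx -> `|D 0 0 p| <= C * kap.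
(** The alternatives are the two functions to be treated: y-derivatives of [E1] bring no factor
    [1 / eps], those of [E12] do, but [E12] is tiny in coarse rows. *)
Hypothesis coarse_rows :
  (forall p, Omegabar p -> [/\ `|D 1 1 p| <= C * eps^-1, `|D 2 1 p| <= C * eps^-1 ^+ 2
    & `|D 1 2 p| <= C * eps^-1]) \/
  (forall p, Omegabar p -> p.2 <= my -> `|D 0 0 p| <= C * kap).
Hypothesis g_shared : forall i j, (i < N)%N -> g i j.+1 true = g i j false.
Hypothesis g_bottom : forall i, (i < N)%N -> g i 0 true = 0.
Hypothesis g_top : forall i, (i < N)%N -> g i N.-1 false = 0.

Let jump i j b := J (T i j b) (fun p =>
  slope (X i) (X i.+1) (Y j) (Y j.+1) b (D 0 0) - D 1 0 p).

(** The patch bound gives 8 * 30 ^ 2 * 2 = 120 ^ 2, and the surplus factor [q * L ^+ 2 <= 4] raises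
    it to 240 ^ 2. *)
Let K0 : R := 240 * 240 * C ^+ 2 * rho ^+ 4 * (L ^+ 2 * q ^+ 3 / eps).

Let i0 : 0 <= eps^-1. Proof. by rewrite invr_ge0 ltW. Qed.

Let fineX i : (n <= i)%N -> (i < N)%N -> eps^-1 * hX i <= rho * L * q.
Proof.
move=> ni iN; have := lm_fine_le lmX (i := i); rewrite ni iN => /(_ isT) hle.
by rewrite mulrC ler_pdivrMr// (_ : rho * L * q * eps = rho * eps * L * q)//; ring.
Qed.

Let fineY j : (n <= j)%N -> (j < N)%N -> eps^-1 * hY j <= rho * L * q.
Proof.
move=> ni iN; have := lm_fine_le lmY (i := j); rewrite ni iN => /(_ isT) hle.
by rewrite mulrC ler_pdivrMr// (_ : rho * L * q * eps = rho * eps * L * q)//; ring.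
Qed.

Let rL1 : 1 <= rho * L. Proof. by rewrite -[1]mulr1; apply: ler_pM. Qed.

Let row_area_le i j : (i < N)%N -> (j.+1 < N)%N ->
  tri_area i j.+1 + tri_area i j <= 2 * hX i * q.
Proof.
move=> iN jN; have h0 := ltW (hX0 iN).
have k1 := ler_wpM2l h0 (lm_le lmY jN); have k2 := ler_wpM2l h0 (lm_le lmY (ltnW jN)).
by rewrite /tri_area; lra.
Qed.

(* The row of triangles meeting the edges y = Y j.+1. The patches are symmetric
   about these edges except for j.+1 = n, where the mesh size changes. *)
Lemma row_bound i j : (n <= i)%N -> (i < N)%N -> (j.+1 < N)%N ->
  slope_term D i j.+1 true + slope_term D i j false <=
  eps * (g i j.+1 true ^+ 2 / 32 * tri_area i j.+1) + eps * (g i j false ^+ 2 / 32 * tri_area i j)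
  + K0 * (hX i * (q + (j.+1 == n)%:R)).
Proof.
move=> ni iN jN.
have jN' : (j < N)%N by exact: ltnW.
have ok1 := cell iN jN'; have ok2 := cell iN jN.
set a := tri_area i j.+1 + tri_area i j.
have a0 : 0 <= a by rewrite addr_ge0 ?area_ge0.
have aq := row_area_le iN jN; rewrite -/a in aq.
have h0 := ltW (hX0 iN).
have hq0 : 0 <= 2 * hX i * q by nonneg.
(* Since [g] is shared, Young's inequality is applied once to the sum of the two integrals, so that
   their cancellation is not lost. *)
have combine r : `|jump i j.+1 true + jump i j false| <= r * a ->
    eps * (8 * r ^+ 2) * (2 * hX i * q) <= K0 * (hX i * (q + (j.+1 == n)%:R)) ->
    slope_term D i j.+1 true + slope_term D i j false <=
    eps * (g i j.+1 true ^+ 2 / 32 * tri_area i j.+1) + eps * (g i j false ^+ 2 / 32 * tri_area i j)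
    + K0 * (hX i * (q + (j.+1 == n)%:R)).
  move=> Jr rK; rewrite /slope_term -/(jump i j.+1 true) -/(jump i j false) (g_shared _ iN).
  rewrite -!mulrDr; apply: le_trans (young_area _ (ltW e0) a0 Jr) _.
  apply: lerD => //; apply: le_trans rK; rewrite mulrA; apply: ler_wpM2l => //; nonneg.
have C2 : 0 <= C ^+ 2 * rho ^+ 2 by rewrite mulr_ge0 ?sqr_ge0.
have rho4 : C ^+ 2 * rho ^+ 2 <= C ^+ 2 * rho ^+ 4.
  apply: ler_wpM2l; first exact: sqr_ge0.
  by rewrite (_ : rho ^+ 4 = rho ^+ 2 * rho ^+ 2) ?ler_peMr ?sqr_ge0//; ring.
have hqt0 : 0 <= hX i * q by nonneg.
have small_row : (forall b, `|jump i (if b then j.+1 else j) b| <=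
     6 * C * kap * rho / (eps * q) * tri_area i (if b then j.+1 else j)) ->
   `|jump i j.+1 true + jump i j false| <= 6 * C * kap * rho / (eps * q) * a.
  move=> h; apply: le_trans (ler_normD _ _) _; rewrite mulrDr.
  exact: lerD (h true) (h false).
have patch_case : `|jump i j.+1 true + jump i j false| <= 30 * C * eps^-1 * (rho * L) ^+ 2 * q ^+ 2 * a ->
   slope_term D i j.+1 true + slope_term D i j false <=
    eps * (g i j.+1 true ^+ 2 / 32 * tri_area i j.+1) + eps * (g i j false ^+ 2 / 32 * tri_area i j)
    + K0 * (hX i * (q + (j.+1 == n)%:R)).
  move=> hJ; apply: combine hJ _.
  rewrite (_ : eps * _ * _ = 120 * 120 * (C ^+ 2 * rho ^+ 4) * (L ^+ 2 * q ^+ 3 / eps) * (q * L ^+ 2) * (hX i * q));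
    last by field; rewrite gt_eqF.
  apply: le_trans (_ : 120 * 120 * (C ^+ 2 * rho ^+ 4) * (L ^+ 2 * q ^+ 3 / eps) * 4 * (hX i * q) <= _).
    apply: ler_wpM2r => //; apply: ler_wpM2l => //.
    by nonneg.
  rewrite (_ : _ * _ * _ * 4 * _ = K0 * (hX i * q)); last by rewrite /K0; ring.
  apply: ler_wpM2l.
    by rewrite /K0; nonneg.
  by apply: ler_wpM2l => //; rewrite lerDl ler0n.
have small_case : (forall b, `|jump i (if b then j.+1 else j) b| <=
     6 * C * kap * rho / (eps * q) * tri_area i (if b then j.+1 else j)) ->
   slope_term D i j.+1 true + slope_term D i j false <=
    eps * (g i j.+1 true ^+ 2 / 32 * tri_area i j.+1) + eps * (g i j false ^+ 2 / 32 * tri_area i j)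
    + K0 * (hX i * (q + (j.+1 == n)%:R)).
  move=> /small_row hJ; apply: combine hJ _.
  apply: le_trans (ler_wpM2r hq0 small_remainder_fine) _.
  have z0 : 0 <= C ^+ 2 * rho ^+ 2 * (L ^+ 2 * q ^+ 3 / eps) * (hX i * q) by nonneg.
  have z1 : C ^+ 2 * rho ^+ 2 * (L ^+ 2 * q ^+ 3 / eps) * (hX i * q)
      <= C ^+ 2 * rho ^+ 4 * (L ^+ 2 * q ^+ 3 / eps) * (hX i * q).
    by apply: ler_wpM2r => //; apply: ler_wpM2r.
  apply: le_trans (_ : K0 * (hX i * q) <= _).
    by rewrite /K0; lra.
  apply: ler_wpM2l; first by rewrite /K0; nonneg.
  by apply: ler_wpM2l => //; rewrite lerDl ler0n.
(* Both rows coarse, both rows fine, or an edge on the transition line. *)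
have /or3P[nj|nj|/eqP nj] : [|| (j.+1 < n), (n < j.+1) | (j.+1 == n)]%N by case: ltngtP.
- case: coarse_rows => [dec|small_y].
    apply: patch_case.
    have symm : Y j.+2 - Y j.+1 = Y j.+1 - Y j by apply: lm_uniform lmY _ _ jN; rewrite nj.
    have okr : cell_ok (X i) (X i.+1) (Y j) (Y j.+2).
      by case: ok1 ok2 => ? [? ? ?] [_ [? ? ?]]; split => //; split => //; lra.
    apply: le_trans (patch_error (M30 := C * eps^-1 ^+ 3) (M21 := C * eps^-1 ^+ 2) (M12 := C * eps^-1)
      ok1 ok2 symm sD _ _ _ erefl) _.
    + by move=> p /(rect_sub okr); exact: D3.
    + by move=> p /(rect_sub okr) /dec[].
    + by move=> p /(rect_sub okr) /dec[].
    have -> : a = hX i * hY j by rewrite /a /tri_area symm; field.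
    apply: ler_wpM2r; first by rewrite mulr_ge0// ltW// hY0.
    apply: patch_arith => //; [exact/ltW/hY0|exact: ltW|exact: fineX|exact: (lm_le lmY jN')].
  apply: small_case => b; apply: (small_fine b sD) => //; first by case: b.
  move=> p rp; case: b rp => rp.
    apply: small_y; first exact: (rect_sub ok2).
    by case: rp => _ /andP[_ /le_trans]; apply; exact: lm_mid lmY _ nj.
  apply: small_y; first exact: (rect_sub ok1).
  by case: rp => _ /andP[_ /le_trans]; apply; apply: lm_mid lmY _ (ltnW nj).
- apply: patch_case.
  have symm : Y j.+2 - Y j.+1 = Y j.+1 - Y j.
    by apply: lm_uniform lmY _ _ jN; apply/orP; right; rewrite -ltnS.
  have okr : cell_ok (X i) (X i.+1) (Y j) (Y j.+2).
    by case: ok1 ok2 => ? [? ? ?] [_ [? ? ?]]; split => //; split => //; lra.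
  apply: le_trans (patch_error (M30 := C * eps^-1 ^+ 3) (M21 := C * eps^-1 ^+ 3) (M12 := C * eps^-1 ^+ 3)
    ok1 ok2 symm sD _ _ _ erefl) _.
  + by move=> p /(rect_sub okr); exact: D3.
  + by move=> p /(rect_sub okr); exact: D3.
  + by move=> p /(rect_sub okr); exact: D3.
  have -> : a = hX i * hY j by rewrite /a /tri_area symm; field.
  apply: ler_wpM2r; first by rewrite mulr_ge0// ltW// hY0.
  apply: patch_arith_fine => //; [exact/ltW/hY0|exact: ltW|exact: fineX|exact: fineY].
(* Without symmetry only an error of first order in [q] is available. The summand [(j.+1 == n)%:R]
   in the budget, where other rows have [q], pays for the difference. *)
- have strip b : `|jump i (if b then j.+1 else j) b| <=
      6 * C * eps^-1 * (rho * L) * q * tri_area i (if b then j.+1 else j).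
    have smooth_bound m : `|jump i (if b then j.+1 else j) b| <=
       (C * eps^-1 ^+ 2 * hX i + C * eps^-1 ^+ m * hY (if b then j.+1 else j))
        * tri_area i (if b then j.+1 else j) ->
       eps^-1 ^+ m * hY (if b then j.+1 else j) <= 2 * eps^-1 * (rho * L * q) ->
       `|jump i (if b then j.+1 else j) b| <=
       6 * C * eps^-1 * (rho * L) * q * tri_area i (if b then j.+1 else j).
      move=> hJ hk; apply: le_trans hJ _; apply: ler_wpM2r.
        by apply: area_ge0 => //; case: (b).
      have y1 := ler_wpM2l C0 hk.
      have y2 := ler_wpM2l (mulr_ge0 C0 i0) (fineX ni iN).
      have y3 : 0 <= C * eps^-1 * (rho * L * q) by nonneg.
      rewrite !mulrA in y1 y2 y3 *; lra.
    have small_bound : `|jump i (if b then j.+1 else j) b| <=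
       6 * C * kap * rho / (eps * q) * tri_area i (if b then j.+1 else j) ->
       `|jump i (if b then j.+1 else j) b| <=
       6 * C * eps^-1 * (rho * L) * q * tri_area i (if b then j.+1 else j).
      move=> hJ; apply: le_trans hJ _; apply: ler_wpM2r.
        by apply: area_ge0 => //; case: (b).
      rewrite (_ : _ / (eps * q) = 6 * C * eps^-1 * rho * (kap / q)); last by field; rewrite !gt_eqF.
      rewrite (_ : 6 * C * eps^-1 * (rho * L) * q = 6 * C * eps^-1 * rho * (L * q)); last by ring.
      apply: ler_wpM2l; first by nonneg.
      rewrite ler_pdivrMr//; apply: le_trans kap_le _.
      rewrite expr2; apply: ler_wpM2r; first exact: ltW.
      by apply: ler_peMl; [exact: ltW|exact: L1].
    have rows jj : (jj < N)%N -> forall p, rect (X i) (X i.+1) (Y jj) (Y jj.+1) p -> Omegabar p.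
      by move=> jjN p; exact: (rect_sub (cell iN jjN)).
    case: b smooth_bound small_bound => smooth_bound small_bound.
      apply: (smooth_bound 2%N).
        by apply: (J_slope_error_smooth ok2 true sD) => // p /(rows _ jN) Op; apply: D2.
      have y1 := ler_wpM2l i0 (fineY (eq_leq (esym nj)) jN).
      have y2 : 0 <= eps^-1 * (rho * L * q) by nonneg.
      rewrite expr2; lra.
    case: coarse_rows => [dec|small_y].
      apply: (smooth_bound 1%N).
        by apply: (J_slope_error_smooth ok1 false sD) => // p /(rows _ jN'); [exact: D2|case/dec].
      have y1 := ler_wpM2l i0 (lm_le lmY jN').
      have y2 : eps^-1 * q <= eps^-1 * (rho * L * q) by apply: ler_wpM2l => //; apply: ler_peMl => //; exact: ltW.
      rewrite expr1; lra.
    apply: small_bound; apply: (small_fine false sD) => // p rp.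
    apply: small_y; first exact: rows rp.
    by case: rp => _ /andP[_ /le_trans]; apply; apply: lm_mid lmY _ _; rewrite -nj.
  have hJ : `|jump i j.+1 true + jump i j false| <= 6 * C * eps^-1 * (rho * L) * q * a.
    apply: le_trans (ler_normD _ _) _; rewrite mulrDr.
    exact: lerD (strip true) (strip false).
  apply: combine hJ _.
  rewrite nj eqxx (_ : eps * _ * _ = 24 * 24 * (C ^+ 2 * rho ^+ 2) * (L ^+ 2 * q ^+ 3 / eps) * hX i);
    last by field; rewrite gt_eqF.
  have z0 : 0 <= C ^+ 2 * rho ^+ 2 * (L ^+ 2 * q ^+ 3 / eps) * hX i by nonneg.
  have z1 : C ^+ 2 * rho ^+ 2 * (L ^+ 2 * q ^+ 3 / eps) * hX i
      <= C ^+ 2 * rho ^+ 4 * (L ^+ 2 * q ^+ 3 / eps) * hX i.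
    by apply: ler_wpM2r => //; apply: ler_wpM2r.
  apply: le_trans (_ : K0 * (hX i * 1) <= _).
    by rewrite /K0; lra.
  apply: ler_wpM2l; first by rewrite /K0; nonneg.
  by apply: ler_wpM2l => //; rewrite lerDr ltW.
Qed.

(** In coarse columns the size [kap] suffices triangle by triangle; in fine columns the bottom and
    top triangles drop out and the others are summed in pairs. *)
Lemma xlayer_slope_terms : mesh_sum N (slope_term D) <=
    energy / 32 + 3 * (2 * (240 * 240 * C ^+ 2 * rho ^+ 4)) * rho * ((eps * q ^+ 2 + q ^+ 3) * L ^+ 3).
Proof.
have [[n0 nN qE] _] := sc.
have N0 : (0 < N)%N by exact: ltn_trans nN.
apply: sum_columns; first by nonneg.
move=> i iN.
case: (ltnP i n) => ni.
  apply: column_of_triangles => // j b jN.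
  apply: le_trans (small_slope_term b sD _ iN jN _) _ => //.
    move=> p rp; apply: small_x; first exact: (rect_sub (cell iN jN)).
    by case: rp => /andP[_ /le_trans] h _; apply: h; exact: lm_mid lmX _ ni.
  rewrite lerD2l; apply: ler_wpM2r.
    by apply: mulr_ge0; [exact: weight_ge0|exact: area_ge0].
  have z0 : 0 <= C ^+ 2 * rho ^+ 2 by nonneg.
  have z1 : C ^+ 2 * rho ^+ 2 <= C ^+ 2 * rho ^+ 4.
    apply: ler_wpM2l; first exact: sqr_ge0.
    by rewrite (_ : rho ^+ 4 = rho ^+ 2 * rho ^+ 2) ?ler_peMr ?sqr_ge0//; ring.
  by rewrite -!mulrA; lra.
rewrite (sum_rows (F := fun j b => slope_term D i j b))//; first last.
- by rewrite /slope_term g_top// mul0r mulr0.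
- by rewrite /slope_term g_bottom// mul0r mulr0.
rewrite (sum_rows (F := fun j b => eps * (g i j b ^+ 2 / 32 * tri_area i j)))//; first last.
- by rewrite g_top// expr0n !mul0r mulr0.
- by rewrite g_bottom// expr0n !mul0r mulr0.
have jN (j : 'I_N.-1) : (j.+1 < N)%N by have := ltn_ord j; move: N0; clear; lia.
apply: le_trans (ler_sum _ (fun (j : 'I_N.-1) _ => row_bound ni iN (jN j))) _.
rewrite big_split/=; apply: lerD => //; rewrite -mulr_sumr -mulr_sumr big_split/=.
(* The row budgets add up to at most 2: fewer than [N] rows with [1 / N] each, and one transition
   row. *)
have s1 : \sum_(j < N.-1) q <= 1.
  rewrite sumr_const card_ord -mulr_natr qE mulrC ler_pdivrMr ?ltr0n// mul1r ler_nat.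
  exact: leq_pred.
have s2 : \sum_(j < N.-1) (j.+1 == n)%:R <= 1 :> R.
  have nN' : (n.-1 < N.-1)%N by move: n0 nN; clear; lia.
  rewrite (bigD1 (Ordinal nN'))//= big1 ?addr0; first by rewrite prednK// eqxx.
  move=> j jn; rewrite (_ : (j.+1 == n)%N = false)//; apply/negbTE; apply: contra jn => /eqP jE.
  by apply/eqP/val_inj; rewrite /= -jE.
have h0 := ltW (hX0 iN).
have W0 := weight_ge_fine ni.
rewrite -mulrA (_ : K0 * _ = 240 * 240 * C ^+ 2 * rho ^+ 4 *
  ((L ^+ 2 * q ^+ 3 / eps) * hX i * (\sum_(j < N.-1) q + \sum_(j < N.-1) (j.+1 == n)%:R))); last first.
  by rewrite /K0; ring.
rewrite [X in _ <= X](_ : _ = 240 * 240 * C ^+ 2 * rho ^+ 4 * (weight i * hX i * 2)); last by ring.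
apply: ler_wpM2l; first by nonneg.
apply: ler_pM.
- by apply: mulr_ge0 => //; exact: fine_ge0.
- by apply: addr_ge0; apply: sumr_ge0 => j _; [exact: ltW|exact: ler0n].
- exact: ler_wpM2r.
- lra.
Qed.

End xlayer.

End slope_terms.

(** * Convection, reaction and stabilization terms *)

Section cell_estimates.
Context {R : realType}.
Variables (x0 x1 y0 y1 : R).
Hypothesis ok : cell_ok x0 x1 y0 y1.
Implicit Types (A B M G m : R) (f g x a gx gy : R * R -> R) (b : bool).
Local Notation box := (rect x0 x1 y0 y1).
Local Notation T := (tri x0 x1 y0 y1).
Local Notation h := (x1 - x0).
Local Notation k := (y1 - y0).

Let h0 : 0 < h. Proof. by case: ok => -[? ? ?] _; rewrite subr_gt0. Qed.
Let k0 : 0 < k. Proof. by case: ok => _ [? ? ?]; rewrite subr_gt0. Qed.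

(** Expands the square of [m * x - 8 * a]. The share 1/16 leaves room for a second term of the same
    size within 1/8. *)
Lemma J_young b a x A m : cont a -> cont x -> 0 < m -> (forall p, T b p -> `|a p| <= A) ->
  J (T b) (fun p => a p * x p) <= m / 16 * J (T b) (fun p => x p ^+ 2) + 4 * A ^+ 2 / m * (h * k / 2).
Proof.
move=> ca cx m0 aA; have oT := @tri_open R x0 x1 y0 y1 b; have sT := tri_sub ok (b := b).
rewrite -(J_cst ok b) -JZ -?JD//; try contt.
apply: le_J => //; try contt.
move=> p Tp; have ap := aA p Tp.
have A2 : a p ^+ 2 <= A ^+ 2.
  by rewrite -[a p ^+ 2]real_normK ?num_real// !expr2; apply: ler_pM.
rewrite -(ler_pM2r m0) mulrDl divfK ?gt_eqF//.
have := sqr_ge0 (m * x p - 8 * a p); nra.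
Qed.

Lemma J_parts_bound_y b g gy phi phiy B (F F' : R) : cont g -> cont gy -> cont phi -> cont phiy ->
  (forall p, Omega p -> is_derive p.2 1 (fun t => g (p.1, t)) (gy p)) ->
  (forall p, Omega p -> is_derive p.2 1 (fun t => phi (p.1, t)) (phiy p)) ->
  (forall p, box p -> `|g p| <= B) -> (forall p, box p -> `|phi p| <= F) ->
  (forall p, box p -> `|phiy p| <= F') ->
  `|J (T b) (fun p => gy p * phi p)| <= 2 * (B * F) * h + B * F' * (h * k / 2).
Proof.
move=> cg cgy cp cpy dg dp gB pF pF'.
rewrite -(J_tri_swap ok b (f := fun p => gy p * phi p)); last by contt.
rewrite (mulrC h k).
apply: (J_parts_bound (cell_ok_swap ok) b (g := fun p => g (swap p)) (gx := fun p => gy (swap p))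
  (phi := fun p => phi (swap p)) (phix := fun p => phiy (swap p))); try exact: cont_swap.
- by move=> p /Omega_swap; exact: dg.
- by move=> p /Omega_swap; exact: dp.
- by move=> p /rect_swap; exact: gB.
- by move=> p /rect_swap; exact: pF.
- by move=> p /rect_swap; exact: pF'.
Qed.

Lemma inverse_y b (a c d : R) :
  d ^+ 2 * k ^+ 3 * h / 48 <= J (T b) (fun p => (a + c * p.1 + d * p.2) ^+ 2).
Proof.
rewrite -(J_tri_swap ok b (f := fun p => (a + c * p.1 + d * p.2) ^+ 2)); last by contt.
apply: le_trans (inverse_x (cell_ok_swap ok) b a d c) _.
by rewrite le_eqVlt; apply/orP; left; apply/eqP/eq_J => p _; rewrite /swap/= addrAC.
Qed.

Lemma norm_le_add (u v s t : R) : `|u| <= s -> `|v| <= t -> `|u + v| <= s + t.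
Proof. by move=> us vt; apply: le_trans (ler_normD _ _) _; exact: lerD. Qed.

Lemma norm_le_mul (u v s t : R) : `|u| <= s -> `|v| <= t -> `|u * v| <= s * t.
Proof. by move=> us vt; rewrite normrM; apply: ler_pM. Qed.

Section residual.
Variables (E D1 D2 : nat -> nat -> R * R -> R) (b : bool) (eps q B M c1 c2 : R).
Hypotheses (sE : smooth 2 E) (s1 : smooth 1 D1) (s2 : smooth 1 D2).
Hypotheses (e0 : 0 < eps) (q0 : 0 < q) (q1 : q <= 1) (hq : q <= h) (kq : q <= k) (M1 : 1 <= M) (B0 : 0 <= B).
Hypothesis E0 : forall p, box p -> `|E 0 0 p| <= B.
Hypothesis E1 : forall p, box p -> `|E 1 0 p| <= B / eps.
Hypothesis E2 : forall p, box p -> `|E 0 1 p| <= B / eps.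
Hypothesis D1M : forall i j p, (i + j <= 1)%N -> box p -> `|D1 i j p| <= M.
Hypothesis D2M : forall i j p, (i + j <= 1)%N -> box p -> `|D2 i j p| <= M.

Let phi i j (p : R * R) := D1 i j p * c1 + D2 i j p * c2.
Let G : R := `|c1| + `|c2|.

Let M0 : 0 <= M. Proof. exact: le_trans M1. Qed.
Let G0 : 0 <= G. Proof. by rewrite addr_ge0. Qed.

Let phiM i j p : (i + j <= 1)%N -> box p -> `|phi i j p| <= M * G.
Proof.
move=> ij bp; rewrite mulrDr; apply: norm_le_add; apply: norm_le_mul => //.
  exact: D1M.
exact: D2M.
Qed.

(* The integrals of the derivatives of E are moved to the boundary, where only
   E and eps * grad E enter; the length of the boundary costs a factor 1 / q. *)
Lemma layer_residual :
  `|J (T b) (fun p => (eps * (E 2 0 p + E 0 2 p) - D1 0 0 p * E 1 0 p - D2 0 0 p * E 0 1 p)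
       * phi 0 0 p)| <= 22 * B * M ^+ 2 * G / q * (h * k / 2).
Proof.
have [cE dEx dEy] := sE; have [cD1 d1x d1y] := s1; have [cD2 d2x d2y] := s2.
have oT := @tri_open R x0 x1 y0 y1 b; have sT := tri_sub ok (b := b).
have [c00 c10 c01] : [/\ cont (E 0 0), cont (E 1 0) & cont (E 0 1)] by split; exact: cE.
have [c20 c02] : cont (E 2 0) /\ cont (E 0 2) by split; exact: cE.
have [a00 a10 a01] : [/\ cont (D1 0 0), cont (D1 1 0) & cont (D1 0 1)] by split; exact: cD1.
have [e00 e10 e01] : [/\ cont (D2 0 0), cont (D2 1 0) & cont (D2 0 1)] by split; exact: cD2.
have [f00 f10 f01] : [/\ cont (phi 0 0), cont (phi 1 0) & cont (phi 0 1)].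
  by split; rewrite /phi; contt.
have phix p : Omega p -> is_derive p.1 1 (fun t => phi 0 0 (t, p.2)) (phi 1 0 p).
  move=> Op; have := d1x 0 0 p isT Op; have := d2x 0 0 p isT Op => ? ?.
  by rewrite /phi; apply: is_derive_eq; rewrite /GRing.scale/=; ring.
have phiy p : Omega p -> is_derive p.2 1 (fun t => phi 0 0 (p.1, t)) (phi 0 1 p).
  move=> Op; have := d1y 0 0 p isT Op; have := d2y 0 0 p isT Op => ? ?.
  by rewrite /phi; apply: is_derive_eq; rewrite /GRing.scale/=; ring.
set ar := h * k / 2.
have ar0 : 0 <= ar by rewrite divr_ge0 ?mulr_ge0// ltW.
(* Side lengths are compared with the area: since the cell is at least [q] wide and high, a boundary
   term costs [2 / q] per unit area. *)
have kar : k <= 2 / q * ar.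
  rewrite (_ : 2 / q * ar = k * (h / q)); last by rewrite /ar; field; rewrite gt_eqF.
  by apply: ler_peMr; [exact: ltW|rewrite ler_pdivlMr// mul1r].
have har : h <= 2 / q * ar.
  rewrite (_ : 2 / q * ar = h * (k / q)); last by rewrite /ar; field; rewrite gt_eqF.
  by apply: ler_peMr; [exact: ltW|rewrite ler_pdivlMr// mul1r].
have arq : ar <= 1 / q * ar by apply: ler_peMl => //; rewrite ler_pdivlMr// mul1r.
have be0 : 0 <= B / eps by rewrite divr_ge0// ltW.
have t1 : `|J (T b) (fun p => E 2 0 p * phi 0 0 p)| <= 5 * (B / eps * (M * G)) / q * ar.
  have F0 : 0 <= B / eps * (M * G) by apply: mulr_ge0; [exact: be0|apply: mulr_ge0; [exact: M0|exact: G0]].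
  apply: le_trans (J_parts_bound ok b (g := E 1 0) (phix := phi 1 0) (B := B / eps) (F := M * G) (F' := M * G)
    c10 c20 f00 f10 _ phix E1 _ _) _.
  - by move=> p Op; exact: dEx.
  - by move=> p; exact: phiM.
  - by move=> p; exact: phiM.
  have := ler_wpM2l F0 kar; have := ler_wpM2l F0 arq; rewrite -/ar; lra.
have t2 : `|J (T b) (fun p => E 0 2 p * phi 0 0 p)| <= 5 * (B / eps * (M * G)) / q * ar.
  have F0 : 0 <= B / eps * (M * G) by apply: mulr_ge0; [exact: be0|apply: mulr_ge0; [exact: M0|exact: G0]].
  apply: le_trans (J_parts_bound_y b (g := E 0 1) (phiy := phi 0 1) (B := B / eps) (F := M * G) (F' := M * G)
    c01 c02 f00 f01 _ phiy E2 _ _) _.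
  - by move=> p Op; exact: dEy.
  - by move=> p; exact: phiM.
  - by move=> p; exact: phiM.
  have := ler_wpM2l F0 har; have := ler_wpM2l F0 arq; rewrite -/ar; lra.
have F0 : 0 <= B * (M * (M * G)) by do 3?[apply: mulr_ge0; first by []]; exact: G0.
have t3 : `|J (T b) (fun p => E 1 0 p * (D1 0 0 p * phi 0 0 p))| <= 6 * (B * (M * (M * G))) / q * ar.
  apply: le_trans (J_parts_bound ok b (g := E 0 0) (phix := fun p => D1 1 0 p * phi 0 0 p + D1 0 0 p * phi 1 0 p)
    (B := B) (F := M * (M * G)) (F' := M * (M * G) + M * (M * G)) c00 c10 _ _ _ _ E0 _ _) _.
  - by contt.
  - by contt.
  - by move=> p Op; exact: dEx.
  - move=> p Op; have := phix p Op; have := d1x 0 0 p isT Op => ? ?.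
    by apply: is_derive_eq; rewrite /GRing.scale/= -surjective_pairing; ring.
  - by move=> p bp; apply: norm_le_mul; [exact: D1M|exact: phiM].
  - by move=> p bp; apply: norm_le_add; apply: norm_le_mul; [exact: D1M|exact: phiM|exact: D1M|exact: phiM].
  have := ler_wpM2l F0 kar; have := ler_wpM2l F0 arq; rewrite -/ar; lra.
have t4 : `|J (T b) (fun p => E 0 1 p * (D2 0 0 p * phi 0 0 p))| <= 6 * (B * (M * (M * G))) / q * ar.
  apply: le_trans (J_parts_bound_y b (g := E 0 0) (phiy := fun p => D2 0 1 p * phi 0 0 p + D2 0 0 p * phi 0 1 p)
    (B := B) (F := M * (M * G)) (F' := M * (M * G) + M * (M * G)) c00 c01 _ _ _ _ E0 _ _) _.
  - by contt.
  - by contt.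
  - by move=> p Op; exact: dEy.
  - move=> p Op; have := phiy p Op; have := d2y 0 0 p isT Op => ? ?.
    by apply: is_derive_eq; rewrite /GRing.scale/= -surjective_pairing; ring.
  - by move=> p bp; apply: norm_le_mul; [exact: D2M|exact: phiM].
  - by move=> p bp; apply: norm_le_add; apply: norm_le_mul; [exact: D2M|exact: phiM|exact: D2M|exact: phiM].
  have := ler_wpM2l F0 har; have := ler_wpM2l F0 arq; rewrite -/ar; lra.
have -> : J (T b) (fun p => (eps * (E 2 0 p + E 0 2 p) - D1 0 0 p * E 1 0 p - D2 0 0 p * E 0 1 p) * phi 0 0 p)
  = eps * J (T b) (fun p => E 2 0 p * phi 0 0 p) + eps * J (T b) (fun p => E 0 2 p * phi 0 0 p)
    + (-1) * J (T b) (fun p => E 1 0 p * (D1 0 0 p * phi 0 0 p))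
    + (-1) * J (T b) (fun p => E 0 1 p * (D2 0 0 p * phi 0 0 p)).
  rewrite -!JZ//; try contt.
  rewrite -!JD//; try contt.
  by apply: eq_J => p _; ring.
have MG : M * G <= M * (M * G) by apply: ler_peMl => //; exact: mulr_ge0.
have z1 := ler_wpM2l (mulr_ge0 B0 ar0) MG.
have iq : 0 <= q^-1 by rewrite invr_ge0 ltW.
have z2 := ler_wpM2r iq z1.
(* 22 = 5 + 5 + 6 + 6: each diffusion term gives 2 * 2 + 1, each convection term 2 * 2 + 2, as its
   multiplier is a product with two derivative terms. *)
apply: le_trans (_ : 5 * (B * (M * G)) / q * ar + 5 * (B * (M * G)) / q * ar
   + 6 * (B * (M * (M * G))) / q * ar + 6 * (B * (M * (M * G))) / q * ar <= _); last by lra.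
apply: norm_le_add; last by rewrite normrM normrN1 mul1r.
apply: norm_le_add; last by rewrite normrM normrN1 mul1r.
have es t : `|t| <= 5 * (B / eps * (M * G)) / q * ar -> `|eps * t| <= 5 * (B * (M * G)) / q * ar.
  move=> h1; rewrite normrM gtr0_norm//; apply: le_trans (ler_wpM2l (ltW e0) h1) _.
  by rewrite le_eqVlt; apply/orP; left; apply/eqP; field; rewrite !gt_eqF.
by apply: norm_le_add; exact: es.
Qed.

End residual.
End cell_estimates.

Definition addD {R : realType} (D D' : nat -> nat -> R * R -> R) i j (p : R * R) : R :=
  D i j p + D' i j p.

Lemma smooth_add {R : realType} n (D D' : nat -> nat -> R * R -> R) :
  smooth n D -> smooth n D' -> smooth n (addD D D').
Proof.
move=> [cD dx dy] [cD' dx' dy']; split.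
- by move=> i j ij; apply: contD; [exact: cD|exact: cD'].
- by move=> i j p ij Op; have := dx i j p ij Op; have := dx' i j p ij Op => ? ?; apply: is_deriveD.
- by move=> i j p ij Op; have := dy i j p ij Op; have := dy' i j p ij Op => ? ?; apply: is_deriveD.
Qed.

Lemma smooth_le {R : realType} n m (D : nat -> nat -> R * R -> R) :
  (n <= m)%N -> smooth m D -> smooth n D.
Proof.
move=> nm [cD dx dy]; split.
- by move=> i j ij; apply: cD; exact: leq_trans nm.
- by move=> i j p ij; apply: dx; exact: leq_trans nm.
- by move=> i j p ij; apply: dy; exact: leq_trans nm.
Qed.

Lemma slopeD {R : realType} (x0 x1 y0 y1 : R) b (f g : R * R -> R) :
  slope x0 x1 y0 y1 b (fun p => f p + g p) = slope x0 x1 y0 y1 b f + slope x0 x1 y0 y1 b g.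
Proof. by rewrite /slope -mulrDl; congr (_ * _); ring. Qed.

Lemma interpD {R : realType} (x0 x1 y0 y1 : R) b (f g : R * R -> R) p :
  interp x0 x1 y0 y1 b (fun p => f p + g p) p = interp x0 x1 y0 y1 b f p + interp x0 x1 y0 y1 b g p.
Proof. by rewrite /interp !slopeD; ring. Qed.

(* [kap] stands for N^(-5/2), the size of a layer function on the coarse side of
   its transition point [mx] or [my]. *)
Record layers (R : realType) (eps kap mx my C : R) (S E1 E2 E12 : nat -> nat -> R * R -> R) : Prop :=
  Layers {
    ly_S : smooth 2 S;
    ly_E1 : smooth 3 E1;
    ly_E2 : smooth 3 E2;
    ly_E12 : smooth 3 E12;
    ly_S_le : forall i j p, (i + j <= 2)%N -> Omegabar p -> `|S i j p| <= C;
    ly_E1_le : forall i j p, (i + j <= 3)%N -> Omegabar p -> `|E1 i j p| <= C * eps^-1 ^+ i;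
    ly_E2_le : forall i j p, (i + j <= 3)%N -> Omegabar p -> `|E2 i j p| <= C * eps^-1 ^+ j;
    ly_E12_le : forall i j p, (i + j <= 3)%N -> Omegabar p -> `|E12 i j p| <= C * eps^-1 ^+ (i + j);
    ly_E1_small : forall i j p, (i + j <= 3)%N -> Omegabar p -> p.1 <= mx ->
      `|E1 i j p| <= C * kap * eps^-1 ^+ i;
    ly_E2_small : forall i j p, (i + j <= 3)%N -> Omegabar p -> p.2 <= my ->
      `|E2 i j p| <= C * kap * eps^-1 ^+ j;
    ly_E12_small : forall i j p, (i + j <= 3)%N -> Omegabar p -> p.1 <= mx \/ p.2 <= my ->
      `|E12 i j p| <= C * kap * eps^-1 ^+ (i + j) }.

(** * Reaction, convection and stabilization on one triangle *)

Section triangle_bounds.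
Context {R : realType}.
Variables (N n : nat) (eps q L rho kap mx my C : R) (X Y : nat -> R).
Hypothesis sc : scales N n eps q L rho kap.
Hypotheses (lmX : layer_mesh N n eps q L rho mx X) (lmY : layer_mesh N n eps q L rho my Y).
Hypothesis C0 : 0 <= C.
Variables S E1 E2 E12 : nat -> nat -> R * R -> R.
Hypothesis ly : layers eps kap mx my C S E1 E2 E12.
Variables (i j : nat) (b : bool).
Hypotheses (iN : (i < N)%N) (jN : (j < N)%N).
Local Notation x0 := (X i).
Local Notation x1 := (X i.+1).
Local Notation y0 := (Y j).
Local Notation y1 := (Y j.+1).
Local Notation box := (rect x0 x1 y0 y1).
Local Notation h := (x1 - x0).
Local Notation k := (y1 - y0).
Local Notation T := (tri x0 x1 y0 y1 b).
Local Notation ar := (h * k / 2).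
Local Notation wt := (weight n eps q L).

Let ok : cell_ok x0 x1 y0 y1 := mesh_cell (lm_partition lmX) (lm_partition lmY) iN jN.
Let e0 : 0 < eps. Proof. by case: sc => _ [[]]. Qed.
Let eq_ : eps <= q. Proof. by case: sc => _ [[]]. Qed.
Let q0 : 0 < q. Proof. exact: lt_le_trans eq_. Qed.
Let q1 : q <= 1. Proof. by case: sc => _ [[]]. Qed.
Let L1 : 1 <= L. Proof. by case: sc => _ [_ []]. Qed.
Let qL : q * L ^+ 2 <= 4. Proof. by case: sc => _ [_ []]. Qed.
Let rho1 : 1 <= rho. Proof. by case: sc => _ [_ []]. Qed.
Let kap0 : 0 <= kap. Proof. by case: sc => _ [_ []]. Qed.
Let kapE : kap ^+ 2 = q ^+ 5. Proof. by case: sc => _ [_ []]. Qed.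
Let rho0 : 0 <= rho. Proof. exact: le_trans rho1. Qed.
Let L0 : 0 <= L. Proof. exact: le_trans L1. Qed.
Let h0 : 0 < h. Proof. by case: ok => -[? ? ?] _; rewrite subr_gt0. Qed.
Let k0 : 0 < k. Proof. by case: ok => _ [? ? ?]; rewrite subr_gt0. Qed.
Let hq : h <= 2 * q. Proof. exact: (lm_le lmX iN). Qed.
Let kq : k <= 2 * q. Proof. exact: (lm_le lmY jN). Qed.
Let i0 : 0 <= eps^-1. Proof. by rewrite invr_ge0 ltW. Qed.
Let ar0 : 0 <= ar. Proof. by rewrite divr_ge0 ?mulr_ge0// ltW. Qed.

Let bO p : box p -> Omegabar p. Proof. exact: rect_sub. Qed.

(** Bounds a fine step divided by [eps], and also [q]; all interpolation errors are expressed
    through it. *)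
Let z : R := rho * L * q.

Let z0 : 0 <= z. Proof. by rewrite /z; nonneg. Qed.

Let qz : q <= z.
Proof.
rewrite /z; apply: ler_peMl; first exact: ltW.
by rewrite -[1]mulr1; apply: ler_pM.
Qed.

Let fx : (n <= i)%N -> eps^-1 * h <= z.
Proof.
move=> ni; have := lm_fine_le lmX (i := i); rewrite ni iN => /(_ isT) hle.
by rewrite mulrC ler_pdivrMr// (_ : z * eps = rho * eps * L * q)// /z; ring.
Qed.

Let fy : (n <= j)%N -> eps^-1 * k <= z.
Proof.
move=> nj; have := lm_fine_le lmY (i := j); rewrite nj jN => /(_ isT) hle.
by rewrite mulrC ler_pdivrMr// (_ : z * eps = rho * eps * L * q)// /z; ring.
Qed.

Let box_x p : (i < n)%N -> box p -> p.1 <= mx.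
Proof. by move=> ni [/andP[_ /le_trans] h' _]; apply: h'; exact: lm_mid lmX _ ni. Qed.

Let box_y p : (j < n)%N -> box p -> p.2 <= my.
Proof. by move=> nj [_ /andP[_ /le_trans] h']; apply: h'; exact: lm_mid lmY _ nj. Qed.

Let smooth_error (F : nat -> nat -> R * R -> R) m (M20 M11 M02 B : R) : smooth m F -> (2 <= m)%N -> 0 <= C ->
  (forall p, box p -> `|F 2 0 p| <= C * M20) -> (forall p, box p -> `|F 1 1 p| <= C * M11) ->
  (forall p, box p -> `|F 0 2 p| <= C * M02) ->
  M20 * h * h <= B -> M11 * k * h <= B -> M02 * k * k <= B ->
  forall p, box p -> `|interp x0 x1 y0 y1 b (F 0 0) p - F 0 0 p| <= 4 * C * B.
Proof.
move=> sF m2 _ f20 f11 f02 b20 b11 b02 p bp.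
apply: le_trans (interp_error ok b sF m2 f20 f11 f02 bp) _.
have := ler_wpM2l C0 b20; have := ler_wpM2l C0 b11; have := ler_wpM2l C0 b02; lra.
Qed.

Let small_error (F : nat -> nat -> R * R -> R) : (forall p, box p -> `|F 0 0 p| <= C * kap) ->
  forall p, box p -> `|interp x0 x1 y0 y1 b (F 0 0) p - F 0 0 p| <= 6 * C * q ^+ 2.
Proof.
move=> small p bp; apply: le_trans (ler_normB _ _) _.
have := interp_le ok b small bp; have := small p bp.
have := ler_wpM2l C0 (kap_le sc); lra.
Qed.

Let sq_z : q * q <= z * z. Proof. by apply: ler_pM => //; exact: ltW. Qed.

Let err_S p : box p -> `|interp x0 x1 y0 y1 b (S 0 0) p - S 0 0 p| <= 16 * C * q ^+ 2.
Proof.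
move=> bp.
have hh : h * h <= 4 * q ^+ 2.
  by rewrite (_ : 4 * q ^+ 2 = (2 * q) * (2 * q)); [apply: ler_pM => //; exact: ltW|ring].
have hk : k * h <= 4 * q ^+ 2.
  by rewrite (_ : 4 * q ^+ 2 = (2 * q) * (2 * q)); [apply: ler_pM => //; exact: ltW|ring].
have kk : k * k <= 4 * q ^+ 2.
  by rewrite (_ : 4 * q ^+ 2 = (2 * q) * (2 * q)); [apply: ler_pM => //; exact: ltW|ring].
rewrite (_ : 16 * C * q ^+ 2 = 4 * C * (4 * q ^+ 2)); last by ring.
by apply: (smooth_error (M20 := 1) (M11 := 1) (M02 := 1) (ly_S ly)) => //;
  rewrite ?mul1r ?mulr1// => r br; apply: (ly_S_le ly) => //; exact: bO.
Qed.

Let fine_pair : (n <= i)%N -> eps^-1 ^+ 2 * h * h <= 4 * z ^+ 2.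
Proof.
move=> /fx hz; rewrite (_ : _ * h * h = (eps^-1 * h) * (eps^-1 * h)); last by ring.
have a : (eps^-1 * h) * (eps^-1 * h) <= z * z.
  by apply: ler_pM => //; apply: mulr_ge0 => //; exact: ltW.
have := sqr_ge0 z; rewrite expr2; lra.
Qed.

Let fine_pair_y : (n <= j)%N -> eps^-1 ^+ 2 * k * k <= 4 * z ^+ 2.
Proof.
move=> /fy hz; rewrite (_ : _ * k * k = (eps^-1 * k) * (eps^-1 * k)); last by ring.
have a : (eps^-1 * k) * (eps^-1 * k) <= z * z.
  by apply: ler_pM => //; apply: mulr_ge0 => //; exact: ltW.
have := sqr_ge0 z; rewrite expr2; lra.
Qed.

Let coarse_z t : 0 <= t -> t <= 2 * q -> t <= 2 * z.
Proof. by move=> _ tq; have := qz; lra. Qed.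

Let err_E1 p : box p ->
  `|interp x0 x1 y0 y1 b (E1 0 0) p - E1 0 0 p| <= 16 * C * z ^+ 2.
Proof.
move=> bp; case: (ltnP i n) => ni.
  apply: le_trans (small_error (F := E1) _ bp) _.
    move=> r br; have := ly_E1_small ly (i := 0) (j := 0) isT (bO br) (box_x ni br).
    by rewrite expr0 mulr1.
  have := ler_wpM2l C0 sq_z; have := mulr_ge0 C0 (sqr_ge0 z); rewrite !expr2; lra.
rewrite (_ : 16 * C * z ^+ 2 = 4 * C * (4 * z ^+ 2)); last by ring.
apply: (smooth_error (M20 := eps^-1 ^+ 2) (M11 := eps^-1 ^+ 1) (M02 := eps^-1 ^+ 0) (ly_E1 ly)) => //.
- by move=> r br; apply: (ly_E1_le ly) => //; exact: bO.
- by move=> r br; apply: (ly_E1_le ly) => //; exact: bO.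
- by move=> r br; apply: (ly_E1_le ly) => //; exact: bO.
- exact: fine_pair.
- rewrite expr1 mulrAC.
  have a : eps^-1 * h * k <= z * (2 * z).
    apply: ler_pM; [by apply: mulr_ge0 => //; exact: ltW|exact: ltW|exact: fx|].
    by apply: coarse_z => //; exact: ltW.
  have := sqr_ge0 z; rewrite expr2; lra.
- rewrite expr0 mul1r.
  have a : k * k <= (2 * z) * (2 * z).
    by apply: ler_pM; rewrite ?(ltW k0)// coarse_z// ltW.
  by rewrite expr2; lra.
Qed.

Let err_E2 p : box p ->
  `|interp x0 x1 y0 y1 b (E2 0 0) p - E2 0 0 p| <= 16 * C * z ^+ 2.
Proof.
move=> bp; case: (ltnP j n) => nj.
  apply: le_trans (small_error (F := E2) _ bp) _.
    move=> r br; have := ly_E2_small ly (i := 0) (j := 0) isT (bO br) (box_y nj br).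
    by rewrite expr0 mulr1.
  have := ler_wpM2l C0 sq_z; have := mulr_ge0 C0 (sqr_ge0 z); rewrite !expr2; lra.
rewrite (_ : 16 * C * z ^+ 2 = 4 * C * (4 * z ^+ 2)); last by ring.
apply: (smooth_error (M20 := eps^-1 ^+ 0) (M11 := eps^-1 ^+ 1) (M02 := eps^-1 ^+ 2) (ly_E2 ly)) => //.
- by move=> r br; apply: (ly_E2_le ly) => //; exact: bO.
- by move=> r br; apply: (ly_E2_le ly) => //; exact: bO.
- by move=> r br; apply: (ly_E2_le ly) => //; exact: bO.
- rewrite expr0 mul1r.
  have a : h * h <= (2 * z) * (2 * z).
    by apply: ler_pM; rewrite ?(ltW h0)// coarse_z// ltW.
  by rewrite expr2; lra.
- rewrite expr1.
  have a : eps^-1 * k * h <= z * (2 * z).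
    apply: ler_pM; [by apply: mulr_ge0 => //; exact: ltW|exact: ltW|exact: fy|].
    by apply: coarse_z => //; exact: ltW.
  have := sqr_ge0 z; rewrite expr2; lra.
- exact: fine_pair_y.
Qed.

Let err_E12 p : box p ->
  `|interp x0 x1 y0 y1 b (E12 0 0) p - E12 0 0 p| <= 16 * C * z ^+ 2.
Proof.
move=> bp.
have small_case : (forall r, box r -> r.1 <= mx \/ r.2 <= my) ->
    `|interp x0 x1 y0 y1 b (E12 0 0) p - E12 0 0 p| <= 16 * C * z ^+ 2.
  move=> sm; apply: le_trans (small_error (F := E12) _ bp) _.
    move=> r br; have := ly_E12_small ly (i := 0) (j := 0) isT (bO br) (sm r br).
    by rewrite expr0 mulr1.
  have := ler_wpM2l C0 sq_z; have := mulr_ge0 C0 (sqr_ge0 z); rewrite !expr2; lra.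
case: (ltnP i n) => ni; first by apply: small_case => r /(box_x ni); left.
case: (ltnP j n) => nj; first by apply: small_case => r /(box_y nj); right.
rewrite (_ : 16 * C * z ^+ 2 = 4 * C * (4 * z ^+ 2)); last by ring.
apply: (smooth_error (M20 := eps^-1 ^+ 2) (M11 := eps^-1 ^+ 2) (M02 := eps^-1 ^+ 2) (ly_E12 ly)) => //.
- by move=> r br; apply: (ly_E12_le ly (i := 2) (j := 0)) => //; exact: bO.
- by move=> r br; apply: (ly_E12_le ly (i := 1) (j := 1)) => //; exact: bO.
- by move=> r br; apply: (ly_E12_le ly (i := 0) (j := 2)) => //; exact: bO.
- exact: fine_pair.
- rewrite (_ : _ * k * h = (eps^-1 * h) * (eps^-1 * k)); last by ring.
  have a : (eps^-1 * h) * (eps^-1 * k) <= z * z.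
    by apply: ler_pM; [apply: mulr_ge0 => //; exact: ltW|apply: mulr_ge0 => //; exact: ltW|exact: fx|exact: fy].
  have := sqr_ge0 z; rewrite expr2; lra.
- exact: fine_pair_y.
Qed.

Definition layer_sum : nat -> nat -> R * R -> R := addD (addD E1 E2) E12.

Definition total_sum : nat -> nat -> R * R -> R := addD S layer_sum.

Let W : R := 64 * C * rho ^+ 2.

Lemma interp_error_fine p : box p ->
  `|interp x0 x1 y0 y1 b (total_sum 0 0) p - total_sum 0 0 p| <= W * (L ^+ 2 * q ^+ 2).
Proof.
move=> bp; rewrite /total_sum /layer_sum /addD !interpD.
set a1 := interp _ _ _ _ _ (S 0 0) p; set a2 := interp _ _ _ _ _ (E1 0 0) p.
set a3 := interp _ _ _ _ _ (E2 0 0) p; set a4 := interp _ _ _ _ _ (E12 0 0) p.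
rewrite (_ : _ - _ = (a1 - S 0 0 p) + (a2 - E1 0 0 p) + (a3 - E2 0 0 p) + (a4 - E12 0 0 p)); last by ring.
have -> : W * (L ^+ 2 * q ^+ 2) = 16 * C * z ^+ 2 + 16 * C * z ^+ 2 + 16 * C * z ^+ 2 + 16 * C * z ^+ 2.
  by rewrite /W /z; ring.
do 3?[apply: norm_le_add]; [|exact: err_E1|exact: err_E2|exact: err_E12].
apply: le_trans (err_S bp) _; apply: ler_wpM2l; first by nonneg.
by rewrite !expr2.
Qed.

(** No logarithm appears because the layer functions are at most a multiple of [kap <= q ^+ 2] here.
    It could not be afforded: squaring and dividing by the stabilization parameter would leave four
    logarithms on [q ^+ 3]. *)
Lemma interp_error_coarse p : (i < n)%N -> (j < n)%N -> box p ->
  `|interp x0 x1 y0 y1 b (total_sum 0 0) p - total_sum 0 0 p| <= W * q ^+ 2.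
Proof.
move=> ni nj bp; rewrite /total_sum /layer_sum /addD !interpD.
set a1 := interp _ _ _ _ _ (S 0 0) p; set a2 := interp _ _ _ _ _ (E1 0 0) p.
set a3 := interp _ _ _ _ _ (E2 0 0) p; set a4 := interp _ _ _ _ _ (E12 0 0) p.
rewrite (_ : _ - _ = (a1 - S 0 0 p) + (a2 - E1 0 0 p) + (a3 - E2 0 0 p) + (a4 - E12 0 0 p)); last by ring.
apply: (@le_trans _ _ (16 * C * q ^+ 2 + 6 * C * q ^+ 2 + 6 * C * q ^+ 2 + 6 * C * q ^+ 2)).
  do 3?[apply: norm_le_add]; first exact: err_S.
  - apply: (small_error (F := E1)) => // r br.
    have := ly_E1_small ly (i := 0) (j := 0) isT (bO br) (box_x ni br); by rewrite expr0 mulr1.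
  - apply: (small_error (F := E2)) => // r br.
    have := ly_E2_small ly (i := 0) (j := 0) isT (bO br) (box_y nj br); by rewrite expr0 mulr1.
  - apply: (small_error (F := E12)) => // r br.
    have := ly_E12_small ly (i := 0) (j := 0) isT (bO br) (or_introl (box_x ni br)); by rewrite expr0 mulr1.
have a : C * q ^+ 2 <= C * q ^+ 2 * rho ^+ 2.
  by apply: ler_peMr; [nonneg|exact: exprn_ege1].
have : 0 <= C * q ^+ 2 by nonneg.
rewrite /W; lra.
Qed.

Variables (D1 D2 : nat -> nat -> R * R -> R) (c chi w : R * R -> R) (M mu Cs a0 gx gy : R).
Hypotheses (s1 : smooth 1 D1) (s2 : smooth 1 D2) (cc : cont c) (cchi : cont chi) (cw : cont w).
Hypothesis D1M : forall r s p, (r + s <= 1)%N -> Omegabar p -> `|D1 r s p| <= M.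
Hypothesis D2M : forall r s p, (r + s <= 1)%N -> Omegabar p -> `|D2 r s p| <= M.
Hypothesis cM : forall p, Omegabar p -> `|c p| <= M.
Hypotheses (M1 : 1 <= M) (mu_gt0 : 0 < mu) (Cs0 : 0 < Cs).
Hypothesis chiE : forall p, T p -> chi p = a0 + gx * p.1 + gy * p.2.
Hypothesis wE : forall p, T p ->
  w p = interp x0 x1 y0 y1 b (total_sum 0 0) p - total_sum 0 0 p.

Let bgr (p : R * R) : R := D1 0 0 p * gx + D2 0 0 p * gy.
Let vx : R := slope x0 x1 y0 y1 b (total_sum 0 0).
Let vy : R := slope y0 y1 x0 x1 b (fun p => total_sum 0 0 (swap p)).
Let dl : R := if (i < n)%N && (j < n)%N then Cs * q else 0.
(** 86 = 2 + 8 + 64 + 12: second derivatives of [S], its slope errors, the reaction term through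
    [W], and the interpolated slopes of the layers. *)
Let Z : R := 86 * M * C * rho ^+ 2.
Let Yc : R := 66 * Cs * C * M ^+ 2.
Let G : R := `|gx| + `|gy|.

(** The integrand of [error_identity] without its diffusion part; [gx] and [gy] are the slopes of
    [chi]. *)
Definition rest (p : R * R) : R :=
  ((c p - (D1 1 0 p + D2 0 1 p)) * w p) * chi p - w p * bgr p
  + dl * ((eps * (total_sum 2 0 p + total_sum 0 2 p) + D1 0 0 p * (vx - total_sum 1 0 p)
      + D2 0 0 p * (vy - total_sum 0 1 p) + c p * w p) * bgr p).

(** In order: reaction, convection on fine triangles, convection on coarse ones, regular part and
    layer part of the stabilization. *)
Definition rest_const : R :=
  144 * M ^+ 2 * W ^+ 2 / mu + 32 * W ^+ 2 * M ^+ 2 + 4 * W ^+ 2 / Cs + 4 * Cs * Z ^+ 2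
  + 384 * Yc ^+ 2 / mu.

Let M0 : 0 <= M. Proof. exact: le_trans M1. Qed.
Let W0 : 0 <= W. Proof. by rewrite /W; nonneg. Qed.
Let oT : open T. Proof. exact: tri_open. Qed.
Let sT : T `<=` Omega. Proof. exact: tri_sub. Qed.
Let bT p : T p -> box p. Proof. exact: tri_rect. Qed.
Let TO p : T p -> Omegabar p. Proof. by move=> /bT; exact: bO. Qed.

Let c_D1 : [/\ cont (D1 0 0), cont (D1 1 0) & cont (D1 0 1)].
Proof. by case: s1 => cD _ _; split; exact: cD. Qed.
Let c_D2 : [/\ cont (D2 0 0), cont (D2 1 0) & cont (D2 0 1)].
Proof. by case: s2 => cD _ _; split; exact: cD. Qed.
Let cbgr : cont bgr.
Proof. by case: c_D1 c_D2 => ? ? ? [? ? ?]; rewrite /bgr; contt. Qed.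

Let sE : smooth 2 layer_sum.
Proof.
apply: (smooth_le (m := 3)) => //; apply: smooth_add; last exact: ly_E12 ly.
by apply: smooth_add; [exact: ly_E1 ly|exact: ly_E2 ly].
Qed.

Let adv (p : R * R) : R := c p - (D1 1 0 p + D2 0 1 p).

Let advM p : T p -> `|adv p| <= 3 * M.
Proof.
move=> /TO Op; rewrite (_ : 3 * M = M + (M + M)); last by ring.
apply: norm_le_add; first exact: cM.
by rewrite normrN; apply: norm_le_add; [exact: D1M|exact: D2M].
Qed.

Let young2 (t e A : R) : 0 < e -> 0 <= A -> A * `|t| <= e * t ^+ 2 + A ^+ 2 / (4 * e).
Proof.
move=> e_gt0 A0; rewrite -[t ^+ 2]real_normK ?num_real//.
have e4 : 0 < 4 * e by rewrite mulr_gt0.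
rewrite -(ler_pM2r e4) [X in _ <= X]mulrDl divfK ?gt_eqF//.
have := sqr_ge0 (2 * e * `|t| - A); lra.
Qed.

Let cadv : cont adv.
Proof. by case: c_D1 c_D2 => ? ? ? [? ? ?]; rewrite /adv; contt. Qed.

Let first_term B : (forall p, T p -> `|w p| <= B) ->
  J T (fun p => adv p * w p * chi p) <=
    mu / 16 * J T (fun p => chi p ^+ 2) + 36 * M ^+ 2 * B ^+ 2 / mu * ar.
Proof.
move=> wB; apply: le_trans (J_young ok (b := b) (a := fun p => adv p * w p) (A := 3 * M * B) _ cchi mu_gt0 _) _.
- by contt.
- by move=> p Tp; apply: norm_le_mul; [exact: advM|exact: wB].
by rewrite lerD2l le_eqVlt; apply/orP; left; apply/eqP; ring.
Qed.

Let G0 : 0 <= G. Proof. by rewrite /G addr_ge0. Qed.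

Let bgrM p : T p -> `|bgr p| <= M * G.
Proof.
move=> /TO Op; rewrite /G mulrDr; apply: norm_le_add; apply: norm_le_mul => //.
  exact: D1M.
exact: D2M.
Qed.

(** Without stabilization the gradient of [chi] is controlled through [eps] only, so convection
    leaves [L ^+ 4 * q ^+ 4 / eps]. The bound on [q * L ^+ 2] reduces this to the fine density,
    which is available because the column or the row is fine. *)
Lemma rest_fine : ~~ ((i < n)%N && (j < n)%N) ->
  J T rest <= eps / 16 * (gx ^+ 2 + gy ^+ 2) * ar + mu / 8 * J T (fun p => chi p ^+ 2)
    + rest_const * ((wt i + wt j) * ar).
Proof.
move=> nij.
have -> : J T rest = J T (fun p => adv p * w p * chi p) + J T (fun p => (- w p) * bgr p).
  rewrite -JD//; try contt.
  by apply: eq_J => p _; rewrite /rest /dl (negbTE nij) /adv; ring.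
have wB p : T p -> `|w p| <= W * (L ^+ 2 * q ^+ 2).
  by move=> Tp; rewrite wE//; apply: interp_error_fine; exact: bT.
have t1 := first_term wB.
have t2 : J T (fun p => (- w p) * bgr p) <= (W * (L ^+ 2 * q ^+ 2) * (M * G)) * ar.
  apply: le_trans (ler_norm _) _; apply: J_bound => //; first by contt.
  by move=> p Tp; apply: norm_le_mul; [rewrite normrN; exact: wB|exact: bgrM].
have Jc0 : 0 <= J T (fun p => chi p ^+ 2) by apply: Rintegral_ge0 => p _; exact: sqr_ge0.
set Jc := J T (fun p => chi p ^+ 2) in t1 Jc0 *.
set A := W * (L ^+ 2 * q ^+ 2) * M.
have A0 : 0 <= A by rewrite /A; nonneg.
have e16 : 0 < eps / 16 by rewrite divr_gt0.
have y1 := ler_wpM2r ar0 (young2 gx e16 A0); have y2 := ler_wpM2r ar0 (young2 gy e16 A0).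
have lq : L ^+ 4 * q ^+ 4 <= 4 * (L ^+ 2 * q ^+ 3).
  rewrite (_ : _ * _ = (q * L ^+ 2) * (L ^+ 2 * q ^+ 3)); last by ring.
  by apply: ler_wpM2r => //; nonneg.
have wt0 r : 0 <= wt r by exact: (weight_ge0 sc).
have fine_wt : L ^+ 2 * q ^+ 3 / eps <= wt i + wt j.
  case: (ltnP i n) nij => [_ /= nj|ni _].
    by rewrite -leqNgt in nj; have := weight_ge_fine sc nj; have := wt0 i; lra.
  by have := weight_ge_fine sc ni; have := wt0 j; lra.
have lqe : L ^+ 2 * q ^+ 3 <= L ^+ 2 * q ^+ 3 / eps.
  apply: ler_peMr; first by nonneg.
  by rewrite invf_ge1//; exact: le_trans q1.
have r1 : 36 * M ^+ 2 * (W * (L ^+ 2 * q ^+ 2)) ^+ 2 / mu * ar <= 144 * M ^+ 2 * W ^+ 2 / mu * ((wt i + wt j) * ar).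
  rewrite (_ : _ / mu * ar = 36 * M ^+ 2 * W ^+ 2 / mu * (L ^+ 4 * q ^+ 4 * ar)); last by field; rewrite gt_eqF.
  rewrite (_ : 144 * _ * _ / mu * _ = 36 * M ^+ 2 * W ^+ 2 / mu * (4 * (wt i + wt j) * ar)); last by field; rewrite gt_eqF.
  apply: ler_wpM2l; first by nonneg.
  by apply: ler_wpM2r => //; lra.
have r2 : 2 * (A ^+ 2 / (4 * (eps / 16)) * ar) <= 32 * W ^+ 2 * M ^+ 2 * ((wt i + wt j) * ar).
  rewrite (_ : 2 * _ = 8 * W ^+ 2 * M ^+ 2 * (L ^+ 4 * q ^+ 4 / eps * ar)); last by rewrite /A; field; rewrite gt_eqF.
  rewrite (_ : 32 * _ * _ * _ = 8 * W ^+ 2 * M ^+ 2 * (4 * (wt i + wt j) * ar)); last by ring.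
  apply: ler_wpM2l; first by nonneg.
  apply: ler_wpM2r => //; have := ler_wpM2r i0 lq; rewrite -mulrA; lra.
have wa : 0 <= (wt i + wt j) * ar by apply: mulr_ge0 => //; apply: addr_ge0; exact: wt0.
have k3 : 0 <= 4 * W ^+ 2 / Cs * ((wt i + wt j) * ar) by nonneg.
have k4 : 0 <= 4 * Cs * Z ^+ 2 * ((wt i + wt j) * ar) by nonneg.
have k5 : 0 <= 384 * Yc ^+ 2 / mu * ((wt i + wt j) * ar) by nonneg.
have mJ : 0 <= mu * Jc by nonneg.
have Ge : W * (L ^+ 2 * q ^+ 2) * (M * G) * ar = A * `|gx| * ar + A * `|gy| * ar.
  by rewrite /A /G; ring.
rewrite Ge in t2; rewrite /rest_const; lra.
Qed.

(** Here [1 / dl] replaces [1 / eps] in the convection term. The stabilization residual is split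
    into [reg], which is O(q) pointwise, and [lay], which is small only after integration by
    parts. *)
Lemma rest_coarse : (i < n)%N -> (j < n)%N ->
  J T rest <= mu / 8 * J T (fun p => chi p ^+ 2) + dl / 8 * J T (fun p => bgr p ^+ 2)
    + rest_const * ((wt i + wt j) * ar).
Proof.
move=> ni nj; have dlE : dl = Cs * q by rewrite /dl ni nj.
have dl0 : 0 < dl by rewrite dlE mulr_gt0.
have [d00 d10 d01] := c_D1; have [f00 f10 f01] := c_D2.
have cS r s : (r + s <= 2)%N -> cont (S r s) by case: (ly_S ly) => cS _ _; exact: cS.
have cE r s : (r + s <= 2)%N -> cont (layer_sum r s) by case: sE => cE _ _; exact: cE.
have [S00 S10 S01] : [/\ cont (S 0 0), cont (S 1 0) & cont (S 0 1)] by split; exact: cS.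
have [S20 S02] : cont (S 2 0) /\ cont (S 0 2) by split; exact: cS.
have [L00 L10 L01] : [/\ cont (layer_sum 0 0), cont (layer_sum 1 0) & cont (layer_sum 0 1)] by split; exact: cE.
have [L20 L02] : cont (layer_sum 2 0) /\ cont (layer_sum 0 2) by split; exact: cE.
pose vxS := slope x0 x1 y0 y1 b (S 0 0).
pose vyS := slope y0 y1 x0 x1 b (fun p => S 0 0 (swap p)).
pose vxE := slope x0 x1 y0 y1 b (layer_sum 0 0).
pose vyE := slope y0 y1 x0 x1 b (fun p => layer_sum 0 0 (swap p)).
have vxD : vx = vxS + vxE by rewrite /vx /total_sum /addD slopeD.
have vyD : vy = vyS + vyE by rewrite /vy /total_sum /addD slopeD.
(* The interpolated slopes of the layer functions stay in [reg]: difference quotients over coarse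
   steps are of order [kap / q], at most [q]. Only true derivatives of the layers go to [lay]. *)
pose reg p := eps * (S 2 0 p + S 0 2 p) + D1 0 0 p * (vxS - S 1 0 p) + D2 0 0 p * (vyS - S 0 1 p)
  + c p * w p + D1 0 0 p * vxE + D2 0 0 p * vyE.
pose lay p := (eps * (layer_sum 2 0 p + layer_sum 0 2 p) - D1 0 0 p * layer_sum 1 0 p
  - D2 0 0 p * layer_sum 0 1 p) * bgr p.
have creg : cont reg by rewrite /reg; contt.
have clay : cont lay by rewrite /lay; contt.
have -> : J T rest = J T (fun p => adv p * w p * chi p) + J T (fun p => (- w p) * bgr p)
    + dl * J T (fun p => reg p * bgr p) + dl * J T lay.
  rewrite -!JZ//; try contt.
  rewrite -!JD//; try contt.
  by apply: eq_J => p _; rewrite /rest vxD vyD /reg /lay /adv /total_sum /addD; ring.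
have wB p : T p -> `|w p| <= W * q ^+ 2.
  by move=> Tp; rewrite wE//; apply: interp_error_coarse => //; exact: bT.
have t1 := first_term wB.
have t2 : J T (fun p => (- w p) * bgr p) <=
    dl / 16 * J T (fun p => bgr p ^+ 2) + 4 * (W * q ^+ 2) ^+ 2 / dl * ar.
  apply: (J_young ok (a := fun p => - w p)) => //; first by contt.
  by move=> p Tp; rewrite normrN; exact: wB.
(* Each layer function loses [1 / eps] in its own direction only; as [1 / eps] is at least 1, the
   total order serves for all three. *)
have Ck p r s : box p -> (r + s <= 1)%N -> `|layer_sum r s p| <= 3 * (C * kap) * eps^-1 ^+ (r + s).
  move=> bp rs; have rs3 : (r + s <= 3)%N by exact: leq_trans rs _.
  have ie1 : 1 <= eps^-1 by rewrite invf_ge1//; exact: le_trans q1.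
  have Ck0 : 0 <= C * kap by nonneg.
  have up m : (m <= r + s)%N -> C * kap * eps^-1 ^+ m <= C * kap * eps^-1 ^+ (r + s).
    by move=> mrs; apply: ler_wpM2l => //; rewrite ler_weXn2l.
  rewrite (_ : 3 * (C * kap) * _ = C * kap * eps^-1 ^+ (r + s) + C * kap * eps^-1 ^+ (r + s)
    + C * kap * eps^-1 ^+ (r + s)); last by ring.
  rewrite /layer_sum /addD; do 2?[apply: norm_le_add].
  - by apply: le_trans (up r (leq_addr _ _)); apply: (ly_E1_small ly) => //; [exact: bO|exact: box_x].
  - by apply: le_trans (up s (leq_addl _ _)); apply: (ly_E2_small ly) => //; [exact: bO|exact: box_y].
  - by apply: (ly_E12_small ly) => //; [exact: bO|left; exact: box_x].
have E00 p : box p -> `|layer_sum 0 0 p| <= 3 * (C * kap).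
  by move=> bp; have := Ck p 0%N 0%N bp isT; rewrite expr0 mulr1.
have qh : q <= h by exact: (lm_coarse lmX ni).
have qk : q <= k by exact: (lm_coarse lmY nj).
have slope_small (v t : R) : q <= t -> `|v| * t <= 2 * (3 * (C * kap)) -> `|v| <= 6 * C * q.
  move=> qt vt; rewrite -(ler_pM2r q0).
  have a1 := ler_wpM2l (normr_ge0 v) qt.
  have a2 := ler_wpM2l C0 (kap_le sc); lra.
have vxE_le : `|vxE| <= 6 * C * q by apply: (slope_small _ h) => //; exact: (slope_le ok b E00).
have vyE_le : `|vyE| <= 6 * C * q.
  apply: (slope_small _ k) => //.
  apply: (slope_le (cell_ok_swap ok) b (D := fun _ _ p => layer_sum 0 0 (swap p))).
  by move=> p /rect_swap; exact: E00.
have slopeS p : box p -> `|vxS - S 1 0 p| <= 4 * C * q.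
  move=> bp; rewrite distrC.
  apply: le_trans (slope_error ok b (ly_S ly) (M20 := C) (M11 := C) _ _ _ bp) _ => //.
  - by move=> r br; apply: (ly_S_le ly) => //; exact: bO.
  - by move=> r br; apply: (ly_S_le ly) => //; exact: bO.
  by have := ler_wpM2l C0 hq; have := ler_wpM2l C0 kq; lra.
have slopeS_y p : box p -> `|vyS - S 0 1 p| <= 4 * C * q.
  move=> bp; rewrite distrC.
  have M20 r : rect y0 y1 x0 x1 r -> `|swapD S 2 0 r| <= C.
    by move=> /rect_swap br; apply: (ly_S_le ly) => //; exact: bO.
  have M11 r : rect y0 y1 x0 x1 r -> `|swapD S 1 1 r| <= C.
    by move=> /rect_swap br; apply: (ly_S_le ly) => //; exact: bO.
  have := slope_error (cell_ok_swap ok) b (smooth_swap (ly_S ly)) isT M20 M11.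
  case: p bp => p1 p2 bp; have /rect_swap bp' := bp.
  move=> /(_ _ bp'); rewrite {1}/swapD/= => hS; apply: le_trans hS _.
  by have := ler_wpM2l C0 hq; have := ler_wpM2l C0 kq; lra.
have regM p : T p -> `|reg p| <= Z * q.
  move=> Tp; have Op := TO Tp; have bp := bT Tp.
  have D1p := D1M (r := 0) (s := 0) isT Op; have D2p := D2M (r := 0) (s := 0) isT Op.
  have MC0 : 0 <= M * C by nonneg.
  have CM : C <= M * C by apply: ler_peMl.
  have r2 : 1 <= rho ^+ 2 by exact: exprn_ege1.
  have wq : `|w p| <= W * q.
    apply: le_trans (wB p Tp) _; apply: ler_wpM2l; first exact: W0.
    by rewrite expr2; apply: ler_piMl => //; exact: ltW.
  have p1 : `|eps * (S 2 0 p + S 0 2 p)| <= q * (C + C).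
    apply: norm_le_mul; first by rewrite gtr0_norm.
    by apply: norm_le_add; apply: (ly_S_le ly).
  apply: (@le_trans _ _ (q * (C + C) + M * (4 * C * q) + M * (4 * C * q) + M * (W * q)
     + M * (6 * C * q) + M * (6 * C * q))).
    do 5?[apply: norm_le_add]; first exact: p1.
    - by apply: norm_le_mul => //; exact: slopeS.
    - by apply: norm_le_mul => //; exact: slopeS_y.
    - by apply: norm_le_mul => //; exact: cM.
    - exact: norm_le_mul.
    - exact: norm_le_mul.
  have z1 : C * q <= M * C * q by apply: ler_wpM2r => //; exact: ltW.
  have z2 : M * C * q <= M * C * q * rho ^+ 2 by apply: ler_peMr => //; nonneg.
  rewrite /Z /W; lra.
have t3 : J T (fun p => reg p * bgr p) <= 1 / 16 * J T (fun p => bgr p ^+ 2) + 4 * (Z * q) ^+ 2 / 1 * ar.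
  exact: (J_young ok).
have t4 : J T lay <= 22 * (3 * (C * kap)) * M ^+ 2 * G / q * ar.
  apply: le_trans (ler_norm _) _.
  apply: (@layer_residual _ _ _ _ _ ok layer_sum D1 D2 b eps q (3 * (C * kap)) M gx gy) => //.
  - by nonneg.
  - by move=> p bp; have := Ck p 1%N 0%N bp isT; rewrite expr1.
  - by move=> p bp; have := Ck p 0%N 1%N bp isT; rewrite expr1.
  - by move=> r s p rs bp; apply: D1M => //; exact: bO.
  - by move=> r s p rs bp; apply: D2M => //; exact: bO.
have Jc0 : 0 <= J T (fun p => chi p ^+ 2) by apply: Rintegral_ge0 => p _; exact: sqr_ge0.
have JcE : J T (fun p => chi p ^+ 2) = J T (fun p => (a0 + gx * p.1 + gy * p.2) ^+ 2).
  by apply: eq_J => p Tp; rewrite chiE.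
have invx : gx ^+ 2 * q ^+ 2 * ar <= 24 * J T (fun p => chi p ^+ 2).
  have := inverse_x ok b a0 gx gy; rewrite -JcE => iv.
  have qq : q ^+ 2 <= h ^+ 2 by rewrite !expr2; apply: ler_pM => //; exact: ltW.
  have g0 : 0 <= gx ^+ 2 * ar by apply: mulr_ge0 => //; exact: sqr_ge0.
  have := ler_wpM2l g0 qq; lra.
have invy : gy ^+ 2 * q ^+ 2 * ar <= 24 * J T (fun p => chi p ^+ 2).
  have := inverse_y ok b a0 gx gy; rewrite -JcE => iv.
  have qq : q ^+ 2 <= k ^+ 2 by rewrite !expr2; apply: ler_pM => //; exact: ltW.
  have g0 : 0 <= gy ^+ 2 * ar by apply: mulr_ge0 => //; exact: sqr_ge0.
  have := ler_wpM2l g0 qq; lra.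
set Jc := J T (fun p => chi p ^+ 2) in t1 Jc0 invx invy *.
set Jb := J T (fun p => bgr p ^+ 2) in t2 t3 *.
have Yc0 : 0 <= Yc by rewrite /Yc; nonneg.
set A := Yc * kap / q.
have A0 : 0 <= A by rewrite /A; nonneg.
(* Two slopes, each costing 24 by the inverse inequality: 2 * 24 / 768 = 1/16, the part of the L2
   norm not yet taken by the reaction term. *)
have mu768 : 0 < mu / 768 by apply: divr_gt0; [exact: mu_gt0|rewrite ltr0n].
have y1 := ler_wpM2r ar0 (young2 (q * gx) mu768 A0).
have y2 := ler_wpM2r ar0 (young2 (q * gy) mu768 A0).
have ty : dl * J T lay <= A * `|q * gx| * ar + A * `|q * gy| * ar.
  apply: le_trans (ler_wpM2l (ltW dl0) t4) _.
  rewrite !normrM (gtr0_norm q0) dlE le_eqVlt; apply/orP; left; apply/eqP.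
  by rewrite /A /Yc /G; field; rewrite gt_eqF.
have tr := ler_wpM2l (ltW dl0) t3.
have wt0 r : 0 <= wt r by exact: (weight_ge0 sc).
have q3 : q ^+ 3 <= wt i + wt j.
  by have := weight_ge_coarse sc i; have := wt0 j; lra.
have q3a := ler_wpM2r ar0 q3.
have q4 : q ^+ 4 <= q ^+ 3 by rewrite [q ^+ 4]exprS; apply: ler_piMl => //; nonneg.
have q4a := ler_wpM2r ar0 q4.
have r1 : 36 * M ^+ 2 * (W * q ^+ 2) ^+ 2 / mu * ar <= 144 * M ^+ 2 * W ^+ 2 / mu * ((wt i + wt j) * ar).
  rewrite (_ : _ / mu * ar = 36 * M ^+ 2 * W ^+ 2 / mu * (q ^+ 4 * ar)); last by field; rewrite gt_eqF.
  rewrite (_ : 144 * _ * _ / mu * _ = 36 * M ^+ 2 * W ^+ 2 / mu * (4 * ((wt i + wt j) * ar))); last by field; rewrite gt_eqF.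
  apply: ler_wpM2l; first by nonneg.
  have : 0 <= (wt i + wt j) * ar by apply: mulr_ge0 => //; apply: addr_ge0; exact: wt0.
  lra.
have r2 : 4 * (W * q ^+ 2) ^+ 2 / dl * ar <= 4 * W ^+ 2 / Cs * ((wt i + wt j) * ar).
  rewrite dlE (_ : _ / _ * ar = 4 * W ^+ 2 / Cs * (q ^+ 3 * ar)); last by field; rewrite !gt_eqF.
  by apply: ler_wpM2l => //; nonneg.
have r3 : dl * (4 * (Z * q) ^+ 2 / 1 * ar) <= 4 * Cs * Z ^+ 2 * ((wt i + wt j) * ar).
  rewrite dlE (_ : _ * _ = 4 * Cs * Z ^+ 2 * (q ^+ 3 * ar)); last by field.
  by apply: ler_wpM2l => //; nonneg.
have r4 : 2 * (A ^+ 2 / (4 * (mu / 768)) * ar) <= 384 * Yc ^+ 2 / mu * ((wt i + wt j) * ar).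
  rewrite (_ : 2 * _ = 384 * Yc ^+ 2 / mu * (kap ^+ 2 / q ^+ 2 * ar)); last first.
    by rewrite /A; field; rewrite !gt_eqF.
  rewrite kapE (_ : q ^+ 5 / q ^+ 2 = q ^+ 3); last by field; rewrite gt_eqF.
  by apply: ler_wpM2l => //; nonneg.
have wa : 0 <= (wt i + wt j) * ar by apply: mulr_ge0 => //; apply: addr_ge0; exact: wt0.
have k2 : 0 <= 32 * W ^+ 2 * M ^+ 2 * ((wt i + wt j) * ar) by nonneg.
have mx1 := ler_wpM2l (ltW mu768) invx; have my1 := ler_wpM2l (ltW mu768) invy.
rewrite /rest_const; lra.
Qed.

End triangle_bounds.

(** * Energy estimate *)

(** Exchanging the coordinates exchanges [E1] with [E2], so the y-part of the diffusion term is an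
    instance of the x-part. *)
Lemma layers_swap (R : realType) (eps kap mx my C : R) S E1 E2 E12 :
  layers eps kap mx my C S E1 E2 E12 ->
  layers eps kap my mx C (swapD S) (swapD E2) (swapD E1) (swapD E12).
Proof.
case=> sS s1 s2 s12 S_le l1 l2 l12 m1 m2 m12; split; try exact: smooth_swap.
- by move=> i j p ij /Omegabar_swap; apply: S_le; rewrite addnC.
- by move=> i j p ij /Omegabar_swap; apply: l2; rewrite addnC.
- by move=> i j p ij /Omegabar_swap; apply: l1; rewrite addnC.
- by move=> i j p ij /Omegabar_swap; rewrite (addnC i); apply: l12; rewrite addnC.
- by move=> i j p ij /Omegabar_swap; apply: m2; rewrite addnC.
- by move=> i j p ij /Omegabar_swap; apply: m1; rewrite addnC.
- move=> i j p ij /Omegabar_swap Op xy; rewrite (addnC i); apply: m12 => //.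
    by rewrite addnC.
  by case: xy; [right|left].
Qed.

Section total.
Context {R : realType}.
Variables (N n : nat) (eps q L rho kap mx my C : R) (X Y : nat -> R).
Hypothesis sc : scales N n eps q L rho kap.
Hypotheses (lmX : layer_mesh N n eps q L rho mx X) (lmY : layer_mesh N n eps q L rho my Y).
Hypothesis C0 : 0 <= C.
Variables S E1 E2 E12 : nat -> nat -> R * R -> R.
Hypothesis ly : layers eps kap mx my C S E1 E2 E12.
Local Notation T := (mesh_tri X Y).
Local Notation D := (total_sum S E1 E2 E12).
Local Notation wt := (weight n eps q L).
Local Notation size := ((eps * q ^+ 2 + q ^+ 3) * L ^+ 3).

Let pX := lm_partition lmX.
Let pY := lm_partition lmY.
Let e0 : 0 < eps. Proof. by case: sc => _ [[]]. Qed.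
Let eq_ : eps <= q. Proof. by case: sc => _ [[]]. Qed.
Let q0 : 0 < q. Proof. exact: lt_le_trans eq_. Qed.
Let q1 : q <= 1. Proof. by case: sc => _ [[]]. Qed.
Let i1 : 1 <= eps^-1. Proof. by rewrite invf_ge1//; exact: le_trans q1. Qed.

Definition slope_const : R :=
  3 * (128 * C ^+ 2) * rho + 3 * (288 * C ^+ 2 * rho ^+ 2) * rho
  + 2 * (3 * (2 * (240 * 240 * C ^+ 2 * rho ^+ 4)) * rho).

Lemma slope_total_sum x0 x1 y0 y1 b : slope x0 x1 y0 y1 b (D 0 0) =
  slope x0 x1 y0 y1 b (S 0 0) + slope x0 x1 y0 y1 b (E1 0 0)
  + slope x0 x1 y0 y1 b (E2 0 0) + slope x0 x1 y0 y1 b (E12 0 0).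
Proof. by rewrite /total_sum /layer_sum /addD !slopeD; ring. Qed.

(** Four applications with share 1/32. In the x-direction [S] and [E2] are handled without patches,
    [E1] and [E12] with them. *)
Lemma total_slope_terms (g : nat -> nat -> bool -> R) :
  (forall i j, (i < N)%N -> g i j.+1 true = g i j false) ->
  (forall i, (i < N)%N -> g i 0 true = 0) -> (forall i, (i < N)%N -> g i N.-1 false = 0) ->
  mesh_sum N (slope_term eps X Y g D) <=
    mesh_sum N (fun i j b => eps * (g i j b ^+ 2 * tri_area X Y i j)) / 8 + slope_const * size.
Proof.
move=> gsh gbot gtop.
have -> : mesh_sum N (slope_term eps X Y g D) = mesh_sum N (slope_term eps X Y g S)
    + mesh_sum N (slope_term eps X Y g E1) + mesh_sum N (slope_term eps X Y g E2)
    + mesh_sum N (slope_term eps X Y g E12).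
  rewrite -!mesh_sumD; apply: eq_mesh_sum => i j b iN jN; rewrite /slope_term.
  have ok := mesh_cell pX pY iN jN.
  have oT : open (T i j b) by exact: tri_open.
  have sT : T i j b `<=` Omega by exact: tri_sub.
  have cS : cont (S 1%R 0%R) by case: (ly_S ly) => cD _ _; exact: cD.
  have c1 : cont (E1 1%R 0%R) by case: (ly_E1 ly) => cD _ _; exact: cD.
  have c2 : cont (E2 1%R 0%R) by case: (ly_E2 ly) => cD _ _; exact: cD.
  have c12 : cont (E12 1%R 0%R) by case: (ly_E12 ly) => cD _ _; exact: cD.
  rewrite -!mulrDr -!JD//; try contt.
  congr (_ * (_ * _)); apply: eq_J => p _.
  by rewrite slope_total_sum /total_sum /layer_sum /addD; ring.
have iS := regular_slope_terms (rho := rho) sc lmX lmY C0 g (ly_S ly) (ly_S_le ly).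
have le_i m1 m2 : (m1 <= m2)%N -> C * eps^-1 ^+ m1 <= C * eps^-1 ^+ m2.
  by move=> m12; apply: ler_wpM2l => //; rewrite ler_weXn2l.
have iE2 : mesh_sum N (slope_term eps X Y g E2) <=
    mesh_sum N (fun i j b => eps * (g i j b ^+ 2 * tri_area X Y i j)) / 32
    + 3 * (288 * C ^+ 2 * rho ^+ 2) * rho * size.
  apply: (ylayer_slope_terms sc lmX lmY C0 g (ly_E2 ly)).
  - by move=> p Op; have := ly_E2_le ly (i := 2) (j := 0) isT Op; rewrite expr0 mulr1.
  - by move=> p Op; have := ly_E2_le ly (i := 1) (j := 1) isT Op; rewrite expr1.
  - by move=> p Op py; have := ly_E2_small ly (i := 0) (j := 0) isT Op py; rewrite expr0 mulr1.
have iE1 : mesh_sum N (slope_term eps X Y g E1) <=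
    mesh_sum N (fun i j b => eps * (g i j b ^+ 2 * tri_area X Y i j)) / 32
    + 3 * (2 * (240 * 240 * C ^+ 2 * rho ^+ 4)) * rho * size.
  apply: (xlayer_slope_terms sc lmX lmY C0 (g := g) (ly_E1 ly)) => //.
  - move=> i j p ij Op; apply: le_trans (le_i i 2%N _); last by rewrite -ij leq_addr.
    by apply: (ly_E1_le ly _ Op); rewrite ij.
  - move=> i j p ij Op; apply: le_trans (le_i i 3%N _); last by rewrite -ij leq_addr.
    by apply: (ly_E1_le ly _ Op); rewrite ij.
  - by move=> p Op px; have := ly_E1_small ly (i := 0) (j := 0) isT Op px; rewrite expr0 mulr1.
  - left=> p Op; split.
    + by have := ly_E1_le ly (i := 1) (j := 1) isT Op; rewrite expr1.
    + exact: (ly_E1_le ly (i := 2) (j := 1)).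
    + by have := ly_E1_le ly (i := 1) (j := 2) isT Op; rewrite expr1.
have iE12 : mesh_sum N (slope_term eps X Y g E12) <=
    mesh_sum N (fun i j b => eps * (g i j b ^+ 2 * tri_area X Y i j)) / 32
    + 3 * (2 * (240 * 240 * C ^+ 2 * rho ^+ 4)) * rho * size.
  apply: (xlayer_slope_terms sc lmX lmY C0 (g := g) (ly_E12 ly)) => //.
  - by move=> i j p ij Op; rewrite -ij; apply: (ly_E12_le ly _ Op); rewrite ij.
  - by move=> i j p ij Op; rewrite -ij; apply: (ly_E12_le ly _ Op); rewrite ij.
  - by move=> p Op px; have := ly_E12_small ly (i := 0) (j := 0) isT Op (or_introl px); rewrite expr0 mulr1.
  - by right=> p Op py; have := ly_E12_small ly (i := 0) (j := 0) isT Op (or_intror py); rewrite expr0 mulr1.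
set en := mesh_sum _ _ in iS iE1 iE2 iE12 *.
rewrite /slope_const; set sz := size in iS iE1 iE2 iE12 *; lra.
Qed.

Lemma sum_weight_area : mesh_sum N (fun i j _ => (wt i + wt j) * tri_area X Y i j) <= 6 * rho * size.
Proof.
have sx := sum_weight sc lmX; have sy := sum_weight sc lmY.
have total Z : partition01 N Z -> \sum_(j < N) (Z j.+1 - Z j) = 1.
  by move=> [Z0 Z1 _]; rewrite -(big_mkord xpredT (fun i => Z i.+1 - Z i)) telescope_sumr// Z0 Z1 subr0.
have -> : mesh_sum N (fun i j _ => (wt i + wt j) * tri_area X Y i j) =
    \sum_(i < N) wt i * (X i.+1 - X i) + \sum_(j < N) wt j * (Y j.+1 - Y j).
  rewrite /mesh_sum (eq_bigr (fun i : 'I_N => \sum_(j < N) (wt i * (X i.+1 - X i) * (Y j.+1 - Y j)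
    + wt j * (Y j.+1 - Y j) * (X i.+1 - X i)))); last first.
    by move=> i _; apply: eq_bigr => j _; rewrite /tri_area; field.
  rewrite (eq_bigr (fun i : 'I_N => wt i * (X i.+1 - X i)
    + (\sum_(j < N) wt j * (Y j.+1 - Y j)) * (X i.+1 - X i))); last first.
    by move=> i _; rewrite big_split/= -mulr_sumr total// mulr1 -mulr_suml.
  by rewrite big_split/= -mulr_sumr total// mulr1.
lra.
Qed.

End total.

(** * The Shishkin mesh and the given decomposition satisfy the abstract hypotheses *)

Section parameters.
Context {R : realType}.
Variables (P : sdfem_data R) (eps : R) (N : nat).
Hypotheses (b10 : 0 < beta1 P) (b20 : 0 < beta2 P) (mok : mesh_ok P eps N).
Local Notation q := (N%:R^-1 : R).
Local Notation L := (ln N%:R : R).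
Local Notation kap := (expR (- (5 / 2 * L)) : R).

Let N0 : 0 < N%:R :> R.
Proof. by case: mok; case: N. Qed.

Lemma mesh_scales rho : 1 <= rho -> scales N N./2 eps q L rho kap.
Proof.
move=> rho1; have [N4 evN e0 eq_ _] := mok; have L1 := ln_ge1 mok.
have expL : expR L = N%:R :> R by rewrite lnK ?posrE.
split; [|split].
- by split => //; move: N4; clear; lia.
- by split => //; rewrite invf_le1// ler1n; case: N N4.
- split => //; last first.
    rewrite -!expRM_natl -[q in RHS]lnK ?posrE ?invr_gt0// lnV ?posrE// -expRM_natl.
    by congr expR; field.
  rewrite mulrC ler_pdivrMr//.
  (* Squaring gives [L ^+ 2 / 4 <= N], hence the bound 4 for [q * L ^+ 2]. *)
  have e2 : L / 2 <= expR (L / 2).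
    by apply: le_trans (expR_ge1Dx _); rewrite lerDr.
  have l2 : 0 <= L / 2 by lra.
  have := ler_pM l2 l2 e2 e2; rewrite -expRD -mulrDl.
  rewrite (_ : (L + L) / 2 = L); last by field.
  rewrite expL; lra.
Qed.

(** The fine step equals [5 / beta * eps * L * q]; [rho] must dominate [5 / beta] for the upper
    bounds and [beta / 5] for the lower one, where [1 <= L] is also used. *)
Lemma shishkin_layer_mesh beta rho : 0 < beta -> 1 <= rho -> 5 / beta <= rho -> beta / 5 <= rho ->
  transition beta eps N <= 2^-1 ->
  layer_mesh N N./2 eps q L rho (1 - transition beta eps N) (shishkin (transition beta eps N) N).
Proof.
move=> beta0 rho1 r5 rb tr; have [N4 evN e0 eq_ _] := mok; have L1 := ln_ge1 mok.
have q0 : 0 < q by rewrite invr_gt0.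
have L0 : 0 < L by exact: lt_le_trans L1.
have tE : transition beta eps N = 5 / beta * eps * L / 2 by rewrite /transition; field; rewrite gt_eqF.
have t0 : 0 < transition beta eps N by rewrite tE !(divr_gt0, mulr_gt0)//.
have eL : 0 < eps * L by rewrite mulr_gt0.
have r5e := ler_wpM2r (ltW eL) r5.
split.
- exact: shishkin_partition.
- by move=> i ni; rewrite shishkin_step//; case/andP: (step_coarse t0 tr N4 evN ni).
- by move=> i _; rewrite shishkin_step//; exact: (step_le t0 tr N4 evN).
- move=> i /andP[ni _]; rewrite shishkin_step// step_fine// tE.
  have -> : rho * (2 * (5 / beta * eps * L / 2) * q) = eps * q * (rho * (5 / beta) * L) by field; rewrite !gt_eqF.
  apply: ler_peMr; first by rewrite mulr_ge0 ?ltW.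
  rewrite -[leLHS]mulr1; apply: ler_pM => //.
  by rewrite -ler_pdivrMr ?divr_gt0// div1r invf_div.
- move=> i /andP[ni _]; rewrite shishkin_step// step_fine// tE.
  rewrite (_ : 2 * _ * q = 5 / beta * (eps * L) * q); last by field; rewrite !gt_eqF.
  by rewrite (_ : rho * eps * L * q = rho * (eps * L) * q) ?ler_pM2r//; ring.
- rewrite (eq_bigr (fun i : 'I_N => step (transition beta eps N) N i)); last first.
    by move=> i _; rewrite shishkin_step.
  rewrite sum_step_fine// tE; apply: le_trans (_ : 5 / beta * (eps * L) <= _).
    rewrite [leLHS](_ : _ = 5 / beta * (eps * L) / 2); last by field; rewrite gt_eqF.
    have a0 : 0 <= 5 / beta * (eps * L) by apply: mulr_ge0; [apply: divr_ge0|]; rewrite // ltW.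
    by lra.
  by rewrite -[leRHS]mulrA.
- move=> i ni iN; rewrite !shishkin_step// /step.
  by case/orP: ni => [ni|ni]; [rewrite ni (ltn_trans _ ni)|rewrite !ltnNge ni leqW].
- by move=> i ni; exact: shishkin_le_mid.
Qed.

End parameters.

(** Beyond a transition point the exponent is at least [5 / 2 * ln N], so the exponential is at most
    [kap]; elsewhere it is bounded by 1. The absolute value appears because no sign of [C0] is
    assumed. *)
Lemma decomposition_layers {R : realType} (P : sdfem_data R) (eps C0 : R) (N : nat) u :
  0 < beta1 P -> 0 < beta2 P -> mesh_ok P eps N -> decomposition P C0 eps u ->
  exists S E1 E2 E12, layers eps (expR (- (5 / 2 * ln N%:R))) (1 - lambda_x P eps N)
      (1 - lambda_y P eps N) `|C0| S E1 E2 E12 /\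
    forall p, Omegabar p -> u p = total_sum S E1 E2 E12 0 0 p.
Proof.
move=> b10 b20 mok [S [E1 [E2 [E12 [DS [DE1 [DE2 [DE12 [uE [cS c1 c2 c12] Sle Ele]]]]]]]]].
have [_ _ e0 _ _] := mok.
have [DS' [sS S0 SE]] := Ck_smooth cS; have [D1 [s1 E10 E1E]] := Ck_smooth c1.
have [D2 [s2 E20 E2E]] := Ck_smooth c2; have [D12 [s12 E120 E12E]] := Ck_smooth c12.
have C0le : C0 <= `|C0| by exact: ler_norm.
have i0 m : 0 <= eps^-1 ^+ m by rewrite exprn_ge0// invr_ge0 ltW.
have pos (beta t : R) : 0 < beta -> t <= 1 -> 0 <= beta * (1 - t) / eps.
  by move=> bt t1; rewrite divr_ge0 ?mulr_ge0 ?subr_ge0// ltW.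
have far (beta t : R) : 0 < beta -> t <= 1 - transition beta eps N ->
    5 / 2 * ln N%:R <= beta * (1 - t) / eps.
  move=> bt tm; rewrite ler_pdivlMr//.
  have -> : 5 / 2 * ln N%:R * eps = beta * transition beta eps N.
    by rewrite /transition; field; rewrite gt_eqF.
  by rewrite ler_pM2l//; lra.
have weak m t : C0 * eps ^- m * expR (- t) <= `|C0| * eps^-1 ^+ m * expR (- t).
  by rewrite -exprVn !ler_wpM2r ?expR_ge0.
have one m t : 0 <= t -> C0 * eps ^- m * expR (- t) <= `|C0| * eps^-1 ^+ m.
  move=> t0; apply: le_trans (weak _ _) _; apply: ler_piMr; first by rewrite mulr_ge0.
  by rewrite -[leRHS]expR0 ler_expR oppr_le0.
have small m t : 5 / 2 * ln N%:R <= t ->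
    C0 * eps ^- m * expR (- t) <= `|C0| * expR (- (5 / 2 * ln N%:R)) * eps^-1 ^+ m.
  move=> tm; apply: le_trans (weak _ _) _; rewrite mulrAC; apply: ler_wpM2r => //.
  by apply: ler_wpM2l => //; rewrite ler_expR lerN2.
exists DS', D1, D2, D12; split; last first.
  by move=> p Op; rewrite uE// /total_sum /layer_sum /addD S0 E10 E20 E120 !addrA.
split => //.
- by move=> i j p ij Op; rewrite SE//; exact: le_trans (Sle _ _ _ _ _) C0le.
- move=> i j p ij Op; have [h _ _] := Ele i j p ij Op; have [/andP[_ p1] _] := Op.
  by rewrite E1E//; apply: le_trans h (one _ _ _); exact: pos.
- move=> i j p ij Op; have [_ h _] := Ele i j p ij Op; have [_ /andP[_ p2]] := Op.
  by rewrite E2E//; apply: le_trans h (one _ _ _); exact: pos.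
- move=> i j p ij Op; have [_ _ h] := Ele i j p ij Op; have [/andP[_ p1] /andP[_ p2]] := Op.
  rewrite E12E//; apply: le_trans h (one _ _ _); rewrite mulrDl.
  by apply: addr_ge0; exact: pos.
- move=> i j p ij Op pm; have [h _ _] := Ele i j p ij Op.
  by rewrite E1E//; apply: le_trans h (small _ _ _); exact: far.
- move=> i j p ij Op pm; have [_ h _] := Ele i j p ij Op.
  by rewrite E2E//; apply: le_trans h (small _ _ _); exact: far.
- move=> i j p ij Op pm; have [_ _ h] := Ele i j p ij Op; have [/andP[_ p1] /andP[_ p2]] := Op.
  rewrite E12E//; apply: le_trans h (small _ _ _); rewrite mulrDl.
  have := pos _ _ b10 p1; have := pos _ _ b20 p2.
  by case: pm => /far; [move=> /(_ b10)|move=> /(_ b20)]; lra.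
Qed.

Lemma coefficient_bounds {R : realType} (P : sdfem_data R) : data_ok P ->
  exists D1 D2 M, [/\ smooth 1 D1, smooth 1 D2, D1 0 0 = coef_b1 P & D2 0 0 = coef_b2 P] /\
    [/\ 1 <= M,
      forall r s p, (r + s <= 1)%N -> Omegabar p -> `|D1 r s p| <= M,
      forall r s p, (r + s <= 1)%N -> Omegabar p -> `|D2 r s p| <= M &
      forall p, Omegabar p -> `|coef_c P p| <= M].
Proof.
move=> [[Db1 [Db2 [/Ck_smooth[D1 [s1 e1 _]] /Ck_smooth[D2 [s2 e2 _]] _]]] [cc _ _ _ _]].
have bound (D : nat -> nat -> R * R -> R) : smooth 1 D -> exists2 M, 0 <= M &
    forall r s p, (r + s <= 1)%N -> Omegabar p -> `|D r s p| <= M.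
  move=> [cD _ _]; have [M0 M00 H0] := cont_bounded (cD 0%N 0%N isT).
  have [M1 M10 H1] := cont_bounded (cD 1%N 0%N isT).
  have [M2 M20 H2] := cont_bounded (cD 0%N 1%N isT).
  exists (M0 + M1 + M2) => [|[|[|r]] [|[|s]] p //= _ Op]; first by rewrite !addr_ge0.
  - by have := H0 p Op; lra.
  - by have := H2 p Op; lra.
  - by have := H1 p Op; lra.
have [M1 M10 H1] := bound _ s1; have [M2 M20 H2] := bound _ s2.
have [M3 M30 H3] := cont_bounded cc.
exists D1, D2, (1 + M1 + M2 + M3); split => //; split.
- lra.
- by move=> r s p rs Op; have := H1 r s p rs Op; lra.
- by move=> r s p rs Op; have := H2 r s p rs Op; lra.
- by move=> p Op; have := H3 p Op; lra.
Qed.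

Lemma total_sum_swap {R : realType} (S E1 E2 E12 : nat -> nat -> R * R -> R) :
  total_sum (swapD S) (swapD E2) (swapD E1) (swapD E12) = swapD (total_sum S E1 E2 E12).
Proof.
apply/funext => i; apply/funext => j; apply/funext => p.
by rewrite /total_sum /layer_sum /addD /swapD; ring.
Qed.

Section energy_estimate.
Context {R : realType}.
Variables (P : sdfem_data R) (eps C M rho : R) (N : nat) (uI uN : R * R -> R).
Variables (S E1 E2 E12 D1 D2 : nat -> nat -> R * R -> R).
Local Notation q := (N%:R^-1 : R).
Local Notation L := (ln N%:R : R).
Local Notation kap := (expR (- (5 / 2 * L)) : R).
Local Notation n := N./2.
Local Notation X := (node_x P eps N).
Local Notation Y := (node_y P eps N).
Local Notation T := (mesh_tri X Y).
Local Notation sx := (slope_x P eps N).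
Local Notation sy := (slope_y P eps N).
Local Notation D := (total_sum S E1 E2 E12).
Local Notation wt := (weight n eps q L).
Local Notation ar := (tri_area X Y).
Local Notation size := ((eps * q ^+ 2 + q ^+ 3) * L ^+ 3).
Local Notation mx := (1 - lambda_x P eps N).
Local Notation my := (1 - lambda_y P eps N).
Local Notation chi := (fun p => uI p - uN p).
Local Notation w := (fun p => uI p - D 0 0 p).
Hypotheses (b10 : 0 < beta1 P) (b20 : 0 < beta2 P) (mu_gt0 : 0 < mu0 P) (Cs0 : 0 < Cstar P).
Hypotheses (mok : mesh_ok P eps N) (cc : cont (coef_c P)) (cf : cont (source P)).
Hypotheses (C0 : 0 <= C) (sc : scales N n eps q L rho kap).
Hypotheses (lmX : layer_mesh N n eps q L rho mx X) (lmY : layer_mesh N n eps q L rho my Y).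
Hypothesis ly : layers eps kap mx my C S E1 E2 E12.
Hypotheses (s1 : smooth 1 D1) (s2 : smooth 1 D2).
Hypotheses (b1E : D1 0 0 = coef_b1 P) (b2E : D2 0 0 = coef_b2 P) (M1 : 1 <= M).
Hypothesis D1M : forall r s p, (r + s <= 1)%N -> Omegabar p -> `|D1 r s p| <= M.
Hypothesis D2M : forall r s p, (r + s <= 1)%N -> Omegabar p -> `|D2 r s p| <= M.
Hypothesis cM : forall p, Omegabar p -> `|coef_c P p| <= M.
Hypothesis pde : forall p, Omega p ->
  - eps * (D 2 0 p + D 0 2 p) + (coef_b1 P p * D 1 0 p + coef_b2 P p * D 0 1 p)
  + coef_c P p * D 0 0 p = source P p.
Hypothesis VuI : VN P eps N uI.
Hypothesis nodesE : forall i j, (i <= N)%N -> (j <= N)%N -> uI (X i, Y j) = D 0 0 (X i, Y j).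
Hypothesis solN : is_sdfem_solution P eps N uN.
Hypothesis coer : coercive P eps N.

Let pX := partition_x b10 mok.
Let pY := partition_y b20 mok.
Let cell := cell_node b10 b20 mok.
Let Vchi : VN P eps N chi. Proof. by apply: VN_sub => //; case: solN. Qed.
Let oT i j b : (i < N)%N -> (j < N)%N -> open (T i j b).
Proof. by move=> *; exact: tri_open. Qed.
Let sT i j b : (i < N)%N -> (j < N)%N -> T i j b `<=` Omega.
Proof. by move=> iN jN; apply: tri_sub; exact: cell. Qed.

Let sD : smooth 2 D.
Proof.
apply: smooth_add; first exact: ly_S ly.
apply: (smooth_le (m := 3)) => //; apply: smooth_add; last exact: ly_E12 ly.
by apply: smooth_add; [exact: ly_E1 ly|exact: ly_E2 ly].
Qed.

Let c_b1 : cont (coef_b1 P). Proof. by rewrite -b1E; case: s1 => cD _ _; exact: cD. Qed.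
Let c_b2 : cont (coef_b2 P). Proof. by rewrite -b2E; case: s2 => cD _ _; exact: cD. Qed.
Let cchi : cont chi. Proof. exact: VN_cont Vchi. Qed.
Let cuI : cont uI. Proof. exact: VN_cont VuI. Qed.
Let cuN : cont uN. Proof. by case: solN => /VN_cont. Qed.
Let c00 : cont (D 0%R 0%R). Proof. by case: sD => cD _ _; exact: cD. Qed.
Let cw : cont w.
Proof. by apply: contB; [exact: VN_cont VuI|case: sD => cD _ _; exact: cD]. Qed.

Let sxE i j b : (i < N)%N -> (j < N)%N ->
  sx uI i j b = slope (X i) (X i.+1) (Y j) (Y j.+1) b (D 0 0).
Proof.
by move=> iN jN; rewrite /slope_x /slope; case: b => /=; rewrite !nodesE// ltnW.
Qed.

Let syE i j b : (i < N)%N -> (j < N)%N ->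
  sy uI i j b = slope (Y j) (Y j.+1) (X i) (X i.+1) b (fun p => D 0 0 (swap p)).
Proof.
by move=> iN jN; rewrite /slope_y /slope /swap; case: b => /=; rewrite !nodesE// ltnW.
Qed.

Let wE i j b p : (i < N)%N -> (j < N)%N -> T i j b p ->
  w p = interp (X i) (X i.+1) (Y j) (Y j.+1) b (D 0 0) p - D 0 0 p.
Proof.
move=> iN jN Tp /=; rewrite (VN_interp b10 b20 mok VuI iN jN Tp) /interp.
rewrite -(sxE b iN jN) -(syE b iN jN) /slope_x /slope_y.
by case: b {Tp} => /=; rewrite nodesE// ltnW.
Qed.

Let chiE i j b : (i < N)%N -> (j < N)%N -> exists a0, forall p, T i j b p ->
  chi p = a0 + sx chi i j b * p.1 + sy chi i j b * p.2.
Proof.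
move=> iN jN; exists (chi (if b then X i else X i.+1, if b then Y j else Y j.+1)
  - sx chi i j b * (if b then X i else X i.+1) - sy chi i j b * (if b then Y j else Y j.+1)).
move=> p Tp; rewrite (VN_interp b10 b20 mok Vchi iN jN Tp) /interp.
rewrite -/(sx chi i j b) -/(sy chi i j b).
by case: b {Tp}; ring.
Qed.

Let restT i j b := rest n eps q X Y S E1 E2 E12 i j b D1 D2 (coef_c P) chi w (Cstar P)
  (sx chi i j b) (sy chi i j b).

Let bgE i j b p : bg P eps N chi i j b p = D1 0 0 p * sx chi i j b + D2 0 0 p * sy chi i j b.
Proof. by rewrite b1E b2E. Qed.

Let rest_le i j b : (i < N)%N -> (j < N)%N ->
  J (T i j b) (restT i j b) <= eps / 16 * (sx chi i j b ^+ 2 + sy chi i j b ^+ 2) * ar i j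
    + mu0 P / 8 * J (T i j b) (fun p => chi p ^+ 2)
    + stab_param P N i j / 8 * J (T i j b) (fun p => bg P eps N chi i j b p ^+ 2)
    + rest_const rho C M (mu0 P) (Cstar P) * ((wt i + wt j) * ar i j).
Proof.
move=> iN jN; have ok := cell iN jN; have [_ _ e0 _ _] := mok.
have -> : J (T i j b) (fun p => bg P eps N chi i j b p ^+ 2) =
    J (T i j b) (fun p => (D1 0 0 p * sx chi i j b + D2 0 0 p * sy chi i j b) ^+ 2).
  by apply: eq_J => p _; rewrite bgE.
have q0 : 0 <= q by rewrite invr_ge0.
case nij : ((i < n)%N && (j < n)%N); rewrite /stab_param nij.
  have [ni nj] := andP nij; have [a0 cE] := chiE b iN jN.
  have := rest_coarse sc lmX lmY C0 ly iN jN s1 s2 cc cchi cw D1M D2M cM M1 mu_gt0 Cs0 cE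
    (fun p => @wE i j b p iN jN) ni nj.
  rewrite nij => h; apply: le_trans h _; rewrite -/(ar i j).
  suff : 0 <= eps / 16 * (sx chi i j b ^+ 2 + sy chi i j b ^+ 2) * ar i j by lra.
  have [[_ xx _] [_ yy _]] := ok.
  have h0 : 0 <= X i.+1 - X i by rewrite subr_ge0 ltW.
  have k0 : 0 <= Y j.+1 - Y j by rewrite subr_ge0 ltW.
  by rewrite /tri_area; nonneg.
have := rest_fine sc lmX lmY C0 ly iN jN (sx chi i j b) (sy chi i j b) s1 s2 cc cchi cw D1M D2M cM
  M1 mu_gt0 Cs0 (fun p => @wE i j b p iN jN) (negbT nij).
by move=> h; apply: le_trans h _; rewrite mul0r mul0r addr0.
Qed.

(** Coercivity puts one half of the squared norm on the left. The right takes back 1/8 + 1/16 of the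
    gradient parts and 1/8 of the other two, so at least 5/16 survives, whence 16/5. [slope_const]
    enters once per direction, and [6 * rho] comes from the total weight. *)
Lemma energy_estimate : norm_SD P eps N chi ^+ 2 <=
  16 / 5 * (2 * slope_const rho C + 6 * rho * rest_const rho C M (mu0 P) (Cstar P)) * size.
Proof.
have [_ _ e0 _ _] := mok.
have c10 : cont (D 1%R 0%R) by case: sD => cD _ _; exact: cD.
have c01 : cont (D 0%R 1%R) by case: sD => cD _ _; exact: cD.
have c20 : cont (D 2%R 0%R) by case: sD => cD _ _; exact: cD.
have c02 : cont (D 0%R 2%R) by case: sD => cD _ _; exact: cD.
have [c10n c01n c20n c02n] : [/\ cont (D 1%N 0%N), cont (D 0%N 1%N), cont (D 2%N 0%N) & cont (D 0%N 2%N)] by [].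
have cbg i j b : cont (bg P eps N chi i j b) by exact: bg_cont.
(* The y-slopes with transposed indices, as they appear on the mesh with exchanged coordinates. *)
pose gy i j b := sy chi j i b.
have nE : norm_SD P eps N chi ^+ 2 = mesh_sum N (fun i j b => eps * (sx chi i j b ^+ 2 * ar i j))
    + mesh_sum N (fun i j b => eps * (sy chi i j b ^+ 2 * ar i j))
    + mesh_sum N (fun i j b => mu0 P * J (T i j b) (fun p => chi p ^+ 2))
    + mesh_sum N (fun i j b => stab_param P N i j * J (T i j b) (fun p => bg P eps N chi i j b p ^+ 2)).
  rewrite (norm_SD_sq b10 b20 mok c_b1 c_b2 Vchi) ?ltW// -!mesh_sumD.
  apply: eq_mesh_sum => i j b iN jN; have ok := cell iN jN; have cb := cbg i j b.
  have oTK := oT (b := b) iN jN; have sTK := sT (b := b) iN jN.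
  rewrite JD//; try contt.
  rewrite JD//; try contt.
  rewrite !JZ//; try contt.
  by rewrite (J_cst ok) /tri_area; ring.
have sE : a_SD P eps N chi chi = mesh_sum N (slope_term eps X Y (sx chi) D)
    + mesh_sum N (fun i j b => slope_term eps Y X gy (swapD D) j i b)
    + mesh_sum N (fun i j b => J (T i j b) (restT i j b)).
  have [cb1x cb2y] : cont (D1 1%R 0%R) /\ cont (D2 0%R 1%R).
    by case: s1 => cD1 _ _; case: s2 => cD2 _ _; split; [exact: cD1|exact: cD2].
  have d1 p : Omega p -> is_derive p.1 1 (fun t => coef_b1 P (t, p.2)) (D1 1 0 p).
    by rewrite -b1E; case: s1 => _ dx _; exact: dx.
  have d2 p : Omega p -> is_derive p.2 1 (fun t => coef_b2 P (p.1, t)) (D2 0 1 p).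
    by rewrite -b2E; case: s2 => _ _ dy; exact: dy.
  apply: etrans; first exact: (error_identity b10 b20 mok c_b1 c_b2 cc cf sD cb1x cb2y d1 d2 pde VuI solN).
  rewrite -!mesh_sumD; apply: eq_mesh_sum => i j b iN jN; have cb := cbg i j b.
  have oTK := oT (b := b) iN jN; have sTK := sT (b := b) iN jN.
  have -> : slope_term eps Y X gy (swapD D) j i b =
      eps * (sy chi i j b * J (T i j b) (fun p => sy uI i j b - D 0 1 p)).
    rewrite /slope_term /gy -(J_mesh_swap pX pY b iN jN (f := fun p => sy uI i j b - D 0 1 p)); last by contt.
    by rewrite (syE b iN jN).
  have -> : slope_term eps X Y (sx chi) D i j b =
      eps * (sx chi i j b * J (T i j b) (fun p => sx uI i j b - D 1 0 p)).
    by rewrite /slope_term (sxE b iN jN).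
  have [d00 d10] : cont (D1 0%N 0%N) /\ cont (D2 0%N 0%N) by rewrite b1E b2E.
  have [d11 d21] : cont (D1 1%N 0%N) /\ cont (D2 0%N 1%N) by [].
  have c00n : cont (D 0%N 0%N) by [].
  have crest : cont (restT i j b) by rewrite /restT /rest; contt.
  rewrite -!JZ//; try contt.
  rewrite -!JD//; try contt.
  apply: eq_J => p _.
  rewrite /restT /rest (sxE b iN jN) (syE b iN jN) b1E b2E /bg /stab_param; ring.
have := coer Vchi; rewrite sE.
have tx : mesh_sum N (slope_term eps X Y (sx chi) D) <=
    mesh_sum N (fun i j b => eps * (sx chi i j b ^+ 2 * ar i j)) / 8 + slope_const rho C * size.
  apply: (total_slope_terms sc lmX lmY C0 ly) => [i j _|i iN|i iN].
  - exact: slope_x_shared.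
  - exact: (slope_x_bottom b10 b20 mok Vchi).
  - exact: (slope_x_top b10 b20 mok Vchi).
have ty : mesh_sum N (fun i j b => slope_term eps Y X gy (swapD D) j i b) <=
    mesh_sum N (fun i j b => eps * (sy chi i j b ^+ 2 * ar i j)) / 8 + slope_const rho C * size.
  rewrite -total_sum_swap mesh_sum_swap [in leRHS]mesh_sum_swap.
  apply: le_trans (total_slope_terms sc lmY lmX C0 (layers_swap ly) (g := gy) _ _ _) _.
  - by move=> i j _; exact: slope_y_shared.
  - by move=> i iN; exact: (slope_y_left b10 b20 mok Vchi).
  - by move=> i iN; exact: (slope_y_right b10 b20 mok Vchi).
  rewrite lerD2r ler_pM2r ?invr_gt0// le_eqVlt; apply/orP; left; apply/eqP.
  by apply: eq_mesh_sum => i j b _ _; rewrite /gy /tri_area; ring.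
have tr : mesh_sum N (fun i j b => J (T i j b) (restT i j b)) <=
    mesh_sum N (fun i j b => eps * (sx chi i j b ^+ 2 * ar i j)) / 16
    + mesh_sum N (fun i j b => eps * (sy chi i j b ^+ 2 * ar i j)) / 16
    + mesh_sum N (fun i j b => mu0 P * J (T i j b) (fun p => chi p ^+ 2)) / 8
    + mesh_sum N (fun i j b => stab_param P N i j * J (T i j b) (fun p => bg P eps N chi i j b p ^+ 2)) / 8
    + rest_const rho C M (mu0 P) (Cstar P) * mesh_sum N (fun i j _ => (wt i + wt j) * ar i j).
  rewrite ![mesh_sum _ _ / _]mulrC -!mesh_sumZ -!mesh_sumD; apply: le_mesh_sum => i j b iN jN.
  by apply: le_trans (rest_le b iN jN) _; rewrite le_eqVlt; apply/orP; left; apply/eqP; ring.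
have wsum := sum_weight_area sc lmX lmY.
have rc : 0 <= rest_const rho C M (mu0 P) (Cstar P).
  have Mge0 : 0 <= M by exact: le_trans M1.
  by rewrite /rest_const; nonneg.
have := ler_wpM2l rc wsum; rewrite nE.
set a1 := mesh_sum N (fun i j b => eps * (sx _ _ _ _ ^+ 2 * _)) in tx tr *.
set a2 := mesh_sum N (fun i j b => eps * (sy _ _ _ _ ^+ 2 * _)) in ty tr *.
set a3 := mesh_sum N (fun i j b => mu0 P * _) in tr *.
set a4 := mesh_sum N (fun i j b => stab_param P N i j * _) in tr *.
have ar0 i j : (i < N)%N -> (j < N)%N -> 0 <= ar i j.
  move=> iN jN; have [[_ xx _] [_ yy _]] := cell iN jN.
  have h0 : 0 <= X i.+1 - X i by rewrite subr_ge0 ltW.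
  have k0 : 0 <= Y j.+1 - Y j by rewrite subr_ge0 ltW.
  by rewrite /tri_area; nonneg.
have J0 i j b (f : R * R -> R) : 0 <= J (T i j b) (fun p => f p ^+ 2).
  by apply: Rintegral_ge0 => p _; exact: sqr_ge0.
have p1 : 0 <= a1.
  by apply: mesh_sum_ge0 => i j b iN jN; have := ar0 i j iN jN => ?; nonneg.
have p2 : 0 <= a2.
  by apply: mesh_sum_ge0 => i j b iN jN; have := ar0 i j iN jN => ?; nonneg.
have p3 : 0 <= a3.
  by apply: mesh_sum_ge0 => i j b iN jN; apply: mulr_ge0; [exact: ltW|exact: (J0 i j b chi)].
have p4 : 0 <= a4.
  apply: mesh_sum_ge0 => i j b iN jN; apply: mulr_ge0; last exact: (J0 i j b (bg P eps N chi i j b)).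
  by rewrite /stab_param; case: ifP => // _; rewrite mulr_ge0 ?invr_ge0// ltW.
move=> h1 h2; lra.
Qed.

End energy_estimate.

(** * Rate of convergence *)

(** The square of a sum of nonnegative terms dominates the sum of the squares; the half-integer
    powers become integer ones. *)
Lemma rate_sq {R : realType} (eps : R) (N : nat) : 0 < eps -> (0 < N)%N -> 1 <= ln N%:R :> R ->
  (eps * N%:R^-1 ^+ 2 + N%:R^-1 ^+ 3) * ln N%:R ^+ 3 <=
  ((eps `^ (1 / 2) * N%:R^-1 + N%:R `^ (- (3 / 2))) * ln N%:R `^ (3 / 2)) ^+ 2.
Proof.
move=> e0 N0 L1; have N0' : 0 <= N%:R :> R by exact: ler0n.
have half (x : R) n : 0 <= x -> (x `^ (n%:R / 2)) ^+ 2 = x ^+ n.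
  move=> x0; rewrite -powR_mulrn ?powR_ge0// -powRrM -powR_mulrn//.
  by congr (_ `^ _); field.
have aE : (eps `^ (1 / 2)) ^+ 2 = eps by rewrite (half eps 1%N) ?ltW// expr1.
have bE : (N%:R `^ (- (3 / 2))) ^+ 2 = N%:R^-1 ^+ 3 :> R.
  by rewrite powRN !exprVn (half N%:R 3%N).
have cE : (ln N%:R `^ (3 / 2)) ^+ 2 = ln N%:R ^+ 3 :> R by rewrite (half _ 3%N)// (le_trans _ L1).
rewrite exprMn cE; apply: ler_wpM2r; first by rewrite exprn_ge0// (le_trans _ L1).
rewrite sqrrD exprMn aE bE lerD2r lerDl.
by rewrite mulrn_wge0// !mulr_ge0 ?powR_ge0 ?invr_ge0.
Qed.

Theorem theorem3p1 (R : realType) (P : sdfem_data R) (C0 : R)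
  (hP : data_ok P)
  (hCstar : forall (eps : R) (N : nat), mesh_ok P eps N -> coercive P eps N) :
  exists C : R,
    forall (eps : R) (N : nat) (u uI uN : R * R -> R),
      mesh_ok P eps N ->
      is_solution P eps u ->
      decomposition P C0 eps u ->
      is_interpolant P eps N u uI ->
      is_sdfem_solution P eps N uN ->
      norm_eps P eps N (fun p => uI p - uN p)
        <= norm_SD P eps N (fun p => uI p - uN p) /\
      norm_SD P eps N (fun p => uI p - uN p)
        <= C * (eps `^ (1 / 2) * N%:R^-1 + N%:R `^ (- (3 / 2)))
             * ln N%:R `^ (3 / 2).
Proof.
have [D1 [D2 [M [[s1 s2 b1E b2E] [M1 D1M D2M cM]]]]] := coefficient_bounds hP.
have [_ [cc cf _ _ [b10 b20 mu_gt0 Cs0]]] := hP.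
(* A sum dominating 1 and every ratio that the meshes in both directions require, independent of
   [eps] and [N]. *)
pose rho := 1 + 5 / beta1 P + 5 / beta2 P + beta1 P / 5 + beta2 P / 5.
pose K := 16 / 5 * (2 * slope_const rho `|C0| + 6 * rho * rest_const rho `|C0| M (mu0 P) (Cstar P)).
have [r1 r2] : 0 < 5 / beta1 P /\ 0 < 5 / beta2 P by rewrite !divr_gt0.
have [rho1 rb1 rb2 rb3 rb4] : [/\ 1 <= rho, 5 / beta1 P <= rho, 5 / beta2 P <= rho,
    beta1 P / 5 <= rho & beta2 P / 5 <= rho] by rewrite /rho; split; lra.
have rho0 : 0 <= rho by exact: le_trans rho1.
have M0 : 0 <= M by exact: le_trans M1.
have K0 : 0 <= K by rewrite /K /rest_const /slope_const; nonneg.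
exists (Num.sqrt K) => eps N u uI uN mok [Du [cDu pde _]] dec [VuI uIE] solN.
have [N4 evN e0 _ [lx ly]] := mok; split.
  (* The two norms differ by the stabilization sum, which is nonnegative. *)
  rewrite /norm_eps /norm_SD ler_wsqrtr// lerDl; apply: sumr_ge0 => k _.
  rewrite (deltaE b10 b20 mok); apply: mulr_ge0.
    by rewrite /stab_param; case: ifP => // _; rewrite mulr_ge0 ?invr_ge0// ltW.
  by apply: Rintegral_ge0 => p _; rewrite -expr2 sqr_ge0.
have [S [E1 [E2 [E12 [lay uE]]]]] := decomposition_layers b10 b20 mok dec.
pose D := total_sum S E1 E2 E12.
have [Du' [sDu Du0 DuE]] := Ck_smooth cDu.
have sD : smooth 2 D.
  apply: smooth_add; first exact: ly_S lay.
  apply: (smooth_le (m := 3)) => //; apply: smooth_add; last exact: ly_E12 lay.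
  by apply: smooth_add; [exact: ly_E1 lay|exact: ly_E2 lay].
(* The differential equation is known for the derivatives of u; it is transferred to the summed
   derivatives of the decomposition. *)
have DE : forall i j p, (i + j <= 2)%N -> Omega p -> D i j p = Du i j p.
  move=> i j p ij Op; rewrite -DuE; last exact: Omega_sub.
  by apply: (smooth_unique sD sDu) => // r /Omega_sub /uE; rewrite Du0.
have pX := partition_x b10 mok; have pY := partition_y b20 mok.
have est : norm_SD P eps N (fun p => uI p - uN p) ^+ 2 <=
    K * ((eps * N%:R^-1 ^+ 2 + N%:R^-1 ^+ 3) * ln N%:R ^+ 3).
  apply: (energy_estimate b10 b20 mu_gt0 Cs0 mok cc cf (normr_ge0 C0) (mesh_scales mok rho1)
    (shishkin_layer_mesh mok b10 rho1 rb1 rb3 lx) (shishkin_layer_mesh mok b20 rho1 rb2 rb4 ly)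
    lay s1 s2 b1E b2E M1 D1M D2M cM) => //.
  - move=> p Op; rewrite -(pde p Op) -!DE// (uE p)//; exact: Omega_sub.
  - move=> i j iN jN; rewrite uIE// uE//; split; rewrite /=.
      exact: (partition_range pX).
    exact: (partition_range pY).
  - exact: hCstar.
have := ler_wpM2l K0 (rate_sq e0 (ltn_trans _ N4) (ln_ge1 mok)).
move=> /(_ isT)/(le_trans est).
rewrite -{1}(sqr_sqrtr K0) -exprMn mulrA ler_sqr ?nnegrE//; first exact: sqrtr_ge0.
by rewrite !mulr_ge0 ?sqrtr_ge0 ?addr_ge0 ?mulr_ge0 ?powR_ge0 ?invr_ge0.
Qed.
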